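(* Let $(a_n)_{n\ge1},(g_n)_{n\ge1},(d_n)_{n\ge1}$ be real sequences with $a_1=0$, $a_n>0$ for $n\ge2$, $g_n\ge0$ for $n\ge1$, $d_1=0$, $d_n\ge0$ for $n\ge2$, and let $b_{n,i}\ge0$ ($1\le n<i$, $i\ge2$) satisfy $\sum_{n=1}^{i-1}nb_{n,i}=i$ for all $i\ge2$. Let $\mathsf a_n=a_n+d_n$, $\theta_n=a_n+g_n+d_n$ and $\Delta^{(m)}_n=n^m-\sum_{k=1}^{n-1}k^mb_{k,n}$ for $n\ge2$. Let the spaces $X_m$ and the operators be as in the context. 1. Let $m>1$ and $m'>m$ be such that $$\liminf_{n\to\infty}\frac{n(a_n+d_n)}{g_n}\ge m'\qquad\text{and}\qquad \liminf_{n\to\infty}\frac{a_n}{\mathsf a_n}\frac{\Delta_n^{(m)}}{n^m}>\frac m{m'} .$$ Then $$(Y_m,D(K_m)):=(K_m+D_m^++B_m,\,D(K_m))=\overline{(T_m+G_m^-+D_m^++B_m,\,D(T_m))}$$ generates a positive $C_0$-semigroup in $X_m$. If additionally $\liminf_{n\to\infty}(a_n+d_n)=\infty$ and either $\sum_{n=1}^\infty\frac1{g_n}<\infty$ or $\lim_{n\to\infty}\frac n{g_n}=0$, then $R(\lambda,Y_m)$ is compact for sufficiently large $\lambda$. 2. If for some $m>1$ $$\liminf_{n\to\infty}\frac{a_n}{\theta_n}\frac{\Delta_n^{(m)}}{n^m}>0,$$ then for every $k\ge m$ the operator $$(U_k,D(T_k)):=(A_k+G_k+D_k+B_k,\,D(T_k))=(Y_k,D(Y_k)),$$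 where $D(T_k)=D(A_k+G_k^0+D_k^0)$ and $Y_k=K_k+D_k^++B_k$ with $D(Y_k)=D(K_k)$, generates a positive analytic semigroup in $X_k$.
   Context: For $m\ge1$, $X_m=\ell^1_m$ is the Banach lattice of sequences $f=(f_n)_{n\ge1}$ with $\|f\|_{[m]}=\sum_{n\ge1}n^m|f_n|<\infty$ (coordinatewise order). For a diagonal matrix $\mathcal P=\mathrm{diag}(p_n)_{n\ge1}$, $P_m$ denotes the operator $P_mf=(p_nf_n)_n$ in $X_m$ with domain $D(P_m)=\{f\in X_m:(p_nf_n)_n\in X_m\}$. In this way $A_m,D^0_m,G^0_m,T_m$ are the operators associated with $\mathrm{diag}(-a_n)$, $\mathrm{diag}(-d_n)$, $\mathrm{diag}(-g_n)$ and $\mathrm{diag}(-\theta_n)$, respectively; $D(T_m)=D(A_m)\cap D(D_m^0)\cap D(G_m^0)$. Off-diagonal parts: $[G_m^-f]_n=g_{n-1}f_{n-1}$ (with $g_0f_0=0$) for $f\in D(T_m)$; $[D_m^+f]_n=d_{n+1}f_{n+1}$ for $f\in D(D_m^0)$; $[B_mf]_n=\sum_{i=n+1}^\infty a_ib_{n,i}f_i$ for $f\in D(A_m)$. All of these map their domains into $X_m$. On $D(T_m)$, the sum $A_m+G_m+D_m+B_m$ means $T_m+G_m^-+D_m^++B_m$ (i.e. $G_m=G_m^0+G_m^-$, $D_m=D_m^0+D_m^+$). $K_m$ is the maximal operator $[K_mf]_n=g_{n-1}f_{n-1}-\theta_nf_n$ with domain $D(K_m)=\{f\in X_m:\sum_{n=2}^\infty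 n^m|\theta_nf_n-g_{n-1}f_{n-1}|<\infty\}$. When $\liminf_{n\to\infty} n(a_n+d_n)/g_n\ge m'$ for some $m'>m$, one has $D(K_m)\subset D(A_m)\cap D(D_m^0)$, so $D_m^++B_m$ is defined on $D(K_m)$; the hypothesis of part 2 implies this for every $k\geq m$ in place of $m$. $R(\lambda,Y)=(\lambda I-Y)^{-1}$; the overline denotes closure in $X_m$. Quotients with $g_n=0$ and positive numerator are read as $+\infty$. *)

(* Defs.v *)
From HB Require Import structures.
From mathcomp Require Import all_boot all_order all_algebra.
From mathcomp Require Import complex.
From mathcomp Require Import all_classical all_reals all_analysis.

Set Implicit Arguments.
Unset Strict Implicit.
Unset Printing Implicit Defensive.

Import Order.TTheory GRing.Theory Num.Theory.
Import numFieldNormedType.Exports.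

Local Open Scope classical_set_scope.
Local Open Scope ring_scope.

(* Sequences indexed by n >= 1 are functions on nat that vanish at 0, so that
   indices agree with the mathematical ones and f_0 = 0. *)

Section wl1_carrier.
Context {R : realType}.
Implicit Types (m : R) (f : nat -> R).

Definition wl1_sum m f : \bar R :=
  (\sum_(1 <= n <oo) (n%:R `^ m * `|f n|)%:E)%E.

Definition wl1_set m : set (nat -> R) :=
  [set f | f 0%N = 0 /\ (wl1_sum m f < +oo)%E].

Definition wl1_pred m : {pred nat -> R} := mem (wl1_set m).

Lemma wl1_term_ge0 m f n : (0 <= (n%:R `^ m * `|f n|)%:E)%E.
Proof. by rewrite lee_fin mulr_ge0// powR_ge0. Qed.

Lemma wl1_sum_ge0 m f : (0 <= wl1_sum m f)%E.
Proof. by apply: nneseries_ge0 => n _ _; exact: wl1_term_ge0. Qed.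

Lemma wl1_sumD m f g : (wl1_sum m (f + g)%R <= wl1_sum m f + wl1_sum m g)%E.
Proof.
rewrite /wl1_sum -nneseriesD; [|by move=> n _ _; exact: wl1_term_ge0..].
apply: lee_nneseries => [n _ _|n _]; first exact: wl1_term_ge0.
by rewrite -EFinD lee_fin -mulrDr ler_wpM2l ?powR_ge0// ler_normD.
Qed.

Lemma wl1_sumZ m (c : R) f : wl1_sum m (c *: f)%R = (`|c|%:E * wl1_sum m f)%E.
Proof.
rewrite /wl1_sum -nneseriesZl; last by move=> n _; exact: wl1_term_ge0.
by apply: eq_eseriesr => n _; rewrite -EFinM normrM mulrCA.
Qed.

Fact wl1_submod_closed m : submod_closed (wl1_pred m).
Proof.
split=> [|c f g].
  rewrite inE; split=> //; rewrite /wl1_sum eseries0 ?ltry// => n _ _ /=.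
  by rewrite normr0 mulr0.
rewrite !inE => -[f0 fs] [g0 gs]; split.
  by rewrite -[LHS]/(c * f 0%N + g 0%N) f0 g0 mulr0 addr0.
apply: le_lt_trans (wl1_sumD _ _ _) _.
by rewrite lte_add_pinfty// wl1_sumZ lte_mul_pinfty// lee_fin.
Qed.

HB.instance Definition _ m :=
  GRing.isSubmodClosed.Build R (nat -> R) (wl1_pred m) (wl1_submod_closed m).

End wl1_carrier.

Record wl1 (R : realType) (m : R) := WL1 {
  wl1_fun :> nat -> R;
  wl1_funP : wl1_fun \in wl1_pred m }.

Section wl1_normed.
Context {R : realType} (m : R).
Local Notation X := (wl1 m).

HB.instance Definition _ := [isSub for @wl1_fun R m].
HB.instance Definition _ := [Choice of X by <:].
HB.instance Definition _ := [SubChoice_isSubLmodule of X by <:].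

Definition wl1_norm (f : X) : R := fine (wl1_sum m f).

Lemma wl1_sum_fin (f : X) : wl1_sum m f \is a fin_num.
Proof.
have := wl1_funP f; rewrite inE => -[_ fs].
by rewrite ge0_fin_numE// wl1_sum_ge0.
Qed.

Fact wl1_normD (f g : X) : wl1_norm (f + g) <= wl1_norm f + wl1_norm g.
Proof.
rewrite -fineD ?wl1_sum_fin// fine_le ?fin_numD ?wl1_sum_fin//.
exact: wl1_sumD.
Qed.

Fact wl1_normZ (c : R) (f : X) : wl1_norm (c *: f) = `|c| * wl1_norm f.
Proof. by rewrite /wl1_norm wl1_sumZ fineM// wl1_sum_fin. Qed.

Fact wl1_norm_eq0 (f : X) : wl1_norm f = 0 -> f = 0.
Proof.
move=> /eqP; rewrite fine_eq0 ?wl1_sum_fin// => /eqP f0.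
apply: val_inj; apply/funext => -[|n] /=.
  by have := wl1_funP f; rewrite inE => -[].
have : (((n.+1)%:R `^ m * `|f n.+1|)%:E <= 0)%E.
  rewrite -f0 /wl1_sum.
  apply: le_trans (nneseries_lim_ge (P := xpredT) n.+2 _); last first.
    by move=> i _ _; exact: wl1_term_ge0.
  rewrite big_nat_recr//= leeDr// sume_ge0//.
rewrite lee_fin pmulr_rle0 ?powR_gt0// normr_le0 => /eqP ->.
by [].
Qed.

HB.instance Definition _ :=
  Lmodule_isNormed.Build R X wl1_normD wl1_normZ wl1_norm_eq0.

End wl1_normed.

Section operators.
Context {R : realType} {V : normedModType R}.
Implicit Types (A B : set (V * V)) (T : R -> V -> V) (Q : V -> V).

(* An unbounded operator is identified with its graph. *)

Definition dom A : set V := fst @` A.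

(* The domain of the sum is dom A `&` dom B. *)
Definition op_add A B : set (V * V) :=
  [set u | exists f g, [/\ A (u.1, f), B (u.1, g) & u.2 = f + g]].

(* Q = (l I - A)^-1 is everywhere defined and bounded. *)
Definition is_resolvent A (l : R) Q :=
  [/\ linear Q, continuous Q & forall f g, Q f = g <-> A (g, l *: g - f)].

Definition compact_operator Q := precompact (Q @` [set f | `|f| <= 1]).

(* Only the values T t with 0 <= t are meaningful. *)
Definition C0_semigroup T :=
  [/\ forall t, 0 <= t -> linear (T t) /\ continuous (T t),
      forall f, T 0 f = f,
      forall s t, 0 <= s -> 0 <= t -> forall f, T (s + t) f = T s (T t f)
    & forall f, T t f @[t --> 0^'+] --> f].

Definition generator T : set (V * V) :=
  [set u | t^-1 *: (T t u.1 - u.1) @[t --> 0^'+] --> u.2].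

End operators.

Section analytic_semigroups.
Context {R : realType} {V : normedModType R}.

(* The pair (f, g) of V * V stands for f + i g.  The product (max) norm of
   V * V is equivalent to the usual norms of the complexification. *)
Definition cscale (z : R[i]) (u : V * V) : V * V :=
  (complex.Re z *: u.1 - complex.Im z *: u.2,
   complex.Im z *: u.1 + complex.Re z *: u.2).

Definition clinear (Q : V * V -> V * V) :=
  forall z u v, Q (cscale z u + v) = cscale z (Q u) + Q v.

Definition sector (delta : R) : set R[i] :=
  [set z | exists r t : R,
    [/\ 0 < r, `|t| < delta & z = Complex (r * cos t) (r * sin t)]].

(* Complex differentiability at z with respect to the operator norm. *)
Definition op_holomorphic_at (S : R[i] -> V * V -> V * V) (z : R[i]) :=
  exists L : V * V -> V * V, [/\ clinear L, continuous L &
    forall eps : R, 0 < eps -> \forall h \near (0 : R[i]^o)^', forall u,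
      `|cscale h^-1 (S (z + h) u - S z u) - L u| <= eps * `|u|].

(* S : V_C -> V_C is an analytic semigroup of angle delta. *)
Definition analytic_semigroup (delta : R) (S : R[i] -> V * V -> V * V) :=
  [/\ forall z, sector delta z -> clinear (S z) /\ continuous (S z),
      forall u, S 0 u = u,
      forall z w, sector delta z -> sector delta w ->
        forall u, S (z + w) u = S z (S w u),
      forall z, sector delta z -> op_holomorphic_at S z
    & forall delta' : R, 0 < delta' < delta -> forall u,
        S z u @[z --> within (sector delta') (nbhs (0 : R[i]^o))] --> u].

(* The complexification of T extends to an analytic semigroup. *)
Definition is_analytic (T : R -> V -> V) :=
  exists (delta : R) (S : R[i] -> V * V -> V * V),
    [/\ 0 < delta <= pi / 2, analytic_semigroup delta S &
      forall t, 0 <= t -> forall f g, S (Complex t 0) (f, g) = (T t f, T t g)].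

End analytic_semigroups.

Section growth_fragmentation.
Context {R : realType} (a d g : nat -> R) (b : nat -> nat -> R) (m : R).
Local Notation X := (wl1 m).

Definition theta (n : nat) : R := a n + g n + d n.

Definition Delta (n : nat) : R :=
  n%:R `^ m - \sum_(1 <= k < n) k%:R `^ m * b k n.

(* The requirement that the image lies in X gives the domain
   {f in X | (p_n f_n)_n in X}; likewise for K_op below. *)
Definition diag_op (p : nat -> R) : set (X * X) :=
  [set u : X * X | forall n, (1 <= n)%N -> u.2 n = p n * u.1 n].

Definition A_op := diag_op (fun n => - a n).
Definition D0_op := diag_op (fun n => - d n).
Definition G0_op := diag_op (fun n => - g n).
Definition T_op := diag_op (fun n => - theta n).

(* For n = 1 the right-hand side is 0, because u.1 0 = 0. *)
Definition Gminus_op : set (X * X) :=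
  [set u : X * X | dom T_op u.1 /\
    forall n, (1 <= n)%N -> u.2 n = g n.-1 * u.1 n.-1].

Definition Dplus_op : set (X * X) :=
  [set u : X * X | dom D0_op u.1 /\
    forall n, (1 <= n)%N -> u.2 n = d n.+1 * u.1 n.+1].

Definition B_op : set (X * X) :=
  [set u : X * X | dom A_op u.1 /\
    forall n, (1 <= n)%N ->
      \sum_(n.+1 <= i < N) a i * b n i * u.1 i @[N --> \oo] --> u.2 n].

Definition K_op : set (X * X) :=
  [set u : X * X | forall n, (1 <= n)%N ->
    u.2 n = g n.-1 * u.1 n.-1 - theta n * u.1 n].

Definition U_op := op_add (op_add (op_add T_op Gminus_op) Dplus_op) B_op.

Definition Y_op := op_add (op_add K_op Dplus_op) B_op.

End growth_fragmentation.

Arguments diag_op {R} m p.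
Arguments A_op {R} a m.
Arguments D0_op {R} d m.
Arguments G0_op {R} g m.
Arguments T_op {R} a d g m.
Arguments Gminus_op {R} a d g m.
Arguments Dplus_op {R} d m.
Arguments B_op {R} a b m.
Arguments K_op {R} a d g m.
Arguments U_op {R} a d g b m.
Arguments Y_op {R} a d g b m.

Definition positive_semigroup {R : realType} (m : R)
    (T : R -> wl1 m -> wl1 m) :=
  forall t, 0 <= t -> forall f : wl1 m,
    (forall n, 0 <= f n) -> forall n, 0 <= T t f n.

(* Main.v *)
(* In the weights [n ^ m], the column sums of the matrix of [Y] are bounded by
   [w n^m - c s_n n^m] for some [c > 0], where [s = a + d] in part 1 and
   [s = theta] in part 2: the fragmentation and death terms dominate the growth
   term [((n + 1)^m - n^m) g_n ~ m n^(m-1) g_n] up to finitely many [n], which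
   [w] absorbs.  Summation gives [(l - w) |f| + c |s f| <= |(l - Y) f|], and
   [l - Y] is onto because the resolvent equation has a minimal nonnegative
   solution, a monotone limit of finitely supported iterates.  Yosida
   approximation then yields the positive semigroup, and the resolvent is
   compact because its image of the unit ball has uniformly small tails when
   [a + d] tends to infinity.

   In part 2, [|Y f| <= (2^k + 3) |theta f|], so that
   [(l - w) |f| + c' |Y f| <= |(l - Y) f|] with [c' > 0].  In the norm
   [|f| + |g|] of the complexification, multiplication by [i] is an isometry,
   so the rotated operators [z Y] with [|Im z| <= c' Re z] remain
   quasi-dissipative; this extends the semigroup to a sector and bounds
   [t |Y e^(tY)|], which gives holomorphy. *)

Require Import Defs.
From mathcomp Require Import all_boot all_order all_algebra.
From mathcomp Require Import complex.
From mathcomp Require Import all_classical all_reals all_analysis.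
From mathcomp Require Import ring lra.

Set Implicit Arguments.
Unset Strict Implicit.
Unset Printing Implicit Defensive.

Import Order.TTheory GRing.Theory Num.Theory.
Import numFieldNormedType.Exports.

Local Open Scope classical_set_scope.
Local Open Scope ring_scope.

(** * Exponentials of bounded operators *)

(** The estimates on exponentials use no vector-valued integral. Each is reduced to a one-step
    inequality for a real function with an error [K * h ^+ 2]; [K] may depend on the operator, since
    it disappears when the step is refined, and only constants uniform in the Yosida index survive.
    The analytic semigroup is not built by a contour integral of the resolvent either. Exponentials
    of complex multiples of the same Yosida approximants converge on a cone, so the extension
    property on the real half-line is inherited from the approximants. The obstacle in part 1 is
    that elements of the domain of [K] only have [(a + d) f] summable, while [theta f] and [g f]
    need not be. Column sums are therefore taken over finite sections: the growth flux leaves a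
    section with the favourable sign, and the inflow from beyond it, by death and fragmentation, is
    small because [(a + d) f] is summable. One such inequality, for nonnegative subsolutions, serves
    twice: for [|f|] it gives dissipativity, for the iterates of the minimal solution it gives
    convergence. *)

Section bounded_operators.
Context {R : realType} {V : normedModType R}.
Implicit Types (X Y : V -> V) (f g : V).

(** Stated for sequences because it then passes to [V * V] and is proved for [wl1 m] through
    coordinatewise limits. *)
Definition seq_complete (W : normedModType R) := forall u : nat -> W,
  (forall e : R, 0 < e -> exists N, forall m n, (N <= m)%N -> (N <= n)%N ->
     `|u m - u n| <= e) -> cvgn u.

Definition bop X :=
  linear X /\ exists2 K : R, 0 <= K & forall f, `|X f| <= K * `|f|.

Lemma lin0 X : linear X -> X 0 = 0.
Proof.
move=> lX; have := lX (-1) 0 0; rewrite scaler0 addr0 scaleN1r addNr.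
exact: id.
Qed.

Lemma linD X : linear X -> {morph X : f g / f + g}.
Proof. by move=> lX f g; have := lX 1 f g; rewrite !scale1r. Qed.

Lemma linZ X : linear X -> forall c, {morph X : f / c *: f}.
Proof. by move=> lX c f; have := lX c f 0; rewrite !addr0 lin0// addr0. Qed.

Lemma linN X : linear X -> {morph X : f / - f}.
Proof. by move=> lX f; rewrite -scaleN1r linZ// scaleN1r. Qed.

Lemma linB X : linear X -> {morph X : f g / f - g}.
Proof. by move=> lX f g; rewrite linD// linN. Qed.

Lemma lin_sum X (I : Type) (r : seq I) (P : pred I) (F : I -> V) : linear X ->
  X (\sum_(i <- r | P i) F i) = \sum_(i <- r | P i) X (F i).
Proof. by move=> lX; apply: (big_morph X (linD lX) (lin0 lX)). Qed.

Lemma bop_id : bop id.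
Proof. by split=> //; exists 1 => // f; rewrite mul1r. Qed.

Lemma bop_comp X Y : bop X -> bop Y -> bop (X \o Y).
Proof.
move=> [lX [K K0 hK]] [lY [L L0 hL]]; split.
  by move=> c f g /=; rewrite lY lX.
exists (K * L); first exact: mulr_ge0.
by move=> f /=; rewrite (le_trans (hK _))// -mulrA ler_wpM2l.
Qed.

Lemma bop_add X Y : bop X -> bop Y -> bop (fun f => X f + Y f).
Proof.
move=> [lX [K K0 hK]] [lY [L L0 hL]]; split.
  by move=> c f g; rewrite lY lX scalerDr addrACA.
exists (K + L); first exact: addr_ge0.
by move=> f; rewrite (le_trans (ler_normD _ _))// mulrDl lerD.
Qed.

Lemma bop_scale (c : R) X : bop X -> bop (fun f => c *: X f).
Proof.
move=> [lX [K K0 hK]]; split.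
  by move=> s f g; rewrite lX scalerDr !scalerA mulrC.
exists (`|c| * K); first exact: mulr_ge0.
by move=> f; rewrite normrZ -mulrA ler_wpM2l.
Qed.

Lemma bop_iter X n : bop X -> bop (iter n X).
Proof.
by move=> bX; elim: n => [|n IHn]; [exact: bop_id | exact: bop_comp].
Qed.

Lemma bop_cvg X (u : nat -> V) l : bop X -> u @ \oo --> l ->
  X \o u @ \oo --> X l.
Proof.
move=> [lX [K K0 hK]] /cvgrPdist_le ul; apply/cvgrPdist_le => e e0.
(* [K + 1] instead of [K], which may be 0. *)
have := ul (e / (K + 1)); rewrite divr_gt0 ?ltr_wpDl// => /(_ isT).
apply: filterS => n /=; rewrite -linB// => h; rewrite (le_trans (hK _))//.
rewrite (@le_trans _ _ ((K + 1) * (e / (K + 1))))//; last first.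
  by rewrite mulrC divfK// gt_eqF// ltr_wpDl.
by rewrite ler_pM// lerDl.
Qed.

Lemma bop_continuous X : bop X -> continuous X.
Proof.
move=> [lX [K K0 hK]] x; apply/cvgrPdist_le => e e0; near=> t.
rewrite -linB// (le_trans (hK _))//.
rewrite (@le_trans _ _ ((K + 1) * (e / (K + 1))))//; last first.
  by rewrite mulrC divfK// gt_eqF// ltr_wpDl.
rewrite ler_pM// ?lerDl//; near: t.
by apply: cvgr_dist_le => //; rewrite divr_gt0 ?ltr_wpDl.
Unshelve. all: by end_near. Qed.

End bounded_operators.

Section exponential.
Context {R : realType} {V : normedModType R}.
Implicit Types (X Y : V -> V) (f g : V) (K L : R).

Definition expt X f n : V := n`!%:R^-1 *: iter n X f.
Definition oexp X f : V := limn (series (expt X f)).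

Lemma expt_bnd X K f n : 0 <= K -> (forall f, `|X f| <= K * `|f|) ->
  `|expt X f n| <= exp_coeff K n * `|f|.
Proof.
move=> K0 hK; rewrite /expt normrZ ger0_norm ?invr_ge0// exp_coeffE/= -mulrA.
rewrite ler_wpM2l ?invr_ge0//.
elim: n => [|n IHn] /=; first by rewrite mul1r.
by rewrite (le_trans (hK _))// exprS -mulrA ler_wpM2l.
Qed.

Lemma series_expt_bnd X K f n : 0 <= K -> (forall f, `|X f| <= K * `|f|) ->
  `|series (expt X f) n| <= series (exp_coeff K) n * `|f|.
Proof.
move=> K0 hK; rewrite /series/= (le_trans (ler_norm_sum _ _ _))//.
by rewrite mulr_suml ler_sum// => i _; exact: expt_bnd.
Qed.

Lemma series_exp_coeff_le K n : 0 <= K -> series (exp_coeff K) n <= expR K.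
Proof.
move=> K0; apply: nondecreasing_cvgn_le; last exact: is_cvg_series_exp_coeff.
by apply: nondecreasing_series => i _ _; exact: exp_coeff_ge0.
Qed.

Lemma limn_norm_le (u : nat -> V) (l : V) (C : R) : u @ \oo --> l ->
  (forall n, `|u n| <= C) -> `|l| <= C.
Proof.
move=> ul uC; have ul' : `|u n| @[n --> \oo] --> `|l| by exact: cvg_norm.
by apply: (cvgr_to_le ul'); apply: nearW.
Qed.

Hypothesis HV : seq_complete V.

Lemma oexp_cvg X f : bop X -> series (expt X f) @ \oo --> oexp X f.
Proof.
move=> [lX [K K0 hK]]; apply: HV => e e0.
have /cauchy_cvgP/cauchy_seriesP : cvgn (series (exp_coeff K)).
  exact: is_cvg_series_exp_coeff.
have d0 : 0 < e / (`|f| + 1) by rewrite divr_gt0// ltr_wpDl.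
move=> /(_ _ d0) [[A B] [[N1 _ h1] [N2 _ h2]] AB].
exists (maxn N1 N2) => m n; wlog mn : m n / (m <= n)%N.
  move=> wh; case: (leqP m n) => [|/ltnW] mn hm hn; first exact: wh.
  by rewrite distrC; exact: wh.
rewrite !geq_max => /andP[m1 m2] /andP[n1 n2].
rewrite distrC sub_series_geq// (le_trans (ler_norm_sum _ _ _))//.
have := AB (m, n) (conj (h1 _ m1) (h2 _ n2)) => /= /ltW h.
rewrite (@le_trans _ _ (`|\sum_(m <= k < n) exp_coeff K k| * `|f|))//.
  rewrite ger0_norm; last by rewrite sumr_ge0// => i _; exact: exp_coeff_ge0.
  by rewrite mulr_suml ler_sum// => i _; exact: expt_bnd.
rewrite (@le_trans _ _ (e / (`|f| + 1) * (`|f| + 1)))//.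
  by rewrite ler_pM// lerDl.
by rewrite divfK// gt_eqF// ltr_wpDl.
Qed.
Arguments oexp_cvg [X] f _.

Lemma oexp_bnd X K f : linear X -> 0 <= K ->
  (forall f, `|X f| <= K * `|f|) -> `|oexp X f| <= expR K * `|f|.
Proof.
move=> lX K0 hK; have bX : bop X by split=> //; exists K.
apply: (limn_norm_le (oexp_cvg f bX)) => n; rewrite (le_trans (series_expt_bnd _ _ _ hK))//.
by rewrite ler_wpM2r// series_exp_coeff_le.
Qed.

Lemma oexp_linear X : bop X -> linear (oexp X).
Proof.
move=> bX c f g.
have h1 : c *: series (expt X f) n + series (expt X g) n @[n --> \oo] -->
    c *: oexp X f + oexp X g.
  by apply: cvgD; [apply: cvgZl_tmp|]; exact: oexp_cvg.
apply: (cvg_unique _ (oexp_cvg (c *: f + g) bX)) => //.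
suff -> : series (expt X (c *: f + g)) =
   (fun n => c *: series (expt X f) n + series (expt X g) n) by [].
apply/funext => n; rewrite /series/= scaler_sumr -big_split/=.
apply: eq_bigr => i _; rewrite /expt scalerA mulrC -scalerA -scalerDr.
by have [-> _] := bop_iter i bX.
Qed.

Lemma oexp_bop X : bop X -> bop (oexp X).
Proof.
move=> bX; split; first exact: oexp_linear.
case: bX => lX [K K0 hK]; exists (expR K); first exact: expR_ge0.
by move=> f; exact: oexp_bnd.
Qed.

Lemma oexp_comm X Y f : bop X -> bop Y -> (forall f, X (Y f) = Y (X f)) ->
  Y (oexp X f) = oexp X (Y f).
Proof.
move=> bX bY XY.
apply: (cvg_unique _ (bop_cvg bY (oexp_cvg f bX))) => //.
suff -> : Y \o series (expt X f) = series (expt X (Y f)) by exact: oexp_cvg.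
apply/funext => n; rewrite /series/= lin_sum; last by case: bY.
apply: eq_bigr => i _; rewrite /expt linZ; last by case: bY.
by congr (_ *: _); elim: i => //= i <-; rewrite XY.
Qed.

(* The terms of order [n + 2] of the series are dominated by [K ^ 2] times
   the terms of order [n] of the series of [expR K]. *)
Lemma oexp_rem X K f : linear X -> 0 <= K ->
  (forall f, `|X f| <= K * `|f|) ->
  `|oexp X f - f - X f| <= K ^+ 2 * expR K * `|f|.
Proof.
move=> lX K0 hK; have bX : bop X by split=> //; exists K.
have h : series (expt X f) n.+2 - f - X f @[n --> \oo] --> oexp X f - f - X f.
  apply: cvgB; last exact: cvg_cst; apply: cvgB; last exact: cvg_cst.
  have := oexp_cvg f bX; rewrite -(@cvg_shiftn 2).
  by under [in X in X -> _]eq_fun do rewrite addn2.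
apply: (limn_norm_le h) => n.
rewrite /series/= big_nat_recl// big_nat_recl// /expt/= invr1 !scale1r.
rewrite [X in `|X|](_ : _ = \sum_(0 <= i < n) expt X f i.+2); last first.
  by rewrite [f + _]addrC addrK [X f + _]addrC addrK.
rewrite (le_trans (ler_norm_sum _ _ _))//.
rewrite (@le_trans _ _ (K ^+ 2 * series (exp_coeff K) n * `|f|))//.
  rewrite /series/= mulr_sumr mulr_suml ler_sum// => i _.
  rewrite (le_trans (expt_bnd _ _ K0 hK))// ler_wpM2r//.
  rewrite !exp_coeffE/= [leRHS]mulrCA -exprD add2n ler_wpM2r ?exprn_ge0//.
  by rewrite lef_pV2 ?posrE ?ltr0n ?fact_gt0// ler_nat leq_fact// -addn2 leq_addr.
by rewrite ler_wpM2r// ler_wpM2l ?exprn_ge0// series_exp_coeff_le.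
Qed.

(* The [(i, j)] term of the product of the series of [X] and [Y]. *)
Definition expxy X Y f i j : V := expt X (expt Y f j) i.

Lemma expt_rec X f n : linear X -> X (expt X f n) = n.+1%:R *: expt X f n.+1.
Proof.
move=> lX; rewrite /expt linZ// scalerA factS natrM invfM mulrA.
by rewrite divff ?mul1r// pnatr_eq0.
Qed.

Lemma expt_linear X n : linear X -> linear (fun f => expt X f n).
Proof.
move=> lX c f g /=; rewrite /expt scalerA mulrC -scalerA -scalerDr.
by congr (_ *: _); elim: n => //= n ->; exact: lX.
Qed.

Lemma exptC X Y f n : linear X -> linear Y -> (forall f, X (Y f) = Y (X f)) ->
  Y (expt X f n) = expt X (Y f) n.
Proof.
move=> lX lY XY; rewrite /expt linZ//; congr (_ *: _).
by elim: n => //= n <-; rewrite XY.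
Qed.

(** The binomial theorem for powers divided by factorials. Induction replaces binomial coefficients:
    multiplied by [n + 1], the term of order [n + 1] is [X + Y] applied to the term of order [n],
    and the factors [i] and [n + 1 - i] add up to [n + 1]. *)
Lemma expt_add X Y f n : linear X -> linear Y -> (forall f, X (Y f) = Y (X f)) ->
  expt (fun f => X f + Y f) f n = \sum_(i < n.+1) expxy X Y f i (n - i).
Proof.
move=> lX lY XY; have lXY : linear (fun f => X f + Y f).
  by move=> c f1 f2; rewrite lX lY scalerDr addrACA.
elim: n => [|n IHn].
  by rewrite big_ord1 /expxy /expt /= fact0 invr1 !scale1r.
have n0 : n.+1%:R != 0 :> R by rewrite pnatr_eq0.
apply: (scalerI n0); rewrite -expt_rec// IHn (lin_sum _ _ _ lX) (lin_sum _ _ _ lY) scaler_sumr.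
transitivity (\sum_(i < n.+2) i%:R *: expxy X Y f i (n.+1 - i) +
              \sum_(i < n.+2) (n.+1 - i)%:R *: expxy X Y f i (n.+1 - i)).
  congr (_ + _).
    rewrite [RHS]big_ord_recl [X in _ = X + _](_ : _ = 0) ?add0r; last by rewrite /= scale0r.
    apply: eq_bigr => i _.
    by rewrite /= /bump/= add1n subSS /expxy expt_rec.
  rewrite [RHS]big_ord_recr/= subnn [X in _ = _ + X](_ : _ = 0) ?addr0; last by rewrite /= scale0r.
  apply: eq_bigr => i _.
  have li : linear (fun g => expt X g i) by exact: expt_linear.
  by rewrite /expxy exptC// expt_rec// (linZ li) subSn// -ltnS.
rewrite -big_split/=; apply: eq_bigr => i _.
by rewrite -scalerDl -natrD subnKC// -ltnS.
Qed.

Lemma series_expt_add X Y f N : linear X -> linear Y ->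
  (forall f, X (Y f) = Y (X f)) ->
  series (expt (fun f => X f + Y f) f) N =
  \sum_(0 <= i < N) \sum_(0 <= j < N | (i + j < N)%N) expxy X Y f i j.
Proof.
move=> lX lY XY; rewrite /series/=.
transitivity (\sum_(0 <= n < N) \sum_(0 <= i < N | (i <= n)%N)
    expxy X Y f i (n - i)).
  apply: eq_big_nat => n /andP[_ nN]; rewrite expt_add//.
  by rewrite big_mkord (big_ord_widen_cond _ xpredT (fun i => expxy X Y f i (n - i)) nN).
rewrite (exchange_big_dep_nat xpredT)//=; apply: eq_big_nat => i /andP[_ iN].
rewrite (big_cat_nat _ (ltnW iN))//= big_nat_cond big_pred0 ?add0r; last first.
  by move=> n; case: (ltnP n i); rewrite ?andbF.
rewrite -{1}(add0n i) big_addn big_nat_cond [RHS](big_cat_nat _ (leq_subr i N))//=.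
rewrite [X in _ = _ + X]big_nat_cond [X in _ = _ + X]big_pred0 ?addr0; last first.
  move=> n; apply/negP => /andP[/andP[]].
  by rewrite leq_subLR => h _; rewrite ltnNge h.
rewrite [RHS]big_nat_cond; apply: eq_big => [n|n _]; last by rewrite addnK.
by rewrite leq_addl !andbT ltn_subRL andbb.
Qed.

Lemma series_expt2 X Y f N : linear X -> series (expt X (series (expt Y f) N)) N =
  \sum_(0 <= i < N) \sum_(0 <= j < N) expxy X Y f i j.
Proof.
move=> lX; rewrite /series/=; apply: eq_bigr => i _.
by rewrite (lin_sum _ _ _ (expt_linear i lX)).
Qed.

(** Both series are cut at the same [N]. The outer partial sums are bounded by [expR K] uniformly in
    [N], so the error of the inner one still tends to 0. *)
Lemma series_expt2_cvg X Y f : bop X -> bop Y ->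
  series (expt X (series (expt Y f) N)) N @[N --> \oo] --> oexp X (oexp Y f).
Proof.
move=> bX bY; have [lX [K K0 hK]] := bX.
apply: (@cvg_trans _ ((series (expt X (oexp Y f)) N -
    series (expt X (oexp Y f - series (expt Y f) N)) N) @[N --> \oo])).
  apply: near_eq_cvg; near=> N.
  rewrite /series/= -sumrB; apply: eq_bigr => i _.
  by rewrite -(linB (expt_linear i lX)) opprB addrC subrK.
rewrite -[oexp X (oexp Y f)]subr0; apply: cvgB; first exact: oexp_cvg.
apply/cvgr0Pnorm_le => e e0.
have d0 : 0 < e / expR K by rewrite divr_gt0// expR_gt0.
have /cvgrPdist_le/(_ _ d0) := oexp_cvg f bY.
apply: filterS => N h; rewrite (le_trans (series_expt_bnd _ _ K0 hK))//.
rewrite (@le_trans _ _ (expR K * (e / expR K)))//; last first.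
  by rewrite mulrC divfK// gt_eqF// expR_gt0.
by rewrite ler_pM ?sumr_ge0 ?series_exp_coeff_le// => i _; exact: exp_coeff_ge0.
Unshelve. all: by end_near. Qed.

End exponential.

Arguments oexp_cvg {R V} HV [X] f _.
Arguments series_expt2_cvg {R V} HV [X Y] f _ _.

(** * The exponential of a sum of commuting operators *)

Section exponential_law.
Context {R : realType} {V : normedModType R}.
Implicit Types (X Y : V -> V) (f g : V) (K L : R).

(** The scalar case of [series_expt_add], on the module [R^o] at the vector 1; it provides the
    majorant in [oexp_add]. *)
Lemma exp_coeff_product K L N :
  series (exp_coeff (K + L)) N =
  \sum_(0 <= i < N) \sum_(0 <= j < N | (i + j < N)%N)
     exp_coeff K i * exp_coeff L j.
Proof.
have E C (x : R^o) n : expt (fun y : R^o => C * y) x n = exp_coeff C n * x.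
  rewrite /expt exp_coeffE/= -mulrA; congr (_ * _).
  by elim: n => [|n IHn]; rewrite ?mul1r//= IHn exprS mulrA.
have lM C : linear (fun y : R^o => C * y).
  by move=> c x y; rewrite mulrDr mulrCA.
have := @series_expt_add R R^o _ _ 1 N (lM K) (lM L).
rewrite /series/= => H.
transitivity (\sum_(0 <= k < N) expt (fun y : R^o => K * y + L * y) 1 k).
  apply: eq_bigr => i _.
  have -> : (fun y : R^o => K * y + L * y) = (fun y => (K + L) * y).
    by apply/funext => y; rewrite mulrDl.
  by rewrite E mulr1.
rewrite H => [|x]; last by rewrite mulrCA.
by apply: eq_bigr => i _; apply: eq_bigr => j _; rewrite /expxy !E mulr1.
Qed.

Hypothesis HV : seq_complete V.

(** The product of partial sums runs over a square and the partial sum of the sum over the triangle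
    [i + j < N]. Their difference is dominated term by term by the same difference for the scalars
    [K] and [L], which vanishes in the limit by [expRD]. *)
Lemma oexp_add X Y f : bop X -> bop Y -> (forall f, X (Y f) = Y (X f)) ->
  oexp (fun f => X f + Y f) f = oexp X (oexp Y f).
Proof.
move=> bX bY XY.
have [lX [K K0 hK]] := bX; have [lY [L L0 hL]] := bY.
have h1 := oexp_cvg HV f (bop_add bX bY).
have h2 := series_expt2_cvg HV f bX bY.
have h : (series (expt X (series (expt Y f) N)) N -
   series (expt (fun f => X f + Y f) f) N) @[N --> \oo] --> (0 : V).
  apply/cvgr0Pnorm_le => e e0.
  have hs : (series (exp_coeff K) N * series (exp_coeff L) N -
      series (exp_coeff (K + L)) N) * `|f| @[N --> \oo] --> (0 : R).
    have -> : 0 = (expR K * expR L - expR (K + L)) * `|f|.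
      by rewrite expRD subrr mul0r.
    apply: cvgMr_tmp; apply: cvgB; last exact: is_cvg_series_exp_coeff.
    by apply: cvgM; exact: is_cvg_series_exp_coeff.
  have /cvgr0Pnorm_le/(_ e e0) := hs; apply: filterS => N; apply: le_trans.
  apply: le_trans (ler_norm _).
  rewrite exp_coeff_product series_expt2// series_expt_add//.
  rewrite /series/= big_distrl/= -!sumrB mulr_suml.
  rewrite (le_trans (ler_norm_sum _ _ _))// ler_sum// => i _.
  rewrite (bigID (fun j => i + j < N)%N)/= addrAC subrr add0r.
  rewrite big_distrr/= [in leRHS](bigID (fun j => i + j < N)%N)/= addrAC subrr add0r.
  rewrite (le_trans (ler_norm_sum _ _ _))// mulr_suml ler_sum// => j _.
  rewrite (le_trans (expt_bnd _ _ K0 hK))// -mulrA ler_wpM2l ?exp_coeff_ge0//.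
  exact: expt_bnd.
have E := cvgB h2 h1.
have /eqP : oexp X (oexp Y f) - oexp (fun f => X f + Y f) f = 0.
  by apply: (cvg_unique _ (E _)).
by rewrite subr_eq0 => /eqP ->.
Qed.

Lemma oexp0 f : oexp (fun _ => 0 : V) f = f.
Proof.
have b0 : bop (fun _ : V => 0 : V).
  by split=> [c x y|]; [rewrite scaler0 addr0 | exists 0 => // x; rewrite normr0 mul0r].
have h0 g : `|(0 : V)| <= (0 : R) * `|g| by rewrite normr0 mul0r.
have := @oexp_rem _ _ HV (fun _ => 0) 0 f b0.1 (lexx 0) h0.
rewrite expr0n !mul0r normr_le0 subr0 subr_eq0.
by move=> /eqP.
Qed.

Lemma oexp_scalar (c : R) f : oexp (fun f => c *: f) f = expR c *: f.
Proof.
have bc := bop_scale c (@bop_id R V).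
have h := oexp_cvg HV f bc.
apply: (cvg_unique _ h) => //.
suff -> : series (expt (fun f => c *: f) f) =
    (fun n => series (exp_coeff c) n *: f).
  by apply: cvgZr_tmp; exact: is_cvg_series_exp_coeff.
apply/funext => n; rewrite /series/= scaler_suml; apply: eq_bigr => i _.
rewrite /expt exp_coeffE/= -scalerA; congr (_ *: _).
by elim: i => [|i IHi]; rewrite ?scale1r//= IHi scalerA exprS.
Qed.

End exponential_law.

Opaque oexp.

(** * Discrete Gronwall inequalities *)

Section discrete_growth.
Context {R : realType}.
Implicit Types (q : R -> R) (t M K hm w kappa : R).

(** Replaces the integration of [q' <= M]: over [n] steps of length [t / n] the quadratic errors add
    up to [K t^2 / n]. *)
Lemma ler_sublinear_growth q t M K hm : 0 <= t -> 0 < hm ->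
  (forall s h, 0 <= s -> 0 <= h <= hm -> s + h <= t ->
     q (s + h) <= q s + h * M + K * h ^+ 2) ->
  q t <= q 0 + t * M.
Proof.
move=> t0 hm0 hq; apply/ler_addgt0Pr => e e0.
(* The first summand keeps the step below [hm], the second keeps the accumulated error below [e]. *)
pose C := t / hm + `|K| * t ^+ 2 / e + 1.
have C0 : 0 <= C by rewrite !addr_ge0 ?divr_ge0 ?mulr_ge0 ?exprn_ge0// ltW.
pose n := Num.bound C.
have nC : C < n%:R by exact: archi_boundP.
have n0 : 0 < n%:R :> R by rewrite (le_lt_trans C0).
pose h := t / n%:R.
have hn : h * n%:R = t by rewrite /h divfK// gt_eqF.
have h_ge0 : 0 <= h by rewrite divr_ge0// ltW.
have h_le : h <= hm.
  rewrite /h ler_pdivrMr// mulrC -ler_pdivrMr//.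
  apply: ltW; apply: le_lt_trans nC; rewrite /C -addrA lerDl.
  by rewrite addr_ge0// divr_ge0// ?mulr_ge0// ?exprn_ge0// ltW.
have IH j : (j <= n)%N -> q (j%:R * h) <= q 0 + j%:R * (h * M + K * h ^+ 2).
  elim: j => [|j IHj] jn; first by rewrite !mul0r addr0.
  rewrite -addn1 natrD !mulrDl !mul1r; apply: (le_trans (hq _ _ _ _ _)).
  - by rewrite mulr_ge0.
  - by rewrite h_ge0.
  - rewrite -[X in _ + X]mul1r -mulrDl natr1 -hn mulrC.
    by rewrite ler_wpM2l// ler_nat.
  - have := IHj (ltnW jn); rewrite mulrDr; lra.
have := IH n (leqnn n); rewrite mulrC hn => /le_trans; apply.
have -> : n%:R * (h * M + K * h ^+ 2) = t * M + K * t * h by rewrite -hn; ring.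
rewrite addrA lerD2l /h mulrA ler_pdivrMr//.
apply: (@le_trans _ _ (`|K| * t ^+ 2)).
  by rewrite -mulrA -expr2 ler_wpM2r ?exprn_ge0// ler_norm.
rewrite [e * _]mulrC -ler_pdivrMr//; apply: ltW; apply: le_lt_trans nC.
by rewrite /C -addrA [_ / e + 1]addrC addrA lerDr addr_ge0// divr_ge0// ltW.
Qed.

(** The integrating factor [expR (- (w * s))] reduces this to [ler_sublinear_growth]. Its least
    value on [[0, t]] is taken in front of the sink [kappa], and multiplying back by [expR (w * t)]
    cancels it. *)
Lemma ler_exp_growth q t w kappa K hm : 0 <= t -> 0 < hm -> 0 <= w ->
  0 <= kappa -> 0 <= K -> (forall s, 0 <= q s) ->
  (forall s h, 0 <= s -> 0 <= h <= hm -> s + h <= t ->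
     q (s + h) <= (1 + h * w) * q s - h * kappa + K * h ^+ 2) ->
  q t <= expR (w * t) * q 0 - t * kappa.
Proof.
move=> t0 hm0 w0 k0 K0 q0 hq.
pose p s := expR (- (w * s)) * q s.
suff : p t <= p 0 + t * (- (expR (- (w * t)) * kappa)).
  rewrite /p mulr0 oppr0 expR0 mul1r expRN => h.
  have E0 := expR_gt0 (w * t).
  rewrite -(ler_pM2l (_ : 0 < (expR (w * t))^-1)) ?invr_gt0//.
  rewrite (le_trans h)// mulrBr mulrA mulVf ?mul1r ?gt_eqF// lerD2l.
  by rewrite mulrN lerN2 mulrCA.
apply: (@ler_sublinear_growth p t _ K hm) => // s h s0 /andP[h1 h2] sht.
have e1 : expR (- (w * (s + h))) <= 1.
  by rewrite -expR0 ler_expR oppr_le0 mulr_ge0// addr_ge0.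
have e2 : expR (- (w * t)) <= expR (- (w * (s + h))).
  by rewrite ler_expR lerN2 ler_wpM2l.
rewrite /p; apply: (@le_trans _ _ (expR (- (w * (s + h))) *
   ((1 + h * w) * q s - h * kappa + K * h ^+ 2))).
  by rewrite ler_wpM2l ?expR_ge0// hq// h1.
rewrite mulrDr lerD//; last first.
  by rewrite ler_piMl// mulr_ge0// exprn_ge0.
rewrite mulrBr lerD//.
  rewrite mulrA ler_wpM2r//.
  apply: (@le_trans _ _ (expR (- (w * (s + h))) * expR (h * w))).
    by rewrite ler_wpM2l ?expR_ge0// expR_ge1Dx.
  by rewrite -expRD ler_expR; lra.
by rewrite !mulrN lerN2 mulrCA ler_wpM2r// mulr_ge0.
Qed.

End discrete_growth.

(** * Comparison of exponentials along a path *)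

Section interpolation.
Context {R : realType} {V : normedModType R}.
Implicit Types (X Y E : V -> V) (f g : V).
Hypothesis HV : seq_complete V.

Definition comm_op X Y := forall f, X (Y f) = Y (X f).
Definition sc (s : R) X : V -> V := fun f => s *: X f.

Lemma subrACA (x y z t : V) : (x - y) - (z - t) = (x - z) - (y - t).
Proof. by rewrite !opprD !opprK addrACA. Qed.

Lemma bop_sc s X : bop X -> bop (sc s X).
Proof. exact: bop_scale. Qed.

Lemma oexp_scD X s h f : bop X ->
  oexp (sc (s + h) X) f = oexp (sc s X) (oexp (sc h X) f).
Proof.
move=> bX; rewrite -(oexp_add HV) ?bop_sc//.
- by congr (oexp _ f); apply/funext => g; rewrite /sc scalerDl.
- exact: bop_sc.
- exact: bop_sc.
- by move=> g; rewrite /sc !(linZ bX.1) !scalerA mulrC.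
Qed.

Lemma comm_sc s X Y : linear Y -> comm_op X Y -> comm_op (sc s X) Y.
Proof. by move=> lY XY f; rewrite /sc XY linZ. Qed.

Lemma comm_sym X Y : comm_op X Y -> comm_op Y X.
Proof. by move=> XY f. Qed.

Lemma comm_oexp X Y : bop X -> bop Y -> comm_op X Y -> comm_op (oexp X) Y.
Proof. by move=> bX bY XY f; rewrite (oexp_comm HV). Qed.

Lemma comm_sc2 s t X Y : linear X -> linear Y -> comm_op X Y ->
  comm_op (sc s X) (sc t Y).
Proof.
move=> lX lY XY; apply: comm_sc.
  by move=> c f g; rewrite /sc lY scalerDr !scalerA mulrC.
by apply: comm_sym; apply: comm_sc => //; exact: comm_sym.
Qed.

Lemma comm_oexp2 X Y : bop X -> bop Y -> comm_op X Y ->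
  comm_op (oexp X) (oexp Y).
Proof.
move=> bX bY XY; apply: comm_oexp => //; first exact: oexp_bop.
by apply: comm_sym; apply: comm_oexp => //; exact: comm_sym.
Qed.

Lemma sc_bnd X K s : (forall f, `|X f| <= K * `|f|) -> 0 <= K -> 0 <= s <= 1 ->
  forall f, `|sc s X f| <= K * `|f|.
Proof.
move=> hK K0 /andP[s0 s1] f; rewrite /sc normrZ ger0_norm//.
by rewrite (le_trans _ (hK f))// ler_piMl.
Qed.

Lemma oexp_sc_bnd X K s f : linear X -> 0 <= K ->
  (forall f, `|X f| <= K * `|f|) -> 0 <= s <= 1 ->
  `|oexp (sc s X) f| <= expR K * `|f|.
Proof.
move=> lX K0 hK s01; apply: (oexp_bnd HV) => //; last exact: sc_bnd.
by have [] : bop (sc s X) by apply: bop_sc; split=> //; exists K.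
Qed.

Lemma oexp_sc_rem X K h f : linear X -> 0 <= K ->
  (forall f, `|X f| <= K * `|f|) -> 0 <= h <= 1 ->
  `|oexp (sc h X) f - f - h *: X f| <= h ^+ 2 * (K ^+ 2 * expR K) * `|f|.
Proof.
move=> lX K0 hK /andP[h0 h1].
apply: (@le_trans _ _ ((h * K) ^+ 2 * expR (h * K) * `|f|)).
  apply: (oexp_rem HV) => //.
  - by have [] : bop (sc h X) by apply: bop_sc; split=> //; exists K.
  - by rewrite mulr_ge0.
  - by move=> g; rewrite /sc normrZ ger0_norm// -mulrA ler_wpM2l.
rewrite ler_wpM2r// exprMn -mulrA ler_wpM2l ?exprn_ge0// ler_wpM2l ?exprn_ge0//.
by rewrite ler_expR ler_piMl.
Qed.

(** The path [F s = exp (s X) exp ((1 - s) X') E g] joins the two vectors, and its derivative is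
    [exp (s X) exp ((1 - s) X') E (X g - X' g)]. The factor [E] serves the Taylor estimate
    [cexp_taylor], where the exponentials are uniformly bounded only after composition with [E]. *)
Lemma oexp_interpolation X X' E M g : bop X -> bop X' -> bop E ->
  comm_op X X' -> comm_op X E -> comm_op X' E ->
  (forall s s' f, 0 <= s -> 0 <= s' -> s + s' <= 1 ->
     `|oexp (sc s X) (oexp (sc s' X') (E f))| <= M * `|f|) ->
  `|oexp X (E g) - oexp X' (E g)| <= M * `|X g - X' g|.
Proof.
move=> bX bX' bE XX' XE X'E hM.
have [lX [K K0 hK]] := bX; have [lX' [L L0 hL]] := bX'.
pose F s := oexp (sc s X) (oexp (sc (1 - s) X') (E g)).
have F1 : F 1 = oexp X (E g).
  rewrite /F subrr; have -> : sc 0 X' = (fun _ => 0).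
    by apply/funext => f; rewrite /sc scale0r.
  rewrite (oexp0 HV); congr (oexp _ _).
  by apply/funext => f; rewrite /sc scale1r.
have F0 : F 0 = oexp X' (E g).
  rewrite /F subr0; have -> : sc 0 X = (fun _ => 0).
    by apply/funext => f; rewrite /sc scale0r.
  rewrite (oexp0 HV); congr (oexp _ _).
  by apply/funext => f; rewrite /sc scale1r.
rewrite -F1 -F0.
suff : `|F 1 - F 0| <= `|F 0 - F 0| + 1 * (M * `|X g - X' g|).
  by rewrite subrr normr0 add0r mul1r.
pose C := (K ^+ 2 * expR K + L ^+ 2 * expR L) * `|E g|.
apply: (@ler_sublinear_growth R (fun s => `|F s - F 0|) 1 _ (expR K * (expR L * C)) 1).
  exact: ler01.
  exact: ltr01.
move=> s h s0 /andP[h0 h1] sh1.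
have -> : F (s + h) - F 0 = (F s - F 0) + (F (s + h) - F s).
  by rewrite [RHS]addrC addrA subrK.
rewrite -[leRHS]addrA (le_trans (ler_normD _ _))// lerD2l.
pose r := (oexp (sc h X) (E g) - E g - h *: X (E g)) -
          (oexp (sc h X') (E g) - E g - h *: X' (E g)).
(* [Z] is the common factor: [F (s + h)] and [F s] are its values at one step of length [h] driven
   by [X] and by [X']; [r] collects the second-order errors of both steps. *)
pose Z f := oexp (sc s X) (oexp (sc (1 - (s + h)) X') f).
have bZ : bop Z by apply: bop_comp; apply: (oexp_bop HV); exact: bop_sc.
have Zr : F (s + h) - F s = h *: Z (E (X g - X' g)) + Z r.
  have -> : F (s + h) = Z (oexp (sc h X) (E g)).
    rewrite /F /Z (oexp_scD _ _ _ bX); congr (oexp (sc s X) _).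
    by apply: comm_oexp2; [exact: bop_sc..|exact: comm_sc2 lX lX' XX'].
  have -> : F s = Z (oexp (sc h X') (E g)).
    have e : 1 - s = 1 - (s + h) + h by ring.
    by rewrite /F e (oexp_scD (1 - (s + h)) h (E g) bX').
  rewrite -(linZ bZ.1) -(linD bZ.1) -(linB bZ.1); congr (Z _).
  rewrite /r (linB bE.1) scalerBr XE X'E.
  rewrite [in RHS]subrACA [RHS]addrC subrK.
  by rewrite [RHS]subrACA subrr subr0.
rewrite Zr (le_trans (ler_normD _ _))// lerD//.
  rewrite normrZ ger0_norm// ler_wpM2l// /Z hM//; first by rewrite subr_ge0.
  by lra.
apply: (@le_trans _ _ (expR K * (expR L * `|r|))).
  rewrite (le_trans (oexp_sc_bnd _ lX K0 hK _))//; first by rewrite s0; lra.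
  by rewrite ler_wpM2l ?expR_ge0// oexp_sc_bnd//; lra.
rewrite -2!mulrA ler_wpM2l ?expR_ge0// ler_wpM2l ?expR_ge0//.
have h01 : 0 <= h <= 1 by rewrite h0.
have -> : C * h ^+ 2 = h ^+ 2 * (K ^+ 2 * expR K) * `|E g| +
    h ^+ 2 * (L ^+ 2 * expR L) * `|E g| by rewrite /C; ring.
by rewrite (le_trans (ler_normB _ _))// lerD// oexp_sc_rem.
Qed.

Lemma oexp_sub_bound X E M g : bop X -> bop E -> comm_op X E ->
  (forall s f, 0 <= s <= 1 -> `|oexp (sc s X) (E f)| <= M * `|f|) ->
  `|oexp X (E g) - E g| <= M * `|X g|.
Proof.
move=> bX bE XE hM.
have b0 : bop (fun _ : V => 0 : V).
  by split=> [c x y|]; [rewrite scaler0 addr0 | exists 0 => // x; rewrite normr0 mul0r].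
have := @oexp_interpolation X (fun _ => 0) E M g bX b0 bE.
rewrite (oexp0 HV) subr0; apply => //.
- by move=> f; rewrite (lin0 bX.1).
- by move=> f; rewrite (lin0 bE.1).
- move=> s s' f s0 s'0 ss'; have -> : sc s' (fun _ : V => 0 : V) = (fun _ => 0).
    by apply/funext => f'; rewrite /sc scaler0.
  by rewrite (oexp0 HV) hM// s0; lra.
Qed.

(** Apply the mean value inequality to [F s = exp (s X) E g - s X E g], whose derivative is
    [exp (s X) E X g - E X g]. *)
Lemma oexp_sub2_le X E g (C : R) : bop X -> bop E -> comm_op X E ->
  (forall s, 0 <= s <= 1 -> `|oexp (sc s X) (E (X g)) - E (X g)| <= C) ->
  `|oexp X (E g) - E g - X (E g)| <= C.
Proof.
move=> bX bE XE hC; have [lX [K K0 hK]] := bX.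
pose F s := oexp (sc s X) (E g) - s *: X (E g).
have F1 : F 1 = oexp X (E g) - X (E g).
  rewrite /F scale1r; congr (oexp _ _ - _).
  by apply/funext => f; rewrite /sc scale1r.
have F0 : F 0 = E g.
  rewrite /F scale0r subr0; have -> : sc 0 X = (fun _ => 0).
    by apply/funext => f; rewrite /sc scale0r.
  by rewrite (oexp0 HV).
have -> : oexp X (E g) - E g - X (E g) = F 1 - F 0 by rewrite F1 F0 addrAC.
suff : `|F 1 - F 0| <= `|F 0 - F 0| + 1 * C.
  by rewrite subrr normr0 add0r mul1r.
pose D := K ^+ 2 * expR K * `|E g|.
apply: (@ler_sublinear_growth R (fun s => `|F s - F 0|) 1 _ (expR K * D) 1).
  exact: ler01.
  exact: ltr01.
move=> s h s0 /andP[h0 h1] sh1.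
have -> : F (s + h) - F 0 = (F s - F 0) + (F (s + h) - F s).
  by rewrite [RHS]addrC addrA subrK.
rewrite -[leRHS]addrA (le_trans (ler_normD _ _))// lerD2l.
have bs := bop_sc s bX.
have bZ := oexp_bop HV bs.
pose r := oexp (sc h X) (E g) - E g - h *: X (E g).
have s01 : 0 <= s <= 1 by rewrite s0; lra.
have Zr : F (s + h) - F s =
    h *: (oexp (sc s X) (E (X g)) - E (X g)) + oexp (sc s X) r.
  rewrite /F (oexp_scD _ _ _ bX) subrACA -(linB bZ.1) scalerDl.
  rewrite [_ - s *: _]addrC addKr.
  rewrite /r [oexp (sc s X) (_ - h *: _)](linB bZ.1) scalerBr -(linZ bZ.1) XE.
  by rewrite [RHS]addrC addrA subrK.
rewrite Zr (le_trans (ler_normD _ _))// lerD//.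
  by rewrite normrZ ger0_norm// ler_wpM2l// hC.
rewrite (le_trans (oexp_sc_bnd _ lX K0 hK _))// -mulrA ler_wpM2l ?expR_ge0//.
by rewrite mulrC /D mulrA oexp_sc_rem// h0.
Qed.

(** A second-order Taylor estimate with both factors [X] acting on [g]. It is meant for a smoothed
    [g], on which [X (X g)] is bounded uniformly in the approximation. *)
Lemma oexp_sub2_bound X E M g : 0 <= M -> bop X -> bop E -> comm_op X E ->
  (forall s f, 0 <= s <= 1 -> `|oexp (sc s X) (E f)| <= M * `|f|) ->
  `|oexp X (E g) - E g - X (E g)| <= M * `|X (X g)|.
Proof.
move=> M0 bX bE XE hM; apply: oexp_sub2_le => // s /andP[s0 s1].
apply: (@le_trans _ _ (M * `|sc s X (X g)|)).
  apply: oexp_sub_bound => //; first exact: bop_sc.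
    exact: comm_sc bE.1 XE.
  move=> s' f /andP[s'0 s'1].
  have -> : sc s' (sc s X) = sc (s' * s) X.
    by apply/funext => f'; rewrite /sc scalerA.
  by rewrite hM// mulr_ge0//= mulr_ile1.
by rewrite ler_wpM2l// /sc normrZ ger0_norm// ler_piMl.
Qed.

End interpolation.

(** * Strong convergence of exponentials *)

Section approximation.
Context {R : realType} {W : normedModType R}.
Hypothesis HW : seq_complete W.
Implicit Types (f g : W).

Lemma cvgn_cauchy (u : nat -> W) : cvgn u -> forall e : R, 0 < e ->
  exists N, forall m n, (N <= m)%N -> (N <= n)%N -> `|u m - u n| <= e.
Proof.
move=> cu e e0; have e20 : 0 < e / 2 by rewrite divr_gt0.
have /cvgrPdist_le/(_ _ e20)[N _ hN] := cu.
exists N => m n Nm Nn; rewrite -(subrKA (limn u)).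
rewrite (le_trans (ler_normD _ _))// (splitr e) lerD//.
  by rewrite distrC; exact: hN.
exact: hN.
Qed.

Lemma cvgn_dense (Z : nat -> W -> W) (M : R) (D : set W) :
  (forall n, linear (Z n)) -> (forall n f, `|Z n f| <= M * `|f|) ->
  (forall f (e : R), 0 < e -> exists2 g, D g & `|f - g| <= e) ->
  (forall g, D g -> cvgn (Z ^~ g)) -> forall f, cvgn (Z ^~ f).
Proof.
move=> lZ hM dD cD f; apply: HW => e e0.
have M10 : 0 < `|M| + 1 by rewrite ltr_wpDl.
have d0 : 0 < e / 3 / (`|M| + 1) by rewrite !divr_gt0.
have [g Dg fg] := dD f _ d0.
have e30 : 0 < e / 3 by rewrite divr_gt0.
have [N hN] := cvgn_cauchy (cD _ Dg) e30.
exists N => m n Nm Nn.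
have h k : `|Z k f - Z k g| <= e / 3.
  rewrite -(linB (lZ k)) (le_trans (hM _ _))//.
  rewrite (@le_trans _ _ ((`|M| + 1) * (e / 3 / (`|M| + 1))))//; last first.
    by rewrite mulrC divfK// gt_eqF.
  rewrite (@le_trans _ _ ((`|M| + 1) * `|f - g|))//.
    by rewrite ler_wpM2r// (le_trans (ler_norm _))// lerDl.
  by rewrite ler_wpM2l// ltW.
have -> : Z m f - Z n f = (Z m f - Z m g) + (Z m g - Z n g) - (Z n f - Z n g).
  by rewrite subrKA opprB subrKA.
have -> : e = e / 3 + e / 3 + e / 3 by field.
rewrite (le_trans (ler_normB _ _))// lerD// (le_trans (ler_normD _ _))//.
by rewrite lerD// hN.
Qed.

(** On [D], interpolation bounds the difference of two exponentials by [M ^ 2] times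
    [X m g - X n g], which is Cauchy; uniform boundedness and density do the rest. The sign of [M]
    is not fixed, hence the absolute values. *)
Lemma oexp_seq_cvgn (X : nat -> W -> W) (M : R) (D : set W) :
  (forall n, bop (X n)) -> (forall m n, comm_op (X m) (X n)) ->
  (forall n s f, 0 <= s <= 1 -> `|oexp (sc s (X n)) f| <= M * `|f|) ->
  (forall f (e : R), 0 < e -> exists2 g, D g & `|f - g| <= e) ->
  (forall g, D g -> cvgn (X ^~ g)) ->
  forall f, cvgn (fun n => oexp (X n) f).
Proof.
move=> bX cX hM dD cD f; apply: (@cvgn_dense (fun n => oexp (X n)) M D) => //.
- by move=> n; exact: oexp_linear.
- move=> n g; have := hM n 1 g; rewrite ler01 lexx => /(_ isT).
  by have -> : sc 1 (X n) = X n by apply/funext => h; rewrite /sc scale1r.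
move=> g Dg; apply: HW => e e0.
have MM0 : 0 < `|M| ^+ 2 + 1 by rewrite ltr_wpDl// exprn_ge0.
have d0 : 0 < e / (`|M| ^+ 2 + 1) by rewrite divr_gt0.
have [N hN] := cvgn_cauchy (cD _ Dg) d0.
exists N => m n Nm Nn.
apply: (@le_trans _ _ (`|M| ^+ 2 * `|X m g - X n g|)).
  apply: (@oexp_interpolation _ _ HW _ _ id) => //; first exact: bop_id.
  move=> s s' h s0 s'0 ss'.
  have hM' k r u : 0 <= r <= 1 -> `|oexp (sc r (X k)) u| <= `|M| * `|u|.
    by move=> r01; rewrite (le_trans (hM _ _ _ r01))// ler_wpM2r// ler_norm.
  rewrite (le_trans (hM' _ _ _ _))//; first by rewrite s0; lra.
  by rewrite expr2 -mulrA ler_wpM2l// hM'// s'0; lra.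
rewrite (@le_trans _ _ ((`|M| ^+ 2 + 1) * (e / (`|M| ^+ 2 + 1))))//; last first.
  by rewrite mulrC divfK// gt_eqF.
by rewrite ler_pM ?exprn_ge0// ?lerDl// hN.
Qed.

End approximation.

(** * The Hille-Yosida theorem *)

Section yosida.
Context {R : realType} {V : normedModType R}.
Implicit Types (A : set (V * V)) (l w c : R) (f g : V) (B : nat -> V -> V).

(* Dissipativity strengthened by a multiple of the norm of the image: the case
   [c > 0], which is what makes the semigroup analytic, is specific to
   [L^1]-type norms. *)
Definition dissipative A w c (l0 : R) := forall l f g, l0 < l -> A (f, g) ->
  (l - w) * `|f| + c * `|g| <= `|l *: f - g|.

Definition lin_graph A := forall (a : R) u v, A u -> A v -> A (a *: u + v).

Lemma resolvent_ex A w c l : w < l -> 0 <= c ->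
  lin_graph A -> dissipative A w c w ->
  (forall h, exists f, A (f, l *: f - h)) ->
  exists Q, is_resolvent A l Q /\
    forall h, (l - w) * `|Q h| + c * `|l *: Q h - h| <= `|h|.
Proof.
move=> wl c0 linA dA rA.
have /choice[Q hQ] := rA.
have lw0 : 0 < l - w by rewrite subr_gt0.
have inj f g h : A (f, l *: f - h) -> A (g, l *: g - h) -> f = g.
  move=> Af Ag; have := dA l _ _ wl (linA (-1) _ _ Ag Af).
  have -> : l *: (-1 *: g + f) - (-1 *: (l *: g - h) + (l *: f - h)) = 0.
    rewrite !scaleN1r ![- _ + _]addrC scalerBr [l *: f - h - _]subrACA.
    by rewrite subrr subr0 subrr.
  rewrite normr0 => h0.
  have : (l - w) * `|-1 *: g + f| <= 0.
    by apply: le_trans h0; rewrite lerDl mulr_ge0.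
  by rewrite pmulr_rle0// normr_le0 scaleN1r addrC subr_eq0 => /eqP ->.
have est h : (l - w) * `|Q h| + c * `|l *: Q h - h| <= `|h|.
  by have := dA l _ _ wl (hQ h); rewrite subKr.
have bnd h : `|Q h| <= (l - w)^-1 * `|h|.
  rewrite -(ler_pM2l lw0) mulrA divff ?mul1r ?gt_eqF//.
  by apply: le_trans (est h); rewrite lerDl mulr_ge0.
have linQ : linear Q.
  move=> a f g; apply: (inj _ _ (a *: f + g)); first exact: hQ.
  have := linA a _ _ (hQ f) (hQ g).
  suff -> : a *: (Q f, l *: Q f - f) + (Q g, l *: Q g - g) =
    (a *: Q f + Q g, l *: (a *: Q f + Q g) - (a *: f + g)) by [].
  apply: injective_projections => //=.
  by rewrite scalerBr scalerDr !scalerA [l * a]mulrC opprD addrACA.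
exists Q; split=> //; split=> //.
  apply: bop_continuous; split=> //; exists (l - w)^-1 => //.
  by rewrite invr_ge0 ltW.
move=> f g; split=> [<-|Ag]; first exact: hQ.
by apply: inj Ag; exact: hQ.
Qed.

(** For [l] different from [k], the resolvent identity gives [P - Q] as [(l - k)] times either
    product; for [l = k] both resolvents coincide. *)
Lemma resolvent_comm A l k Q P : is_resolvent A l Q -> is_resolvent A k P ->
  comm_op Q P.
Proof.
move=> [lQ _ hQ] [lP _ hP] h.
have [lk|lk] := eqVneq l k.
  have QP u : Q u = P u by apply/hQ; rewrite lk; exact/hP.
  by rewrite !QP.
have QP u : (l - k) *: Q (P u) = P u - Q u.
  have : Q ((l - k) *: P u + u) = P u.
    apply/hQ; have /hP : P u = P u by [].
    by rewrite scalerBl opprD opprB addrA addrCA subrr addr0.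
  by rewrite lQ => E; rewrite -[in RHS]E addrK.
have PQ u : (l - k) *: P (Q u) = P u - Q u.
  have : P ((k - l) *: Q u + u) = Q u.
    apply/hP; have /hQ : Q u = Q u by [].
    by rewrite scalerBl opprD opprB addrA addrCA subrr addr0.
  rewrite lP => E; rewrite -[in RHS]E opprD addrCA subrr addr0.
  by rewrite -scaleNr opprB.
by apply: (@scalerI _ _ (l - k)); rewrite ?subr_eq0// QP PQ.
Qed.

Variables (A : set (V * V)) (w c : R) (Q : nat -> V -> V) (N0 : nat).
Hypotheses (w0 : 0 <= w) (c0 : 0 <= c) (HN0 : 2 * w < N0%:R).
Hypothesis QR : forall n, is_resolvent A (n + N0)%:R (Q n).
Hypothesis Qest : forall n h, ((n + N0)%:R - w) * `|Q n h| +
  c * `|(n + N0)%:R *: Q n h - h| <= `|h|.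

(** The classical approximant [l (l Q - 1)] for [l = n + N0]; the shift by [N0] makes every
    parameter larger than [2 w]. *)
Definition yosida n f : V := (n + N0)%:R *: ((n + N0)%:R *: Q n f - f).

Local Notation ln n := ((n + N0)%:R : R).

Let ln_gt0 n : 0 < ln n.
Proof.
by rewrite (lt_le_trans (le_lt_trans _ HN0))// ?mulr_ge0// ler_nat leq_addl.
Qed.

Let ln_w n : 2 * w < ln n.
Proof. by rewrite (lt_le_trans HN0)// ler_nat leq_addl. Qed.

(** [2 w < l] means [l - w > l / 2], whence the factor 2. It is also the reason why the approximants
    grow at rate [2 w] instead of [w]. *)
Lemma yosidaQ_bnd n f : ln n * `|Q n f| <= 2 * `|f|.
Proof.
have h1 : 0 <= (ln n - 2 * w) * `|Q n f|.
  by rewrite mulr_ge0// subr_ge0 ltW// ln_w.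
have h2 : (ln n - w) * `|Q n f| <= `|f|.
  by apply: le_trans (Qest n f); rewrite lerDl mulr_ge0.
set q := `|Q n f| in h1 h2 *; lra.
Qed.

Lemma bop_resolvent n : bop (Q n).
Proof.
have [lQ _ _] := QR n; split=> //; exists (2 / ln n).
  by rewrite divr_ge0// ltW.
move=> f; rewrite mulrAC ler_pdivlMr// mulrC; exact: yosidaQ_bnd.
Qed.

Lemma bop_yosida n : bop (yosida n).
Proof.
apply: bop_scale.
rewrite (_ : (fun f => _) = (fun f => ln n *: Q n f + (-1) *: f)).
  apply: bop_add; apply: bop_scale; [exact: bop_resolvent | exact: bop_id].
by apply/funext => f; rewrite scaleN1r.
Qed.

Lemma yosida_comm m n : comm_op (yosida m) (yosida n).
Proof.
have yC (X : V -> V) k : linear X -> comm_op (Q k) X -> comm_op (yosida k) X.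
  by move=> lX QX f; rewrite /yosida (linZ lX) (linB lX) (linZ lX) QX.
have lQ k : linear (Q k) by have [] := QR k.
apply: (yC _ m); first exact: (bop_yosida n).1.
apply: comm_sym; apply: (yC _ n) => //; apply: comm_sym.
exact: resolvent_comm (QR m) (QR n).
Qed.

(* With [l = n + N0], [f + tau B f = (1 - tau l) f + tau l^2 Q f]. *)
Lemma yosida_growth n (tau : R) f : 0 <= tau -> tau * ln n <= 1 ->
  `|f + tau *: yosida n f| <=
  (1 + tau * (2 * w)) * `|f| - tau * (c * `|yosida n f|).
Proof.
move=> t0 t1.
have E : f + tau *: yosida n f =
    (1 - tau * ln n) *: f + (tau * ln n ^+ 2) *: Q n f.
  rewrite /yosida !scalerBr scalerBl !scalerA scale1r -mulrA -expr2.
  by rewrite -!addrA; congr (_ + _); rewrite addrC.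
rewrite {1}E (le_trans (ler_normD _ _))// 2!normrZ.
have ht : 0 <= tau * ln n ^+ 2 by rewrite mulr_ge0// exprn_ge0// ltW.
have ht1 : 0 <= 1 - tau * ln n by rewrite subr_ge0.
rewrite (ger0_norm ht) (ger0_norm ht1).
have nB : `|yosida n f| = ln n * `|ln n *: Q n f - f|.
  by rewrite /yosida normrZ ger0_norm// ltW.
rewrite nB.
set x := `|_ - f|; have := Qest n f; rewrite -/x.
have := yosidaQ_bnd n f; have := ln_gt0 n; set L := ln n; set q := `|Q n f|.
set y := `|f| => L0 qL h.
have h2 : L * ((L - w) * q + c * x) <= L * y by rewrite ler_wpM2l// ltW.
have h3 : w * (L * q) <= w * (2 * y) by rewrite ler_wpM2l.
have h4 : tau * (L ^+ 2 * q) <= tau * (L * y + w * (2 * y) - L * (c * x)).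
  by rewrite ler_wpM2l//; lra.
lra.
Qed.

Lemma yosida_dom n f g : A (f, g) -> yosida n f = ln n *: Q n g.
Proof.
move=> Afg; have [lQ _ hQ] := QR n.
have /hQ h : A (f, ln n *: f - (ln n *: f - g)) by rewrite subKr.
rewrite /yosida; congr (_ *: _).
by rewrite -[in X in _ - X]h -(linZ lQ) -(linB lQ) opprB addrC subrK.
Qed.

Hypothesis denseA : forall f (e : R), 0 < e ->
  exists2 g, dom A g & `|f - g| <= e.

(** On the domain the approximant is [l Q g], so [l Q] has to converge to the identity. If [A] maps
    [h] to [k], then [h - l Q h = - Q k] is of order [1 / l]; density of the domain and the uniform
    bound on [l Q] extend this to [g]. *)
Lemma yosida_cvg f g : A (f, g) -> yosida n f @[n --> \oo] --> g.
Proof.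
move=> Afg; under eq_fun do rewrite (yosida_dom _ Afg).
apply/cvgrPdist_le => e e0.
have e40 : 0 < e / 4 by rewrite divr_gt0.
have [h [[h1 k] /= Ahk h1h] gh] := denseA g e40; subst h1.
near=> n; have [lQ _ hQ] := QR n.
have -> : g - ln n *: Q n g = (g - h) - ln n *: Q n (g - h) +
   (h - ln n *: Q n h).
  rewrite (linB lQ) scalerBr subrACA.
  by rewrite subrK.
have lQn : `|ln n *: Q n (g - h)| <= e / 2.
  rewrite normrZ ger0_norm ?(ltW (ln_gt0 n))//.
  rewrite (le_trans (yosidaQ_bnd _ _))//.
  have -> : e / 2 = 2 * (e / 4) by field.
  by rewrite ler_wpM2l.
have lhn : `|h - ln n *: Q n h| <= e / 4.
  have -> : h - ln n *: Q n h = - Q n k.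
    have /hQ E : A (h, ln n *: h - (ln n *: h - k)).
      by rewrite subKr.
    rewrite -{1}E (linB lQ) (linZ lQ) addrAC subrr add0r.
    by [].
  rewrite normrN -(ler_pM2l (ln_gt0 n)) (le_trans (yosidaQ_bnd _ _))//.
  rewrite -ler_pdivrMr//; near: n.
  exists (Num.bound (2 * `|k| / (e / 4))) => // n /= hn.
  have h0 : 0 <= 2 * `|k| / (e / 4) by rewrite divr_ge0// ?mulr_ge0// ltW.
  rewrite (le_trans (ltW (archi_boundP h0)))// ler_nat.
  by rewrite (leq_trans hn)// leq_addr.
apply: (le_trans (ler_normD _ _)).
have := ler_normB (g - h) (ln n *: Q n (g - h)); lra.
Unshelve. all: by end_near. Qed.

End yosida.

(** * Growth and smoothing of exponentials in a second norm *)

Section exponential_growth.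
Context {R : realType} {W : normedModType R}.
Hypothesis HW : seq_complete W.
Variables (N : W -> R) (X B : W -> W) (w k h0 : R).
Hypotheses (N0 : forall u, 0 <= N u) (ND : forall u v, N (u + v) <= N u + N v)
  (N2 : forall u, N u <= 2 * `|u|).
Hypotheses (bX : bop X) (bB : bop B) (XB : comm_op X B).
Hypotheses (w0 : 0 <= w) (k0 : 0 <= k) (h00 : 0 < h0).
Hypothesis gX : forall tau u, 0 <= tau <= h0 ->
  N (u + tau *: X u) <= (1 + tau * w) * N u - tau * (k * N (B u)).

(** The one-step hypothesis is iterated in [N], while the ambient norm only controls the
    second-order error of each step. [kappa] is a lower bound of the dissipation along the whole
    orbit. *)
Let growth t (kappa : R) u : 0 <= t -> 0 <= kappa ->
  (forall s, 0 <= s <= t -> kappa <= k * N (B (oexp (sc s X) u))) ->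
  N (oexp (sc t X) u) <= expR (w * t) * N u - t * kappa.
Proof.
move=> t0 kappa0 hk; have [lX [K K0 hK]] := bX.
have e0 : oexp (sc 0 X) u = u.
  have -> : sc 0 X = (fun _ => 0) by apply/funext => f; rewrite /sc scale0r.
  exact: oexp0.
(* The factor 2 compares [N] with the norm, [K ^+ 2 * expR K] is the Taylor remainder for steps of
   length at most 1 (hence the minimum with 1 below), and the rest bounds the orbit on [[0, t]]. *)
pose C := 2 * (K ^+ 2 * expR K * (expR (t * K) * `|u|)).
have C0 : 0 <= C.
  by rewrite !mulr_ge0 ?expR_ge0 ?exprn_ge0.
have h10 : 0 < Num.min h0 1 by rewrite lt_min h00 ltr01.
have := @ler_exp_growth R (fun s => N (oexp (sc s X) u)) t w kappa C
  (Num.min h0 1) t0 h10 w0 kappa0 C0.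
rewrite e0; apply=> // s h s0 /andP[hp]; rewrite le_min => /andP[h1 h2] sht.
set p := oexp (sc s X) u.
have -> : oexp (sc (s + h) X) u = oexp (sc h X) p.
  by rewrite addrC (oexp_scD HW h s u bX).
have pb : `|p| <= expR (t * K) * `|u|.
  apply: (@le_trans _ _ (expR (s * K) * `|u|)).
    apply: (oexp_bnd HW); [exact: (bop_sc s bX).1|exact: mulr_ge0|].
    by move=> f; rewrite /sc normrZ ger0_norm// -mulrA ler_wpM2l.
  by rewrite ler_wpM2r// ler_expR ler_wpM2r//; lra.
have -> : oexp (sc h X) p = (p + h *: X p) + (oexp (sc h X) p - p - h *: X p).
  by rewrite -[_ - p - _]addrA -opprD [RHS]addrC subrK.
rewrite (le_trans (ND _ _))// lerD//.
  have h0h : 0 <= h <= h0 by rewrite hp.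
  rewrite (le_trans (gX p h0h))// lerD2l lerN2 ler_wpM2l//.
  by rewrite hk// s0; lra.
rewrite (le_trans (N2 _))// /C -mulrA ler_wpM2l//.
have h01 : 0 <= h <= 1 by rewrite hp.
rewrite (le_trans (oexp_sc_rem HW p lX K0 hK h01))//.
have -> : K ^+ 2 * expR K * (expR (t * K) * `|u|) * h ^+ 2 =
    h ^+ 2 * (K ^+ 2 * expR K) * (expR (t * K) * `|u|) by ring.
by rewrite ler_wpM2l// !mulr_ge0 ?expR_ge0 ?exprn_ge0.
Qed.

Lemma oexp_growth t u : 0 <= t -> N (oexp (sc t X) u) <= expR (w * t) * N u.
Proof.
move=> t0; have := @growth t 0 u t0 (lexx 0); rewrite mulr0 subr0.
by apply=> s _; rewrite mulr_ge0.
Qed.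

(* The integral of [k * N (B p_s)] over [[0, t]] is controlled by the growth
   bound, and [N (B p_s)] is almost decreasing along [p_s]. *)
Lemma oexp_smoothing t u : 0 <= t ->
  t * (k * N (B (oexp (sc t X) u))) <= expR (2 * (w * t)) * N u.
Proof.
move=> t0; set q := N (B _).
have hk s : 0 <= s <= t -> k * (expR (- (w * t)) * q) <=
    k * N (B (oexp (sc s X) u)).
  move=> /andP[s0 st]; rewrite ler_wpM2l// expRN.
  rewrite ler_pdivrMl ?expR_gt0//.
  have ts0 : 0 <= t - s by rewrite subr_ge0.
  have E : B (oexp (sc t X) u) = oexp (sc (t - s) X) (B (oexp (sc s X) u)).
    rewrite -{1}(subrK s t) (oexp_scD HW (t - s) s u bX).
    apply: (oexp_comm HW) => //; first exact: bop_sc.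
    exact: comm_sc bB.1 XB.
  rewrite /q E (le_trans (oexp_growth _ ts0))// ler_wpM2r// ler_expR.
  by rewrite ler_wpM2l// gerBl.
have kq0 : 0 <= k * (expR (- (w * t)) * q).
  by rewrite !mulr_ge0// ?expR_ge0// N0.
have := growth t0 kq0 hk.
have Nt := N0 (oexp (sc t X) u).
rewrite lerBrDr => h.
have h2 : t * (k * (expR (- (w * t)) * q)) <= expR (w * t) * N u by lra.
rewrite [2 * _]mulr_natl mulr2n expRD -mulrA.
rewrite -(ler_pM2l (expR_gt0 (- (w * t)))) [leRHS]mulrA -expRD addNr expR0 mul1r.
by apply: le_trans h2; rewrite le_eqVlt; apply/orP; left; apply/eqP; ring.
Qed.

End exponential_growth.

(** * The limit semigroup and its generator *)

Section hille_yosida.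
Context {R : realType} {V : normedModType R}.
Hypothesis HV : seq_complete V.
Variables (A : set (V * V)) (B : nat -> V -> V) (w : R).
Hypotheses (bB : forall n, bop (B n)) (cB : forall m n, comm_op (B m) (B n))
  (w0 : 0 <= w)
  (gB : forall n, exists2 h0, 0 < h0 & forall tau f, 0 <= tau <= h0 ->
     `|f + tau *: B n f| <= (1 + tau * w) * `|f|)
  (denseA : forall f (e : R), 0 < e -> exists2 g, dom A g & `|f - g| <= e)
  (cvA : forall f g, A (f, g) -> B n f @[n --> \oo] --> g).

Lemma oexp_approx_bnd n t f : 0 <= t ->
  `|oexp (sc t (B n)) f| <= expR (w * t) * `|f|.
Proof.
move=> t0; have [h0 h00 hg] := gB n.
apply: (@oexp_growth _ _ HV (fun u => `|u|) (B n) (B n) w 0 h0) => //.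
- by move=> u v; exact: ler_normD.
- by move=> u; rewrite mulr_natl mulr2n lerDl.
- by move=> tau u ht; rewrite mul0r mulr0 subr0 hg.
Qed.

Let approx_bnd01 n t f s : 0 <= t -> 0 <= s <= 1 ->
  `|oexp (sc s (sc t (B n))) f| <= expR (w * t) * `|f|.
Proof.
move=> t0 /andP[s0 s1]; have -> : sc s (sc t (B n)) = sc (s * t) (B n).
  by apply/funext => g; rewrite /sc scalerA.
rewrite (le_trans (oexp_approx_bnd _ _ _)) ?mulr_ge0// ler_wpM2r// ler_expR.
by rewrite ler_wpM2l// ler_piMl.
Qed.

Definition sgrp t f : V := limn (fun n => oexp (sc t (B n)) f).

Lemma sgrp_cvg t f : 0 <= t ->
  oexp (sc t (B n)) f @[n --> \oo] --> sgrp t f.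
Proof.
move=> t0.
apply: (@oexp_seq_cvgn _ _ HV (fun n => sc t (B n)) (expR (w * t)) (dom A)) => //.
- by move=> n; exact: bop_sc.
- by move=> m n; apply: comm_sc2 => //; [exact: (bB m).1|exact: (bB n).1].
- by move=> n s g s01; exact: approx_bnd01.
move=> g [[g1 k] /= Ak <-]; apply/cvg_ex; exists (t *: k).
by apply: cvgZl_tmp; exact: cvA Ak.
Qed.

Arguments sgrp_cvg [t] f _.

Lemma sgrp_bnd t f : 0 <= t -> `|sgrp t f| <= expR (w * t) * `|f|.
Proof.
move=> t0; apply: (limn_norm_le (sgrp_cvg f t0)) => n; exact: oexp_approx_bnd.
Qed.

Lemma sgrp_linear t : 0 <= t -> linear (sgrp t).
Proof.
move=> t0 a f g.
have h : (a *: oexp (sc t (B n)) f + oexp (sc t (B n)) g) @[n --> \oo] -->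
    a *: sgrp t f + sgrp t g.
  by apply: cvgD; [apply: cvgZl_tmp|]; exact: sgrp_cvg.
have h2 := sgrp_cvg (a *: f + g) t0.
apply: (cvg_unique _ h2) => //.
suff -> : (fun n => oexp (sc t (B n)) (a *: f + g)) =
  (fun n => a *: oexp (sc t (B n)) f + oexp (sc t (B n)) g) by [].
by apply/funext => n; exact: (oexp_linear HV (bop_sc t (bB n)) a f g).
Qed.

Lemma sgrp_bop t : 0 <= t -> bop (sgrp t).
Proof.
move=> t0; split; first exact: sgrp_linear.
by exists (expR (w * t)); [exact: expR_ge0|move=> f; exact: sgrp_bnd].
Qed.

Lemma sgrp0 f : sgrp 0 f = f.
Proof.
have := sgrp_cvg f (lexx 0).
have -> : (fun n => oexp (sc 0 (B n)) f) = (fun _ => f).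
  apply/funext => n; have -> : sc 0 (B n) = (fun _ => 0).
    by apply/funext => g; rewrite /sc scale0r.
  exact: oexp0.
move=> h; apply: (cvg_unique _ h) => //; exact: cvg_cst.
Qed.

Lemma sgrpD s t f : 0 <= s -> 0 <= t -> sgrp (s + t) f = sgrp s (sgrp t f).
Proof.
move=> s0 t0; have h := sgrp_cvg f (addr_ge0 s0 t0).
apply: (cvg_unique _ h) => //.
have E n : oexp (sc (s + t) (B n)) f =
   oexp (sc s (B n)) (oexp (sc t (B n)) f - sgrp t f) +
   oexp (sc s (B n)) (sgrp t f).
  rewrite (linB (oexp_linear HV (bop_sc s (bB n)))) subrK.
  exact: (oexp_scD HV s t f (bB n)).
rewrite /= (funext E) -[sgrp s (sgrp t f)]add0r.
apply: cvgD; last exact: sgrp_cvg.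
apply/cvgr0Pnorm_le => e e0.
have d0 : 0 < e / expR (w * s) by rewrite divr_gt0// expR_gt0.
have /cvgrPdist_le/(_ _ d0) := sgrp_cvg f t0; apply: filterS => n hn.
rewrite (le_trans (oexp_approx_bnd _ _ s0))// mulrC -ler_pdivlMr ?expR_gt0//.
by rewrite distrC.
Qed.

(** Uniformity in [n] is the point: the estimate passes to the limit and controls the difference
    quotients of [sgrp]. For [h] in the domain, [B n h] converges and is therefore bounded, so the
    displacement is at most proportional to [s]. *)
Lemma oexp_approx_small g (e : R) : 0 < e -> exists2 t0, 0 < t0 &
  forall n s, 0 <= s <= t0 -> `|oexp (sc s (B n)) g - g| <= e.
Proof.
move=> e0; pose M := expR w.
have M0 : 0 < M by exact: expR_gt0.
have d0 : 0 < e / 2 / (M + 1) by rewrite !divr_gt0// addr_gt0.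
have [h [[h1 k] /= Ak h1h] gh] := denseA g d0; subst h1.
have /cvg_seq_bounded/pinfty_ex_gt0[C C0 hC] : cvgn (fun n => B n h).
  by apply/cvg_ex; exists k; exact: cvA.
pose t0 := Num.min 1 (e / 2 / (M * C)).
have t00 : 0 < t0 by rewrite lt_min ltr01 !divr_gt0// mulr_gt0.
exists t0 => // n s /andP[s0]; rewrite le_min => /andP[s1 s2].
have lE := oexp_linear HV (bop_sc s (bB n)).
have -> : oexp (sc s (B n)) g - g = (oexp (sc s (B n)) (g - h) - (g - h)) +
   (oexp (sc s (B n)) h - h).
  by rewrite (linB lE) subrACA subrK.
have Mb u : `|oexp (sc s (B n)) u| <= M * `|u|.
  rewrite (le_trans (oexp_approx_bnd _ _ s0))// ler_wpM2r// ler_expR.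
  by rewrite ler_piMr.
rewrite (le_trans (ler_normD _ _))// (splitr e) lerD//.
  rewrite (le_trans (ler_normB _ _))// (@le_trans _ _ ((M + 1) * `|g - h|))//.
    by rewrite mulrDl mul1r lerD2r Mb.
  by rewrite mulrC -ler_pdivlMr// addr_gt0.
apply: (@le_trans _ _ (M * `|sc s (B n) h|)).
  apply: (@oexp_sub_bound _ _ HV (sc s (B n)) id) => //.
  - exact: bop_sc.
  - exact: bop_id.
  move=> r u r01; rewrite (le_trans (approx_bnd01 _ _ s0 r01))// ler_wpM2r//.
  by rewrite ler_expR ler_piMr.
rewrite /sc normrZ ger0_norm//.
apply: (@le_trans _ _ (M * (e / 2 / (M * C) * C))).
  rewrite ler_wpM2l ?(ltW M0)// ler_pM//.
  by apply: hC.
rewrite le_eqVlt; apply/orP; left; apply/eqP; field.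
by rewrite !gt_eqF.
Qed.

Lemma sgrp_small g (e : R) : 0 < e -> exists2 t0, 0 < t0 &
  forall s, 0 <= s <= t0 -> `|sgrp s g - g| <= e.
Proof.
move=> /(oexp_approx_small g)[t0 t00 h]; exists t0 => // s /[dup] st /andP[s0 _].
have hc : (oexp (sc s (B n)) g - g) @[n --> \oo] --> sgrp s g - g.
  by apply: cvgB; [exact: sgrp_cvg|exact: cvg_cst].
by apply: (limn_norm_le hc) => n; exact: h.
Qed.

Lemma sgrp_C0 : C0_semigroup sgrp.
Proof.
split.
- move=> t t0; split; first exact: sgrp_linear.
  by apply: bop_continuous; exact: sgrp_bop.
- exact: sgrp0.
- by move=> s t s0 t0 f; exact: sgrpD.
move=> f; apply/cvgrPdist_le => e e0; have [t0 t00 h] := sgrp_small f e0.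
near=> t; rewrite distrC; apply: h; apply/andP; split; last first.
  by near: t; apply: nbhs_right_le.
by near: t; apply: nbhs_right_ge.
Unshelve. all: by end_near. Qed.

(** For each [n] the first-order Taylor error is at most [t] times the displacement of [B n f] by
    the semigroup of [B n]. As [B n f] tends to [g], this is compared with the displacement of [g],
    which is small uniformly in [n]. *)
Lemma sgrp_generator_sup u : A u -> generator sgrp u.
Proof.
case: u => f g Afg; rewrite /generator/=; apply/cvgrPdist_le => e e0.
have e20 : 0 < e / 2 by rewrite divr_gt0.
have [t0 t00 h] := oexp_approx_small g e20.
near=> t.
have tp : 0 < t by near: t; exact: nbhs_right_gt.
have tt0 : t <= t0 by near: t; exact: nbhs_right_le.
suff H : `|sgrp t f - f - t *: g| <= t * e.
  rewrite distrC.
  have -> : t^-1 *: (sgrp t f - f) - g = t^-1 *: (sgrp t f - f - t *: g).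
    by rewrite [in RHS]scalerBr scalerA mulVf ?gt_eqF// scale1r.
  by rewrite normrZ (@ger0_norm _ t^-1) ?invr_ge0 ?(ltW tp)// ler_pdivrMl.
pose M := expR (w * t) + 1.
have M0 : 0 < M by rewrite addr_gt0// expR_gt0.
have d0 : 0 < e / 2 / M by rewrite !divr_gt0.
have hc : (oexp (sc t (B n)) f - f - t *: B n f) @[n --> \oo] -->
    sgrp t f - f - t *: g.
  apply: cvgB; first by apply: cvgB; [exact: (sgrp_cvg f (ltW tp))|exact: cvg_cst].
  by apply: cvgZl_tmp; exact: cvA.
apply: (cvgr_to_le (cvg_norm hc)).
have /cvgrPdist_le/(_ _ d0) := cvA Afg; apply: filterS => n hn.
have bt := bop_sc t (bB n).
apply: (@oexp_sub2_le _ _ HV (sc t (B n)) id f) => //; first exact: bop_id.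
move=> s /[dup] s01 /andP[s0 s1].
have bs := bop_sc s bt; have lE := oexp_linear HV bs.
rewrite /= {1 3}/sc (linZ lE) -scalerBr normrZ (@ger0_norm _ t) ?(ltW tp)// ler_wpM2l ?(ltW tp)//.
have -> : oexp (sc s (sc t (B n))) (B n f) - B n f =
   (oexp (sc s (sc t (B n))) (B n f - g) - (B n f - g)) +
   (oexp (sc s (sc t (B n))) g - g).
  by rewrite (linB lE) subrACA subrK.
rewrite (le_trans (ler_normD _ _))// (splitr e) lerD//.
  rewrite (le_trans (ler_normB _ _))// (@le_trans _ _ (M * `|B n f - g|))//.
    by rewrite mulrDl mul1r lerD2r approx_bnd01 ?(ltW tp).
  by rewrite distrC mulrC -ler_pdivlMr.
have -> : sc s (sc t (B n)) = sc (s * t) (B n).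
  by apply/funext => v; rewrite /sc scalerA.
apply: h; rewrite mulr_ge0 ?(ltW tp)//=.
by apply: le_trans tt0; rewrite ler_piMl// ltW.
Unshelve. all: by end_near. Qed.

(** [l - A] is onto and the generator extends [A], so it suffices that [l] is not an eigenvalue of
    the generator. Along an eigenvector the norm would grow at least like [1 + t l] to first order,
    while the growth bound allows [1 + t M]: [M = w * expR w] bounds the slope of [expR (w * t)] on
    [[0, 1]]. *)
Lemma sgrp_generator : lin_graph A ->
  (exists l0, forall l h, l0 < l -> exists f, A (f, l *: f - h)) ->
  generator sgrp = A.
Proof.
move=> linA [l0 rA]; apply/seteqP; split=> [[f g] Gfg|]; last first.
  exact: sgrp_generator_sup.
pose M := w * expR w.
pose l := Num.max l0 M + 1.
have l0l : l0 < l by rewrite ltr_pwDr// le_max lexx.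
have Ml : M < l by rewrite ltr_pwDr// le_max lexx orbT.
have [f' Af'] := rA l (l *: f - g) l0l.
suff ff' : f = f'.
  by move: Af'; rewrite -ff' subKr.
have Gf' := sgrp_generator_sup Af'.
apply/eqP; rewrite -subr_eq0; set u := f - f'.
have Gu : t^-1 *: (sgrp t u - u) @[t --> 0^'+] --> l *: u.
  have -> : l *: u = g - (l *: f' - (l *: f - g)).
    by rewrite /u scalerBr opprB [RHS]addrC [RHS]addrAC subrK.
  apply: (@cvg_trans _ ((t^-1 *: (sgrp t f - f) -
    t^-1 *: (sgrp t f' - f')) @[t --> 0^'+])); last exact: cvgB.
  apply: near_eq_cvg; near=> t.
  have tp : 0 <= t by near: t; exact: nbhs_right_ge.
  by rewrite -scalerBr subrACA -(linB (sgrp_linear tp)).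
have : (l - M) * `|u| <= 0.
  apply/ler_addgt0Pr => e e0; rewrite add0r.
  have /cvgrPdist_le/(_ _ e0) Gue := Gu.
  near (0 : R)^'+ => t.
  have tp : 0 < t by near: t; exact: nbhs_right_gt.
  have t1 : t <= 1 by near: t; exact: nbhs_right_le.
  have h1 : `|l *: u - t^-1 *: (sgrp t u - u)| <= e by near: t.
  have h2 := sgrp_bnd u (ltW tp).
  have h3 : expR (w * t) - 1 <= t * M.
    have := expR_ge1Dx (- (w * t)); rewrite expRN => h.
    have Ew : expR (w * t) <= expR w by rewrite ler_expR ler_piMr.
    have := expR_gt0 (w * t) => E0.
    have : expR (w * t) * (1 - w * t) <= 1.
      by rewrite -ler_pdivlMl// mulr1.
    have : w * t * expR (w * t) <= w * t * expR w.
      by rewrite ler_wpM2l// mulr_ge0// ltW.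
    rewrite /M; lra.
  have h4 : (1 + t * l) * `|u| <= `|sgrp t u| + t * e.
    have -> : (1 + t * l) * `|u| = `|u + t *: (l *: u)|.
      rewrite scalerA -{2}(scale1r u) -scalerDl normrZ ger0_norm//.
      rewrite addr_ge0// mulr_ge0 ?(ltW tp)// (le_trans _ (ltW Ml))//.
      by rewrite mulr_ge0// expR_ge0.
    have -> : u + t *: (l *: u) = sgrp t u +
        t *: (l *: u - t^-1 *: (sgrp t u - u)).
      rewrite [t *: (_ - _)]scalerBr (scalerA t t^-1) divff ?gt_eqF// scale1r opprB.
      by rewrite addrCA [sgrp t u + _]addrC subrK addrC.
    rewrite (le_trans (ler_normD _ _))// lerD2l normrZ (ger0_norm (ltW tp)).
    by rewrite (ler_wpM2l (ltW tp)).
  rewrite -(ler_pM2l tp).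
  have h5 : (expR (w * t) - 1) * `|u| <= t * M * `|u| by rewrite ler_wpM2r.
  lra.
rewrite pmulr_rle0 ?subr_gt0// normr_le0.
by [].
Unshelve. all: by end_near. Qed.

(* [P] plays the role of the positive cone. *)
Lemma sgrp_cone (P : set V) : P 0 -> (forall f g, P f -> P g -> P (f + g)) ->
  (forall a f, 0 <= a -> P f -> P (a *: f)) ->
  (forall u f, (forall n, P (u n)) -> u @ \oo --> f -> P f) ->
  (forall n, exists k, forall f, P f -> P (B n f + k *: f)) ->
  forall t f, 0 <= t -> P f -> P (sgrp t f).
Proof.
move=> P0 PD PZ Pc PB t f t0 Pf.
apply: (Pc _ _ _ (sgrp_cvg f t0)) => n; have [k hk] := PB n.
(* The exponential of [t B n] is [expR (- (t * k))] times that of [t C], and every term of the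
   latter series preserves [P]. *)
pose C g := B n g + k *: g.
have bC : bop C by apply: bop_add => //; apply: bop_scale; exact: bop_id.
have bD : bop (fun g : V => - (t * k) *: g) by apply: bop_scale; exact: bop_id.
have -> : oexp (sc t (B n)) f =
    oexp (sc t C) (oexp (fun g : V => - (t * k) *: g) f).
  rewrite -(oexp_add HV) => [|||g]; [|exact: bop_sc|exact: bD|].
    congr (oexp _ f); apply/funext => g.
    by rewrite /sc /C scalerDr scalerA -addrA -scalerDl addrN scale0r addr0.
  rewrite (linZ (bop_sc t bC).1).
  by [].
rewrite (oexp_scalar HV) (linZ (oexp_linear HV (bop_sc t bC))).
apply: (PZ _); first exact: expR_ge0.
apply: (Pc _ _ _ (oexp_cvg HV f (bop_sc t bC))) => m.
rewrite /series/=; elim/big_ind: _ => // i _.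
apply: (PZ _); first by rewrite invr_ge0.
by elim: i => //= i IHi; exact: (PZ t _ t0 (hk _ IHi)).
Qed.

End hille_yosida.

(* The scaling of charges of MathComp-Analysis has the same name. *)
Local Notation cscale := Defs.cscale.

(** * Analytic semigroups *)

(* [limn] does not find the pointed structure of a product by itself. *)
Definition seq_lim (R : realType) (W : normedModType R) (u : nat -> W) : W :=
  limn u.

Lemma cvg_seq_norm_bounded (R : realType) (W : normedModType R) (u : nat -> W)
  (l : W) : u @ \oo --> l -> exists2 C : R, 0 < C & forall n, `|u n| <= C.
Proof.
move=> ul; have /cvg_seq_bounded/pinfty_ex_gt0[C C0 hC] : cvgn u.
  by apply/cvg_ex; exists l.
by exists C => // n; exact: hC.
Qed.

(** * The complexification and its norms *)

Section complexification.
Context {R : realType} {V : normedModType R}.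
Local Notation W := (V * V)%type.
Local Notation Re := complex.Re.
Local Notation Im := complex.Im.
Implicit Types (z : R[i]) (u v : W).

Lemma seq_complete_pair : seq_complete V -> seq_complete W.
Proof.
move=> HV u hu.
have c1 : cvgn (fun n => (u n).1).
  apply: HV => e e0; have [N hN] := hu e e0; exists N => m n Nm Nn.
  apply: le_trans (hN m n Nm Nn).
  by rewrite prod_normE/= le_max lexx.
have c2 : cvgn (fun n => (u n).2).
  apply: HV => e e0; have [N hN] := hu e e0; exists N => m n Nm Nn.
  apply: le_trans (hN m n Nm Nn).
  by rewrite prod_normE/= le_max lexx orbT.
apply/cvg_ex; exists (limn (fun n => (u n).1), limn (fun n => (u n).2)).
apply: (cvg_trans _ (cvg_pair c1 c2)); apply: near_eq_cvg.
by apply: nearW => n; rewrite -surjective_pairing.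
Qed.

Definition nrm1 u : R := `|u.1| + `|u.2|.

Lemma nrm1_ge0 u : 0 <= nrm1 u. Proof. exact: addr_ge0. Qed.

Lemma nrm1D u v : nrm1 (u + v) <= nrm1 u + nrm1 v.
Proof. by rewrite /nrm1/= addrACA lerD// ler_normD. Qed.

Lemma nrm1Z (a : R) u : nrm1 (a *: u) = `|a| * nrm1 u.
Proof. by rewrite /nrm1/= !normrZ mulrDr. Qed.

Lemma nrm1_le2 u : nrm1 u <= 2 * `|u|.
Proof.
by rewrite mulr_natl mulr2n prod_normE lerD// le_max lexx// orbT.
Qed.

Lemma norm_le_nrm1 u : `|u| <= nrm1 u.
Proof. by rewrite prod_normE /nrm1 ge_max lerDl lerDr !normr_ge0. Qed.

(** Equivalent to the modulus but free of square roots; the factors 2 in [abs1_le_norm] and [abs1V]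
    are the price. *)
Definition abs1 z : R := `|Re z| + `|Im z|.

Lemma cscale_linear z : linear (@Defs.cscale R V z).
Proof.
move=> a u v; rewrite /cscale; apply: injective_projections => /=.
  rewrite !scalerDr !scalerN !scalerA opprD addrACA.
  by rewrite [Re z * a]mulrC [Im z * a]mulrC.
rewrite !scalerDr !scalerA addrACA.
by rewrite [Re z * a]mulrC [Im z * a]mulrC.
Qed.

Lemma cscale_bnd z u : `|cscale z u| <= abs1 z * `|u|.
Proof.
have h1 : `|u.1| <= `|u| by rewrite prod_normE le_max lexx.
have h2 : `|u.2| <= `|u| by rewrite prod_normE le_max lexx orbT.
rewrite [leLHS]prod_normE /cscale/= ge_max /abs1 mulrDl; apply/andP; split.
  by rewrite (le_trans (ler_normB _ _))// !normrZ lerD// ler_wpM2l.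
rewrite (le_trans (ler_normD _ _))// !normrZ addrC lerD// ler_wpM2l//.
Qed.

Lemma bop_cscale z : bop (@Defs.cscale R V z).
Proof.
split; first exact: cscale_linear.
by exists (abs1 z); [exact: addr_ge0 | exact: cscale_bnd].
Qed.

Lemma cscaleD z w u : cscale (z + w) u = cscale z u + cscale w u.
Proof.
case: z w => [a b] [c d]; apply: injective_projections => /=.
  by rewrite !scalerDl opprD addrACA.
by rewrite !scalerDl addrACA.
Qed.

Lemma cscaleM z w u : cscale (z * w) u = cscale z (cscale w u).
Proof.
case: z w => [a b] [c d]; apply: injective_projections => /=.
  rewrite scalerBl scalerDl scalerBr scalerDr !scalerA !opprD.
  by rewrite -!addrA; congr (_ + _); rewrite addrCA.
rewrite scalerBl scalerDl scalerBr scalerDr !scalerA.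
by rewrite [RHS]addrC [RHS]addrACA.
Qed.

Lemma cscale1 u : cscale 1 u = u.
Proof.
by apply: injective_projections; rewrite /= scale1r scale0r ?subr0 ?add0r.
Qed.

Lemma cscale_real (a : R) u : cscale (Complex a 0) u = a *: u.
Proof. by apply: injective_projections; rewrite /= scale0r ?subr0 ?add0r. Qed.

Lemma clinear_linear (Q : W -> W) : clinear Q -> linear Q.
Proof. by move=> cQ a u v; rewrite -!cscale_real cQ. Qed.

Lemma abs1_le_norm z (r : R) : `|z| < (r%:C)%C -> abs1 z <= 2 * r.
Proof.
rewrite normc_def ltcR => /ltW hr.
rewrite mulr_natl mulr2n /abs1 lerD// (le_trans _ hr)// -sqrtr_sqr ler_wsqrtr//.
  by rewrite lerDl sqr_ge0.
by rewrite lerDr sqr_ge0.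
Qed.

Lemma abs1V z : z != 0 -> abs1 z^-1 * abs1 z <= 2.
Proof.
case: z => a b z0; rewrite /abs1/=.
have n0 : 0 < a ^+ 2 + b ^+ 2.
  rewrite lt_neqAle eq_sym addr_ge0 ?sqr_ge0// andbT.
  rewrite paddr_eq0 ?sqr_ge0// !sqrf_eq0; apply: contra z0.
  by move=> /andP[/eqP -> /eqP ->].
rewrite normrN !normrM normfV (ger0_norm (ltW n0)) -mulrDl mulrAC.
rewrite ler_pdivrMr// -(real_normK (num_real a)) -(real_normK (num_real b)).
have := sqr_ge0 (`|a| - `|b|); rewrite !expr2; lra.
Qed.

Definition cmap (B : V -> V) u : W := (B u.1, B u.2).

Lemma bop_cmap B : bop B -> bop (cmap B).
Proof.
move=> [lB [K K0 hK]]; split.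
  move=> a u v; apply: injective_projections => /=; exact: lB.
exists K => // u; rewrite !prod_normE/= maxr_pMr// ge_max !le_max !hK orbT.
by [].
Qed.

Lemma cmap_cscale B z : linear B -> comm_op (cmap B) (cscale z).
Proof.
move=> lB u; apply: injective_projections => /=.
  by rewrite (linB lB) !(linZ lB).
by rewrite (linD lB) !(linZ lB).
Qed.

End complexification.

(** * Extension of the semigroup to a sector *)

Section analytic.
Context {R : realType} {V : normedModType R}.
Local Notation W := (V * V)%type.
Local Notation Re := complex.Re.
Local Notation Im := complex.Im.
Implicit Types (z : R[i]) (u v : W).
Hypothesis HV : seq_complete V.
Variables (A : set (V * V)) (B : nat -> V -> V) (w c : R).
Hypotheses (bB : forall n, bop (B n)) (cB : forall m n, comm_op (B m) (B n))
  (w0 : 0 <= w) (c0 : 0 < c)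
  (gB : forall n, exists2 h0, 0 < h0 & forall tau f, 0 <= tau <= h0 ->
     `|f + tau *: B n f| <=
     (1 + tau * w) * `|f| - tau * (c * `|B n f|))
  (denseA : forall f (e : R), 0 < e -> exists2 g, dom A g & `|f - g| <= e)
  (cvA : forall f g, A (f, g) -> B n f @[n --> \oo] --> g).

Let HW : seq_complete W := seq_complete_pair HV.

Definition cgen n z u : W := cscale z (cmap (B n) u).
Definition cexp n z : W -> W := oexp (cgen n z).
(** The bound [c / 2] spends half of the dissipation on the rotation by [Im z]; the other half
    remains for the smoothing estimate. Unlike a sector, this set contains 0. *)
Definition cone z := 0 <= Re z /\ `|Im z| <= c / 2 * Re z.

Lemma bop_cgen n z : bop (cgen n z).
Proof. by apply: bop_comp; [exact: bop_cscale|exact: bop_cmap]. Qed.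

Lemma bop_cexp n z : bop (cexp n z).
Proof. by apply: (oexp_bop HW); exact: bop_cgen. Qed.

Lemma cgen_cscale n z y : comm_op (cgen n z) (cscale y).
Proof.
by move=> u; rewrite /cgen (cmap_cscale _ (bB n).1) -!cscaleM mulrC.
Qed.

Lemma cmap_comm m n : comm_op (cmap (B m)) (cmap (B n)).
Proof. by move=> u; rewrite /cmap/= !(cB m n). Qed.

Lemma cgen_cmap m n z : comm_op (cgen m z) (cmap (B n)).
Proof.
by move=> u; rewrite /cgen cmap_comm -(cmap_cscale _ (bB n).1).
Qed.

Lemma cgen_comm m n z y : comm_op (cgen m z) (cgen n y).
Proof. by move=> u; rewrite /cgen -/(cgen m z _) cgen_cscale cgen_cmap. Qed.

Lemma cexp_cscale n z y u : cexp n z (cscale y u) = cscale y (cexp n z u).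
Proof.
apply/esym/(oexp_comm HW); [exact: bop_cgen|exact: bop_cscale|].
exact: cgen_cscale.
Qed.

Lemma cexp_cmap n z u : cexp n z (cmap (B n) u) = cmap (B n) (cexp n z u).
Proof.
apply/esym/(oexp_comm HW); [exact: bop_cgen|exact: bop_cmap|].
exact: cgen_cmap.
Qed.

Lemma cexpD n z y u : cexp n (z + y) u = cexp n z (cexp n y u).
Proof.
rewrite /cexp -(oexp_add HW); [|exact: bop_cgen|exact: bop_cgen|exact: cgen_comm].
by congr (oexp _ u); apply/funext => v; rewrite /cgen cscaleD.
Qed.

Lemma sc_cgen (s : R) n z : sc s (cgen n z) = cgen n (Complex s 0 * z).
Proof. by apply/funext => u; rewrite /sc /cgen cscaleM cscale_real. Qed.

Lemma cone_scale (s : R) z : 0 <= s -> cone z -> cone (Complex s 0 * z).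
Proof.
case: z => a b s0 [/= a0 ba]; split => /=.
  by rewrite mul0r subr0 mulr_ge0.
rewrite !mul0r subr0 addr0 normrM (ger0_norm s0).
by rewrite mulrCA ler_wpM2l.
Qed.

Lemma coneD z y : cone z -> cone y -> cone (z + y).
Proof.
case: z y => [a b] [a' b'] [/= h1 h2] [/= h3 h4]; split => /=.
  exact: addr_ge0.
by rewrite (le_trans (ler_normD _ _))// mulrDr lerD.
Qed.

(* [f |-> i f] is an isometry for [nrm1], so that a rotation of the generator
   costs at most [|Im z| * nrm1 (B u)], which the dissipation absorbs. *)
Lemma cgen_growth n z : cone z -> exists2 h0 : R, 0 < h0 &
  forall tau u, 0 <= tau <= h0 -> nrm1 (u + tau *: cgen n z u) <=
    (1 + tau * (w * Re z)) * nrm1 u -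
    tau * (c / 2 * Re z * nrm1 (cmap (B n) u)).
Proof.
case: z => x y [/= x0 yx]; have [h0 h00 hg] := gB n.
have x10 : 0 < x + 1 by rewrite ltr_wpDl.
exists (h0 / (x + 1)); first exact: divr_gt0.
move=> tau u /andP[t0]; rewrite ler_pdivlMr// => th.
pose v := cmap (B n) u.
have tx : 0 <= tau * x <= h0.
  rewrite mulr_ge0//=; apply: le_trans th; rewrite ler_wpM2l//; lra.
have -> : u + tau *: cgen n (Complex x y) u =
    (u + (tau * x) *: v) + (tau * y) *: (- v.2, v.1).
  apply: injective_projections => /=.
    by rewrite scalerBr !scalerA scalerN addrA.
  by rewrite scalerDr !scalerA -addrA; congr (_ + _); rewrite addrC.
rewrite (le_trans (nrm1D _ _))// nrm1Z normrM (ger0_norm t0).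
have -> : nrm1 (- v.2, v.1) = nrm1 v by rewrite /nrm1/= normrN addrC.
have h1 := hg _ u.1 tx; have h2 := hg _ u.2 tx.
have h3 : nrm1 (u + (tau * x) *: v) <=
   (1 + tau * x * w) * nrm1 u - tau * x * (c * nrm1 v).
  apply: (le_trans (lerD h1 h2)).
  by rewrite le_eqVlt; apply/orP; left; apply/eqP; rewrite /nrm1; ring.
have h4 : tau * `|y| * nrm1 v <= tau * (c / 2 * x) * nrm1 v.
  by rewrite ler_wpM2r ?nrm1_ge0// ler_wpM2l.
apply: (le_trans (lerD h3 h4)).
by rewrite /= le_eqVlt; apply/orP; left; apply/eqP; field.
Qed.

Lemma cexp_nrm1 n z u : cone z -> nrm1 (cexp n z u) <= expR (w * Re z) * nrm1 u.
Proof.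
move=> cz; have [h0 h00 hg] := cgen_growth n cz.
have := @oexp_growth _ _ HW (@nrm1 R V) (cgen n z) (cmap (B n)) (w * Re z)
  (c / 2 * Re z) h0 (@nrm1_ge0 _ _) (@nrm1D _ _) (@nrm1_le2 _ _) (bop_cgen n z).
have wz : 0 <= w * Re z by rewrite mulr_ge0//; case: cz.
have cz0 : 0 <= c / 2 * Re z by rewrite mulr_ge0 ?divr_ge0 ?(ltW c0)//; case: cz.
move=> /(_ wz cz0 h00 hg 1 u ler01); rewrite mulr1.
have -> // : sc 1 (cgen n z) = cgen n z.
by apply/funext => v; rewrite /sc scale1r.
Qed.

Lemma cexp_bnd n z u : cone z -> `|cexp n z u| <= 2 * expR (w * Re z) * `|u|.
Proof.
move=> cz; rewrite (le_trans (norm_le_nrm1 _))// (le_trans (cexp_nrm1 _ _ cz))//.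
by rewrite [2 * _]mulrC -mulrA ler_wpM2l ?expR_ge0// nrm1_le2.
Qed.

Lemma cexp_smoothing n z u : cone z -> 0 < Re z ->
  `|cmap (B n) (cexp n z u)| <=
  2 * expR (2 * (w * Re z)) / (c / 2 * Re z) * `|u|.
Proof.
move=> cz z0; have [h0 h00 hg] := cgen_growth n cz.
have wz : 0 <= w * Re z by rewrite mulr_ge0//; case: cz.
have cz0 : 0 < c / 2 * Re z by rewrite mulr_gt0 ?divr_gt0.
have := @oexp_smoothing _ _ HW (@nrm1 R V) (cgen n z) (cmap (B n)) (w * Re z)
  (c / 2 * Re z) h0 (@nrm1_ge0 _ _) (@nrm1D _ _) (@nrm1_le2 _ _) (bop_cgen n z)
  (bop_cmap (bB n)) (cgen_cmap n n z) wz (ltW cz0) h00 hg 1 u ler01.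
rewrite mul1r mulr1.
have -> : sc 1 (cgen n z) = cgen n z.
  by apply/funext => v; rewrite /sc scale1r.
rewrite -/(cexp n z) -ler_pdivlMl// => h.
rewrite (le_trans (norm_le_nrm1 _))// (le_trans h)//.
rewrite [leRHS]mulrAC [leRHS]mulrC ler_wpM2l ?invr_ge0 ?(ltW cz0)//.
by rewrite [leRHS]mulrAC [leRHS]mulrC ler_wpM2l ?expR_ge0// nrm1_le2.
Qed.

Definition csgrp z u : W := seq_lim (fun n => cexp n z u).
Definition cdom : set W := [set u | dom A u.1 /\ dom A u.2].

Lemma cdom_dense u (e : R) : 0 < e -> exists2 v, cdom v & `|u - v| <= e.
Proof.
move=> e0; have [f Df hf] := denseA u.1 e0; have [g Dg hg] := denseA u.2 e0.
by exists (f, g) => //; rewrite prod_normE ge_max hf hg.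
Qed.

Lemma cmap_cvg u : cdom u -> exists l : W, cmap (B n) u @[n --> \oo] --> l.
Proof.
move=> [[[f f'] /= Af fu] [[g g'] /= Ag gu]].
exists (f', g').
by rewrite /cmap -fu -gu; exact: cvg_pair (cvA Af) (cvA Ag).
Qed.

Lemma csgrp_cvg z u : cone z -> cexp n z u @[n --> \oo] --> csgrp z u.
Proof.
move=> cz.
apply: (@oexp_seq_cvgn _ _ HW (fun n => cgen n z) (2 * expR (w * Re z)) cdom).
- by move=> n; exact: bop_cgen.
- by move=> m n; exact: cgen_comm.
- move=> n s f /andP[s0 s1]; rewrite sc_cgen.
  have cs := cone_scale s0 cz.
  rewrite (le_trans (cexp_bnd _ _ cs))// ler_wpM2r// ler_wpM2l// ler_expR.
  rewrite ler_wpM2l//; case: z cz {cs} => x y [/= x0 _].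
  by rewrite mul0r subr0 ler_piMl.
- exact: cdom_dense.
move=> v Dv; have [l hl] := cmap_cvg Dv.
by apply/cvg_ex; exists (cscale z l); exact: bop_cvg (bop_cscale z) hl.
Qed.

Arguments csgrp_cvg [z] u _.

Lemma csgrp_bnd z u : cone z -> `|csgrp z u| <= 2 * expR (w * Re z) * `|u|.
Proof.
by move=> cz; apply: (limn_norm_le (csgrp_cvg u cz)) => n; exact: cexp_bnd.
Qed.

Lemma clinear_lim (Q : nat -> W -> W) (L : W -> W) :
  (forall n, clinear (Q n)) -> (forall u, Q n u @[n --> \oo] --> L u) ->
  clinear L.
Proof.
move=> cQ QL z u v.
have h : cscale z (Q n u) + Q n v @[n --> \oo] --> cscale z (L u) + L v.
  by apply: cvgD => //; exact: bop_cvg (bop_cscale z) (QL u).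
have h2 := QL (cscale z u + v).
have E : (fun n => Q n (cscale z u + v)) =
  (fun n => cscale z (Q n u) + Q n v) by apply/funext => n; exact: cQ.
by rewrite E in h2; apply: (cvg_unique _ h2 h).
Qed.

Lemma cexp_clinear n z : clinear (cexp n z).
Proof.
by move=> y u v; rewrite (linD (bop_cexp n z).1) cexp_cscale.
Qed.

Lemma csgrp_clinear z : cone z -> clinear (csgrp z).
Proof.
move=> cz; apply: (@clinear_lim (fun n => cexp n z)) => [n|u].
  exact: cexp_clinear.
exact: csgrp_cvg.
Qed.

Lemma csgrp_bop z : cone z -> bop (csgrp z).
Proof.
move=> cz; split; first by apply: clinear_linear; exact: csgrp_clinear.
exists (2 * expR (w * Re z)); first by rewrite mulr_ge0// expR_ge0.
by move=> u; exact: csgrp_bnd.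
Qed.

Lemma csgrpD z y u : cone z -> cone y ->
  csgrp (z + y) u = csgrp z (csgrp y u).
Proof.
move=> cz cy; have h := csgrp_cvg u (coneD cz cy).
have E n : cexp n (z + y) u =
   cexp n z (cexp n y u - csgrp y u) + cexp n z (csgrp y u).
  by rewrite (linB (bop_cexp n z).1) subrK cexpD.
suff h' : cexp n (z + y) u @[n --> \oo] --> csgrp z (csgrp y u).
  exact: (cvg_unique (@norm_hausdorff _ _) h h').
rewrite (funext E) -[csgrp z (csgrp y u)]add0r.
apply: cvgD; last exact: csgrp_cvg.
apply/cvgr0Pnorm_le => e e0.
have M0 : 0 < 2 * expR (w * Re z) by rewrite mulr_gt0// expR_gt0.
have d0 : 0 < e / (2 * expR (w * Re z)) by rewrite divr_gt0.
have /cvgrPdist_le/(_ _ d0) := csgrp_cvg u cy; apply: filterS => n hn.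
rewrite (le_trans (cexp_bnd _ _ cz))// mulrC -ler_pdivlMr//.
by rewrite distrC.
Qed.

Lemma csgrp0 u : csgrp 0 u = u.
Proof.
have c00 : cone 0 by split; rewrite /= ?normr0 ?mulr0.
have h := csgrp_cvg u c00.
have E : (fun n => cexp n 0 u) = (fun _ => u).
  apply/funext => n; rewrite /cexp.
  have -> : cgen n 0 = (fun _ => 0).
    apply/funext => v; rewrite /cgen -[0]/(Complex 0 0) cscale_real scale0r.
    by [].
  exact: oexp0.
rewrite E in h; apply: (cvg_unique _ h) => //; exact: cvg_cst.
Qed.

Lemma csgrp_small u (e : R) : 0 < e -> exists2 r : R, 0 < r &
  forall z, cone z -> abs1 z <= r -> `|csgrp z u - u| <= e.
Proof.
move=> e0; pose M := 2 * expR w.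
have M0 : 0 < M by rewrite mulr_gt0// expR_gt0.
have d0 : 0 < e / 2 / (M + 1) by rewrite !divr_gt0// addr_gt0.
have [h Dh uh] := cdom_dense u d0.
have [l /cvg_seq_norm_bounded[C C0 hC]] := cmap_cvg Dh.
pose r := Num.min 1 (e / 2 / (M * C)).
have r0 : 0 < r by rewrite lt_min ltr01 !divr_gt0// mulr_gt0.
exists r => // z cz; rewrite le_min => /andP[z1 z2].
have hc : (cexp n z u - u) @[n --> \oo] --> csgrp z u - u.
  by apply: cvgB; [exact: csgrp_cvg|exact: cvg_cst].
apply: (limn_norm_le hc) => n.
have x1 : Re z <= 1.
  by apply: le_trans z1; rewrite (le_trans (ler_norm _))// lerDl.
have Mb y v : cone y -> Re y <= 1 -> `|cexp n y v| <= M * `|v|.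
  move=> cy y1; rewrite (le_trans (cexp_bnd _ _ cy))// ler_wpM2r// ler_wpM2l//.
  by rewrite ler_expR ler_piMr.
have -> : cexp n z u - u = (cexp n z (u - h) - (u - h)) + (cexp n z h - h).
  by rewrite (linB (bop_cexp n z).1) subrACA subrK.
rewrite (le_trans (ler_normD _ _))// (splitr e) lerD//.
  rewrite (le_trans (ler_normB _ _))// (@le_trans _ _ ((M + 1) * `|u - h|))//.
    by rewrite mulrDl mul1r lerD2r Mb.
  by rewrite mulrC -ler_pdivlMr// addr_gt0.
apply: (@le_trans _ _ (M * `|cgen n z h|)).
  apply: (@oexp_sub_bound _ _ HW (cgen n z) id) => //.
  - exact: bop_cgen.
  - exact: bop_id.
  move=> s v /andP[s0 s1]; rewrite sc_cgen; apply: Mb; first exact: cone_scale.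
  case: z cz {z1 z2 hc} x1 => x y [/= x0 _] x1; rewrite mul0r subr0.
  by rewrite mulr_ile1.
apply: (@le_trans _ _ (M * (e / 2 / (M * C) * C))).
  rewrite ler_wpM2l ?(ltW M0)// (le_trans (cscale_bnd _ _))// ler_pM//.
  exact: addr_ge0.
rewrite le_eqVlt; apply/orP; left; apply/eqP; field.
by rewrite !gt_eqF.
Qed.

(** For real [t] the exponential series of the complexified approximant is computed componentwise,
    so both sides are limits of the same sequences. *)
Lemma csgrp_real (t : R) f g : 0 <= t ->
  csgrp (Complex t 0) (f, g) = (sgrp B t f, sgrp B t g).
Proof.
move=> t0.
have gB' n : exists2 h0, 0 < h0 & forall tau f, 0 <= tau <= h0 ->
     `|f + tau *: B n f| <= (1 + tau * w) * `|f|.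
  have [h0 h00 h] := gB n; exists h0 => // tau f' /[dup] /andP[t'0 _] /h.
  move=> /(_ f')/le_trans; apply.
  by rewrite gerBl mulr_ge0// mulr_ge0// ltW.
have ct : cone (Complex t 0) by split => //=; rewrite normr0 mulr_ge0// ltW// divr_gt0.
have h := csgrp_cvg (f, g) ct.
have h2 : (oexp (sc t (B n)) f, oexp (sc t (B n)) g) @[n --> \oo] -->
    ((sgrp B t f, sgrp B t g) : W).
  exact: cvg_pair (sgrp_cvg HV bB cB w0 gB' denseA cvA (f := f) t0)
   (sgrp_cvg HV bB cB w0 gB' denseA cvA (f := g) t0).
suff E : (fun n => cexp n (Complex t 0) (f, g)) =
  (fun n => (oexp (sc t (B n)) f, oexp (sc t (B n)) g)).
  by rewrite E in h; exact: (cvg_unique (@norm_hausdorff _ _) h h2).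
apply/funext => n.
have bt := bop_sc t (bB n).
have h3 := oexp_cvg HW (f, g) (bop_cgen n (Complex t 0)).
have h4 : (series (expt (sc t (B n)) f) k, series (expt (sc t (B n)) g) k)
    @[k --> \oo] --> ((oexp (sc t (B n)) f, oexp (sc t (B n)) g) : W).
  exact: cvg_pair (oexp_cvg HV f bt) (oexp_cvg HV g bt).
suff E : series (expt (cgen n (Complex t 0)) (f, g)) =
  (fun k => (series (expt (sc t (B n)) f) k, series (expt (sc t (B n)) g) k)).
  by rewrite E in h3; exact: (cvg_unique (@norm_hausdorff _ _) h3 h4).
apply/funext => k.
have E j : expt (cgen n (Complex t 0)) (f, g) j =
   (expt (sc t (B n)) f j, expt (sc t (B n)) g j).
  rewrite /expt; set x := iter j (cgen _ _) _.
  have -> : x = (iter j (sc t (B n)) f, iter j (sc t (B n)) g).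
    rewrite /x; elim: j {x} => //= j ->.
    by rewrite /cgen cscale_real.
  by [].
rewrite /series/=; elim: k => [|k IHk]; first by rewrite !big_geq.
by rewrite !big_nat_recr//= IHk E.
Qed.

Definition cder z u : W := seq_lim (fun n => cmap (B n) (cexp n z u)).

(** Smoothing bounds these operators uniformly in [n], so convergence on the dense set [cdom]
    suffices. There [B n] may be moved inside the exponential, where it converges. *)
Lemma cder_cvg z u : cone z -> 0 < Re z ->
  cmap (B n) (cexp n z u) @[n --> \oo] --> cder z u.
Proof.
move=> cz z0.
pose C := 2 * expR (2 * (w * Re z)) / (c / 2 * Re z).
apply: (@cvgn_dense _ _ HW (fun n u => cmap (B n) (cexp n z u)) C cdom).
- by move=> n; exact: (bop_comp (bop_cmap (bB n)) (bop_cexp n z)).1.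
- by move=> n f; exact: cexp_smoothing.
- exact: cdom_dense.
move=> v Dv; have [l hl] := cmap_cvg Dv.
apply/cvg_ex; exists (csgrp z l).
have E n : cmap (B n) (cexp n z v) =
   cexp n z (cmap (B n) v - l) + cexp n z l.
  by rewrite (linB (bop_cexp n z).1) subrK cexp_cmap.
rewrite (funext E) -[csgrp z l]add0r.
apply: cvgD; last exact: csgrp_cvg.
apply/cvgr0Pnorm_le => e e0.
have M0 : 0 < 2 * expR (w * Re z) by rewrite mulr_gt0// expR_gt0.
have d0 : 0 < e / (2 * expR (w * Re z)) by rewrite divr_gt0.
have /cvgrPdist_le/(_ _ d0) := hl; apply: filterS => n hn.
rewrite (le_trans (cexp_bnd _ _ cz))// mulrC -ler_pdivlMr//.
by rewrite distrC.
Qed.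

Arguments cder_cvg [z] u _ _.

Lemma cder_clinear z : cone z -> 0 < Re z -> clinear (cder z).
Proof.
move=> cz z0.
apply: (@clinear_lim (fun n u => cmap (B n) (cexp n z u))) => [n|u].
  move=> y u v.
  rewrite cexp_clinear (linD (bop_cmap (bB n)).1).
  by rewrite (cmap_cscale _ (bB n).1).
exact: cder_cvg.
Qed.

Lemma cder_continuous z : cone z -> 0 < Re z -> continuous (cder z).
Proof.
move=> cz z0; apply: bop_continuous; split.
  by apply: clinear_linear; exact: cder_clinear.
exists (2 * expR (2 * (w * Re z)) / (c / 2 * Re z)).
  by rewrite divr_ge0 ?mulr_ge0 ?expR_ge0 ?divr_ge0 ?(ltW c0) ?(ltW z0).
move=> u; apply: (limn_norm_le (cder_cvg u cz z0)) => n.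
exact: cexp_smoothing.
Qed.

(** Write [z = hz + hz]. One half is the operator [E] that keeps the exponentials of [h] bounded,
    since [s h + hz] stays in the cone although [h] need not lie in it. The other half is split into
    two quarters, one smoothing step for each of the two generators in the remainder. The aperture
    [c / 4], half that of the cone, leaves room for a disc around [z]. *)
Lemma cexp_taylor z : 0 < Re z -> `|Im z| <= c / 4 * Re z ->
  exists rho C : R, [/\ 0 < rho, 0 <= C,
    forall h, abs1 h <= rho -> cone (z + h) &
    forall n h u, abs1 h <= rho ->
    `|cexp n (z + h) u - cexp n z u - cscale h (cmap (B n) (cexp n z u))| <=
      C * abs1 h ^+ 2 * `|u|].
Proof.
move=> x0 yx; pose hz := Complex 2^-1 0 * z; pose qz := Complex 4^-1 0 * z.
have hzE : hz + hz = z.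
  rewrite /hz; case: (z) => a b; congr (Complex _ _) => /=; by field.
have qzE : qz + qz = hz.
  rewrite /qz /hz; case: (z) => a b; congr (Complex _ _) => /=; by field.
have Rehz : Re hz = Re z / 2.
  by rewrite /hz; case: (z) => a b /=; field.
have Imhz : Im hz = Im z / 2.
  by rewrite /hz; case: (z) => a b /=; field.
have Reqz : Re qz = Re z / 4.
  by rewrite /qz; case: (z) => a b /=; field.
have cz : cone z.
  split; first exact: ltW.
  apply: (le_trans yx); rewrite ler_wpM2r ?(ltW x0)// ler_wpM2l ?(ltW c0)//.
  by rewrite lef_pV2 ?posrE// ler_nat.
have cqz : cone qz by apply: cone_scale => //; rewrite invr_ge0.
pose x := Re z; have c20 : 0 < 1 + c / 2 by rewrite addr_gt0// divr_gt0.
(* The cone condition for [s h + hz] follows from [rho + c / 8 * x <= c / 2 * (x / 2 - rho)], which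
   [rho] satisfies with equality. *)
pose rho := c / 8 * x / (1 + c / 2).
have rho0 : 0 < rho by rewrite !divr_gt0// !mulr_gt0// invr_gt0.
have rhoE : rho * (1 + c / 2) = c / 8 * x by rewrite /rho divfK// gt_eqF.
have rhox : rho <= x / 4.
  rewrite /rho ler_pdivrMr//; have := mulr_gt0 c0 x0; rewrite -/x.
  by have : 0 < x by []; lra.
have near h s : abs1 h <= rho -> 0 <= s <= 1 ->
    cone (Complex s 0 * h + hz) /\ Re (Complex s 0 * h + hz) <= x.
  move=> hr /andP[s0 s1].
  have hp : `|Re h| <= rho by apply: le_trans hr; rewrite lerDl.
  have hq : `|Im h| <= rho by apply: le_trans hr; rewrite lerDr.
  have -> : Re (Complex s 0 * h + hz) = s * Re h + x / 2.
    by rewrite -Rehz; case: (h) => p q; case: (hz) => p' q' /=; ring.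
  have sp : `|s * Re h| <= rho.
    by rewrite normrM (ger0_norm s0) (le_trans _ hp)// ler_piMl.
  have sq : `|s * Im h| <= rho.
    by rewrite normrM (ger0_norm s0) (le_trans _ hq)// ler_piMl.
  have := sp; rewrite ler_norml => /andP[sp1 sp2].
  have xx : 0 < x by [].
  split; last lra.
  split.
    have -> : Re (Complex s 0 * h + hz) = s * Re h + x / 2.
      by rewrite -Rehz; case: (h) => p q; case: (hz) => p' q' /=; ring.
    lra.
  have -> : Re (Complex s 0 * h + hz) = s * Re h + x / 2.
    by rewrite -Rehz; case: (h) => p q; case: (hz) => p' q' /=; ring.
  have -> : Im (Complex s 0 * h + hz) = s * Im h + Im z / 2.
    by rewrite -Imhz; case: (h) => p q; case: (hz) => p' q' /=; ring.
  rewrite (le_trans (ler_normD _ _))//.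
  have -> : `|Im z / 2| = `|Im z| / 2 by rewrite normrM (ger0_norm (x := 2^-1)).
  have h1 : c / 2 * (x / 2 - rho) <= c / 2 * (s * Re h + x / 2).
    by rewrite ler_wpM2l ?divr_ge0 ?(ltW c0)//; lra.
  move: yx rhoE; rewrite -/x; lra.
pose M := 2 * expR (w * x).
have M0 : 0 <= M by rewrite mulr_ge0// expR_ge0.
(* The smoothing constant of one quarter; it enters twice, hence [D ^+ 2] in the result. *)
pose D := 2 * expR (2 * (w * Re qz)) / (c / 2 * Re qz).
have D0 : 0 <= D.
  rewrite divr_ge0 ?mulr_ge0 ?expR_ge0 ?divr_ge0 ?(ltW c0)//.
  by rewrite Reqz divr_ge0// ltW.
exists rho, (M * D ^+ 2); split=> //.
- by rewrite mulr_ge0// exprn_ge0.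
- move=> h hr; have [ch _] := near h 1 hr (introT andP (conj ler01 (lexx _))).
  have -> : z + h = (Complex 1 0 * h + hz) + hz.
    rewrite -{1}hzE; case: (h) => p q; case: (hz) => p' q'.
    by congr (Complex _ _) => /=; ring.
  by apply: coneD => //; apply: cone_scale => //; rewrite invr_ge0.
move=> n h u hr.
have Eg : cexp n hz (cexp n hz u) = cexp n z u by rewrite -cexpD hzE.
have := @oexp_sub2_bound _ _ HW (cgen n h) (cexp n hz) M (cexp n hz u) M0
  (bop_cgen n h) (bop_cexp n hz).
rewrite Eg -/(cexp n h) -cexpD [h + z]addrC /cgen -/(cgen n h) => H.
apply: (le_trans (H _ _)).
- apply: comm_sym; apply: comm_oexp; [exact: HW|exact: bop_cgen| |].
    exact: bop_cgen.
  exact: cgen_comm.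
- move=> s v s01; rewrite sc_cgen -/(cexp n _) -cexpD.
  have [ch chx] := near h s hr s01.
  rewrite (le_trans (cexp_bnd _ _ ch))// ler_wpM2r// ler_wpM2l// ler_expR.
  by rewrite ler_wpM2l.
have -> : M * D ^+ 2 * abs1 h ^+ 2 * `|u| =
    M * (abs1 h * (abs1 h * (D * (D * `|u|)))) by ring.
rewrite ler_wpM2l// (le_trans (cscale_bnd _ _))// ler_wpM2l ?addr_ge0//.
rewrite (cmap_cscale _ (bB n).1).
rewrite (le_trans (cscale_bnd _ _))// ler_wpM2l ?addr_ge0//.
rewrite -qzE cexpD -cexp_cmap.
have z40 : 0 < Re qz by rewrite Reqz divr_gt0.
rewrite (le_trans (cexp_smoothing _ _ cqz z40))// -/D ler_wpM2l//.
exact: cexp_smoothing.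
Qed.

Lemma csgrp_holomorphic z : 0 < Re z -> `|Im z| <= c / 4 * Re z ->
  op_holomorphic_at csgrp z.
Proof.
move=> x0 yx; have [rho [C [rho0 C0 chz hT]]] := cexp_taylor x0 yx.
have cz : cone z.
  by rewrite -[z]addr0; apply: chz; rewrite /abs1 /= normr0 addr0 ltW.
exists (cder z); split; [exact: cder_clinear|exact: cder_continuous|].
move=> eps eps0.
(* The 2 comes from [abs1 h^-1 * abs1 h <= 2]; the radius is halved below because [abs1] is at most
   twice the modulus. *)
have C20 : 0 < 2 * C + 1 by rewrite ltr_wpDl// mulr_ge0.
pose r := Num.min rho (eps / (2 * C + 1)).
have r0 : 0 < r by rewrite lt_min rho0 divr_gt0.
pose r2 := r / 2; have r20 : 0 < r2 by rewrite divr_gt0.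
apply/nbhs_ballP; exists (r2%:C)%C => /=; first by rewrite ltcR.
move=> h; rewrite -ball_normE /= sub0r normrN => hr2 h0 u.
have hr : abs1 h <= r.
  by rewrite (le_trans (abs1_le_norm hr2))// /r2 mulrC divfK.
have hrho : abs1 h <= rho by rewrite (le_trans hr)// ge_min lexx.
have heps : abs1 h <= eps / (2 * C + 1).
  by rewrite (le_trans hr)// ge_min lexx orbT.
have czh := chz h hrho.
have key : `|csgrp (z + h) u - csgrp z u - cscale h (cder z u)| <=
    C * abs1 h ^+ 2 * `|u|.
  have hc : (cexp n (z + h) u - cexp n z u -
      cscale h (cmap (B n) (cexp n z u))) @[n --> \oo] -->
      csgrp (z + h) u - csgrp z u - cscale h (cder z u).
    apply: cvgB; first by apply: cvgB; exact: csgrp_cvg.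
    exact: bop_cvg (bop_cscale h) (cder_cvg u cz x0).
  by apply: (limn_norm_le hc) => n; exact: hT.
have -> : cscale h^-1 (csgrp (z + h) u - csgrp z u) - cder z u =
    cscale h^-1 (csgrp (z + h) u - csgrp z u - cscale h (cder z u)).
  by rewrite [RHS](linB (cscale_linear _)) -cscaleM mulVf// cscale1.
have a0 : 0 <= abs1 h by exact: addr_ge0.
have aV0 : 0 <= abs1 h^-1 by exact: addr_ge0.
apply: (le_trans (cscale_bnd _ _)).
apply: (@le_trans _ _ (abs1 h^-1 * (C * abs1 h ^+ 2 * `|u|))).
  by rewrite ler_wpM2l.
have -> : abs1 h^-1 * (C * abs1 h ^+ 2 * `|u|) =
   (abs1 h^-1 * abs1 h) * (C * abs1 h * `|u|) by ring.
apply: (@le_trans _ _ (2 * (C * abs1 h * `|u|))).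
  by rewrite ler_wpM2r ?abs1V// !mulr_ge0.
rewrite 2!mulrA ler_wpM2r//.
apply: (@le_trans _ _ ((2 * C + 1) * abs1 h)).
  by rewrite ler_wpM2r// lerDl.
by rewrite mulrC -ler_pdivlMr.
Qed.

Lemma sector_angle : exists2 delta : R, 0 < delta <= pi / 2 &
  forall z, sector delta z -> 0 < Re z /\ `|Im z| <= c / 4 * Re z.
Proof.
have c40 : 0 < c / 4 by rewrite divr_gt0.
have hcos : cos t @[t --> (0 : R)] --> (1 : R).
  by rewrite -[X in _ --> X](@cos0 R); exact: continuous_cos.
have hsin : sin t @[t --> (0 : R)] --> (0 : R).
  by rewrite -[X in _ --> X](@sin0 R); exact: continuous_sin.
have hf : \forall t \near (0 : R), 0 < cos t /\ `|sin t| <= c / 4 * cos t.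
  near=> t.
  have h1 : `|1 - cos t| <= 2^-1.
    by near: t; have /cvgrPdist_le := hcos; apply; rewrite invr_gt0.
  have h2 : `|0 - sin t| <= c / 8.
    by near: t; have /cvgrPdist_le := hsin; apply; rewrite divr_gt0.
  move: h1 h2; rewrite sub0r normrN ler_norml => /andP[h1 h1'] h2.
  have h3 : 2^-1 <= cos t by lra.
  have h4 : c / 4 * 2^-1 <= c / 4 * cos t by rewrite ler_wpM2l// ltW.
  split; first by lra.
  by apply: (le_trans h2); apply: le_trans h4; lra.
move/nbhs_ballP: hf => [r /= r0 hr].
exists (Num.min r (pi / 2)).
  by rewrite lt_min r0 divr_gt0 ?pi_gt0//= ge_min lexx orbT.
move=> _ [s [t [s0 ht ->]]] /=.
have [|ct st] := hr t.
  by rewrite -ball_normE /= sub0r normrN (lt_le_trans ht)// ge_min lexx.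
split; first exact: mulr_gt0.
by rewrite normrM (gtr0_norm s0) mulrCA ler_wpM2l// ltW.
Unshelve. all: by end_near. Qed.

Lemma sgrp_analytic : is_analytic (sgrp B).
Proof.
have [delta hd hs] := sector_angle.
have sc z : sector delta z -> cone z.
  move=> /hs[x0 yx]; split; first exact: ltW.
  apply: (le_trans yx); rewrite ler_wpM2r ?(ltW x0)// ler_wpM2l ?(ltW c0)//.
  by rewrite lef_pV2 ?posrE// ler_nat.
exists delta, csgrp; split; [exact: hd| |]; last first.
  by move=> t t0 f g; exact: csgrp_real.
split.
- move=> z /sc cz; split; first exact: csgrp_clinear.
  by apply: bop_continuous; exact: csgrp_bop.
- exact: csgrp0.
- by move=> z y /sc cz /sc cy u; exact: csgrpD.
- by move=> z /hs[]; exact: csgrp_holomorphic.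
move=> delta' /andP[d'0 d'd] u; apply/cvgrPdist_le => e e0.
have [r r0 hr] := csgrp_small u e0.
pose r2 := r / 2; have r20 : 0 < r2 by rewrite divr_gt0.
apply/nbhs_ballP; exists (r2%:C)%C => /=; first by rewrite ltcR.
move=> z; rewrite -ball_normE /= sub0r normrN => hz sz.
have {}sz : sector delta z.
  move: sz => [s [t [s0 td ->]]]; exists s, t; split=> //.
  exact: lt_trans td d'd.
rewrite distrC; apply: hr; first exact: sc.
by rewrite (le_trans (abs1_le_norm hz))// /r2 mulrC divfK.
Qed.

End analytic.

(** * Generation theorem for strongly dissipative operators *)

Section generation.
Context {R : realType} {V : normedModType R}.
Hypothesis HV : seq_complete V.
Variables (A : set (V * V)) (w c : R).
Hypotheses (w0 : 0 <= w) (c0 : 0 <= c) (linA : lin_graph A)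
  (dissA : dissipative A w c w)
  (rangeA : forall l h, w < l -> exists f, A (f, l *: f - h))
  (denseA : forall f (e : R), 0 < e -> exists2 g, dom A g & `|f - g| <= e).

Theorem generation : exists S : R -> V -> V,
  [/\ C0_semigroup S, generator S = A, 0 < c -> is_analytic S &
    forall P : set V, P 0 -> (forall f g, P f -> P g -> P (f + g)) ->
      (forall a f, 0 <= a -> P f -> P (a *: f)) ->
      (forall u f, (forall n, P (u n)) -> u @ \oo --> f -> P f) ->
      (forall l f h, w < l -> P h -> A (f, l *: f - h) -> P f) ->
      forall t f, 0 <= t -> P f -> P (S t f)].
Proof.
pose N0 := Num.bound (2 * w).
have HN0 : 2 * w < N0%:R by apply: archi_boundP; rewrite mulr_ge0.
have ln2 n : 2 * w < (n + N0)%:R.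
  by rewrite (lt_le_trans HN0)// ler_nat leq_addl.
have lnw n : w < (n + N0)%:R by apply: le_lt_trans (ln2 n); rewrite mulr_natl mulr2n lerDl.
have ln0 n : 0 < (n + N0)%:R :> R by rewrite (le_lt_trans w0).
have /choice[Q hQ] : forall n, exists Q, is_resolvent A (n + N0)%:R Q /\
    forall h, ((n + N0)%:R - w) * `|Q h| + c * `|(n + N0)%:R *: Q h - h| <= `|h|.
  by move=> n; apply: resolvent_ex => // h; exact: rangeA.
pose B := yosida Q N0.
have QR n : is_resolvent A (n + N0)%:R (Q n) by have [] := hQ n.
have Qe n h : ((n + N0)%:R - w) * `|Q n h| + c * `|(n + N0)%:R *: Q n h - h|
    <= `|h| by have [_] := hQ n.
have bB n : bop (B n) by exact: (bop_yosida w0 c0 HN0 QR Qe).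
have cB m n : comm_op (B m) (B n) by exact: (yosida_comm w0 c0 HN0 QR Qe).
have gB n : exists2 h0, 0 < h0 & forall tau f, 0 <= tau <= h0 ->
    `|f + tau *: B n f| <= (1 + tau * (2 * w)) * `|f| - tau * (c * `|B n f|).
  exists ((n + N0)%:R^-1); first by rewrite invr_gt0.
  move=> tau f /andP[t0 t1]; apply: (yosida_growth w0 c0 HN0 Qe) => //.
  by rewrite -ler_pdivlMr// mul1r.
have gB' n : exists2 h0, 0 < h0 & forall tau f, 0 <= tau <= h0 ->
    `|f + tau *: B n f| <= (1 + tau * (2 * w)) * `|f|.
  have [h0 h00 h] := gB n; exists h0 => // tau f /[dup] /andP[t0 _] /h.
  by move=> /(_ f)/le_trans; apply; rewrite gerBl !mulr_ge0.
have cvA f g : A (f, g) -> B n f @[n --> \oo] --> g.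
  exact: (yosida_cvg w0 c0 HN0 QR Qe denseA).
have w20 : 0 <= 2 * w by rewrite mulr_ge0.
exists (sgrp B); split.
- exact: (sgrp_C0 HV bB cB w20 gB' denseA cvA).
- apply: (sgrp_generator HV bB cB w20 gB' denseA cvA) => //.
  by exists w => l h; exact: rangeA.
- move=> cp; exact: (sgrp_analytic HV bB cB w20 cp gB denseA cvA).
move=> P P0 PD PZ Pc PA; apply: (sgrp_cone HV bB cB w20 gB' denseA cvA) => //.
(* With [l = n + N0], [B n + l] is [l ^ 2] times the resolvent, which preserves [P]. *)
move=> n; exists (n + N0)%:R => f Pf.
have -> : B n f + (n + N0)%:R *: f = (n + N0)%:R *: ((n + N0)%:R *: Q n f).
  by rewrite /B /yosida scalerBr subrK.
have [_ _ hR] := QR n.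
apply: (PZ _ _ (ltW (ln0 n))); apply: (PZ _ _ (ltW (ln0 n))).
by apply: (PA _ _ f (lnw n) Pf); exact/hR.
Qed.

End generation.

Lemma cvg_finite_sum (R : realType) (T : Type) (F : set_system T) (I : Type)
  (r : seq I) (u : I -> T -> R) (l : I -> R) : Filter F ->
  (forall i, u i x @[x --> F] --> l i) ->
  \sum_(i <- r) u i x @[x --> F] --> \sum_(i <- r) l i.
Proof.
by move=> FF h; apply: cvg_big => //; exact: add_continuous.
Qed.

(** * Weighted l^1 spaces *)

Section weighted_l1.
Context {R : realType} {m : R}.
Implicit Types (f g : wl1 m).

Lemma wl1_at0 f : f 0%N = 0.
Proof. by have := wl1_funP f; rewrite inE => -[]. Qed.

Lemma wl1D f g n : (f + g) n = f n + g n. Proof. by []. Qed.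
Lemma wl1B f g n : (f - g) n = f n - g n. Proof. by []. Qed.
Lemma wl1Z (a : R) f n : (a *: f) n = a * f n. Proof. by []. Qed.

Lemma wl1P f g : (forall n, (1 <= n)%N -> f n = g n) -> f = g.
Proof.
move=> fg; apply: val_inj; apply/funext => -[|n] /=; last exact: fg.
by rewrite !wl1_at0.
Qed.

Lemma wl1_partial f N : \sum_(1 <= n < N) n%:R `^ m * `|f n| <= `|f|.
Proof.
rewrite -lee_fin [X in (_ <= X)%E](_ : _ = wl1_sum m f); last first.
  by rewrite -[RHS]fineK ?wl1_sum_fin.
rewrite -sumEFin; apply: (nneseries_lim_ge (P := xpredT)) => n _ _.
exact: wl1_term_ge0.
Qed.

Lemma wl1_ex (f : nat -> R) (C : R) : f 0%N = 0 ->
  (forall N, \sum_(1 <= n < N) n%:R `^ m * `|f n| <= C) ->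
  exists2 F : wl1 m, wl1_fun F = f & `|F| <= C.
Proof.
move=> f0 hC.
have sC : (wl1_sum m f <= C%:E)%E.
  apply: lime_le; first by apply: is_cvg_nneseries => n _ _; exact: wl1_term_ge0.
  by apply: nearW => N; rewrite sumEFin lee_fin.
have fP : f \in wl1_pred m.
  by rewrite inE; split=> //; apply: le_lt_trans sC _; exact: ltry.
exists (WL1 fP) => //.
by rewrite -lee_fin; apply: le_trans sC; rewrite -[leRHS]fineK// (wl1_sum_fin (WL1 fP)).
Qed.

Lemma wl1_norm_le f (C : R) :
  (forall N, \sum_(1 <= n < N) n%:R `^ m * `|f n| <= C) -> `|f| <= C.
Proof.
move=> hC; have [F Ff FC] := wl1_ex (wl1_at0 f) hC.
suff -> : f = F by [].
by apply: wl1P => n _; rewrite Ff.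
Qed.

(** If beyond every [N] some block exceeded [e], all partial sums, and hence the norm, would be at
    most [|f| - e]. *)
Lemma wl1_tail f (e : R) : 0 < e ->
  exists N, forall M, \sum_(N.+1 <= n < M) n%:R `^ m * `|f n| <= e.
Proof.
move=> e0; apply: contrapT => /forallNP hN.
suff : `|f| <= `|f| - e by rewrite lerBrDr gerDl leNgt e0.
apply: wl1_norm_le => N; have /existsNP[M /negP] := hN N.
rewrite -ltNge => hM.
have [NM|MN] := leqP N.+1 M; last first.
  by move: hM; rewrite big_geq ?(ltnW MN)// ltNge ltW.
rewrite lerBrDr (le_trans _ (wl1_partial f M))//.
have [N0|N1] := leqP N 0.
  move: N0 NM hM; rewrite leqn0 => /eqP -> NM hM.
  by rewrite big_geq// add0r ltW.
rewrite [leRHS](big_cat_nat N1 (ltnW NM))/= lerD2l (le_trans (ltW hM))//.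
by rewrite [leRHS]big_ltn// lerDr mulr_ge0// powR_ge0.
Qed.

Hypothesis m0 : 0 <= m.

Lemma powR_nat_ge1 n : (1 <= n)%N -> 1 <= n%:R `^ m.
Proof.
move=> n1; have {1}-> : 1 = 1 `^ m :> R by rewrite powR1.
by apply: ge0_ler_powR => //; rewrite ?nnegrE// ler1n.
Qed.

Lemma wl1_weighted_coord f n : (1 <= n)%N -> n%:R `^ m * `|f n| <= `|f|.
Proof.
move=> n1; apply: le_trans (wl1_partial f n.+1).
by rewrite big_nat_recr//= lerDr sumr_ge0.
Qed.

Lemma wl1_coord f n : `|f n| <= `|f|.
Proof.
case: n => [|n]; first by rewrite wl1_at0 normr0.
by rewrite (le_trans _ (wl1_weighted_coord f (ltn0Sn n)))// ler_peMl// powR_nat_ge1.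
Qed.

Lemma wl1_coord_cvg (u : nat -> wl1 m) f n : u @ \oo --> f ->
  u k n @[k --> \oo] --> f n.
Proof.
move=> /cvgrPdist_le uf; apply/cvgrPdist_le => e e0.
have := uf e e0; apply: filterS => k; apply: le_trans.
by rewrite -wl1B wl1_coord.
Qed.

Lemma wl1_complete : seq_complete (wl1 m).
Proof.
move=> u hu.
have cu n : cvgn (fun k => u k n).
  apply/cauchy_cvgP/cauchy_exP => e e0.
  have e20 : 0 < e / 2 by rewrite divr_gt0.
  have [N hN] := hu _ e20; exists (u N n).
  exists N => // k /= Nk; rewrite -ball_normE /=.
  rewrite -wl1B (le_lt_trans (wl1_coord _ _))// (le_lt_trans (hN _ _ _ _))//.
  by rewrite ltr_pdivrMr// ltr_pMr// ltr1n.
pose f n := limn (fun k => u k n).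
have f0 : f 0%N = 0.
  rewrite /f; under eq_fun do rewrite wl1_at0.
  exact: lim_cst.
have key (e : R) : 0 < e -> exists N, forall k, (N <= k)%N ->
    forall M, \sum_(1 <= n < M) n%:R `^ m * `|u k n - f n| <= e.
  move=> e0; have [N hN] := hu _ e0; exists N => k Nk M.
  have h : \sum_(1 <= n < M) n%:R `^ m * `|u k n - u l n| @[l --> \oo] -->
      \sum_(1 <= n < M) n%:R `^ m * `|u k n - f n|.
    apply: cvg_finite_sum => n; apply: cvgMl_tmp; apply: cvg_norm.
    by apply: cvgB; [exact: cvg_cst|exact: cu].
  apply: (cvgr_to_le h); exists N => // l /= Nl.
  exact: le_trans (wl1_partial (u k - u l) M) (hN _ _ Nk Nl).
have [N1 hN1] := key 1 ltr01.
have g0 : u N1 0%N - f 0%N = 0 by rewrite f0 wl1_at0 subr0.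
(* Only the difference between [u N1] and the coordinatewise limit has known bounds on its partial
   sums; the limit is recovered as [u N1 - G]. *)
have [G GE _] := @wl1_ex (fun n => u N1 n - f n) _ g0 (hN1 N1 (leqnn _)).
apply/cvg_ex; exists (u N1 - G); apply/cvgrPdist_le => e e0.
have [N hN] := key e e0; exists N => // k /= Nk.
rewrite distrC; apply: wl1_norm_le => M; apply: le_trans (hN k Nk M).
apply: ler_sum => n _; by rewrite !wl1B GE subKr.
Qed.

End weighted_l1.

(** * Sums of nonnegative terms *)

Section finite_sums.
Context {R : realType}.
Implicit Types (x y : nat -> R).

Lemma triangular_exchange (F : nat -> nat -> R) M :
  \sum_(1 <= n < M) \sum_(n.+1 <= i < M) F n i =
  \sum_(1 <= i < M) \sum_(1 <= n < i) F n i.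
Proof.
elim: M => [|M IHM]; first by rewrite !big_geq.
have [M0|M1] := leqP M 0.
  by move: M0; rewrite leqn0 => /eqP ->; rewrite !big_geq.
rewrite big_nat_recr//= [in RHS]big_nat_recr//= -IHM.
rewrite [X in _ + X = _]big_geq// addr0 -big_split/=.
by apply: eq_big_nat => n /andP[n1 nM]; rewrite big_nat_recr.
Qed.

Lemma ler_sum_ext x N M : (N <= M)%N -> (forall n, (1 <= n)%N -> 0 <= x n) ->
  \sum_(1 <= n < N) x n <= \sum_(1 <= n < M) x n.
Proof.
move=> NM x0; have [N0|N1] := leqP N 0.
  rewrite big_geq; last by rewrite (leq_trans N0).
  by rewrite big_nat_cond sumr_ge0// => i /andP[/andP[i1 _] _]; exact: x0.
rewrite [leRHS](big_cat_nat N1 NM)/= lerDl big_nat_cond.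
rewrite sumr_ge0// => i /andP[/andP[i1 _] _]; apply: x0.
exact: leq_trans i1.
Qed.

(** The argument of [wl1_tail], with the supremum of the partial sums in place of the norm. *)
Lemma bounded_sum_tail x (C : R) : (forall n, (1 <= n)%N -> 0 <= x n) ->
  (forall N, \sum_(1 <= n < N) x n <= C) ->
  forall e : R, 0 < e -> exists N, forall M, \sum_(N.+1 <= n < M) x n <= e.
Proof.
move=> x0 xC e e0; apply: contrapT => /forallNP hN.
pose S := [set r | exists N, r = \sum_(1 <= n < N) x n].
have supS : has_sup S.
  split; first by exists (\sum_(1 <= n < 0) x n), 0%N.
  by exists C => _ [N ->].
suff : sup S <= sup S - e by rewrite lerBrDr gerDl leNgt e0.
apply: ge_sup; first by case: supS.
move=> _ [N ->]; have /existsNP[M /negP] := hN N.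
rewrite -ltNge => hM.
have [NM|MN] := leqP N.+1 M; last first.
  by move: hM; rewrite big_geq ?(ltnW MN)// ltNge ltW.
have hs : \sum_(1 <= n < M) x n <= sup S.
  by apply: sup_upper_bound => //; exists M.
rewrite lerBrDr (le_trans _ hs)//.
have M1 : (1 <= M)%N by rewrite (leq_trans _ NM).
have h1 : \sum_(1 <= n < N) x n <= \sum_(1 <= n < N.+1) x n.
  exact: ler_sum_ext.
rewrite [leRHS](@big_cat_nat _ _ _ N.+1)//=.
by rewrite lerD// ltW.
Qed.

(** [x] is the difference of the nonnegative sequences [|x| + x] and [|x|], whose partial sums are
    monotone and bounded. *)
Lemma abs_bounded_cvg x (C : R) k :
  (forall N, \sum_(k <= i < N) `|x i| <= C) ->
  cvgn (fun N => \sum_(k <= i < N) x i).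
Proof.
move=> hC.
have mono y : (forall i, 0 <= y i) -> (forall N, \sum_(k <= i < N) y i <= 2 * C) ->
    cvgn (fun N => \sum_(k <= i < N) y i).
  move=> y0 yC; apply: nondecreasing_is_cvgn; last first.
    by exists (2 * C) => _ [N _ <-].
  apply/nondecreasing_seqP => N; have [kN|Nk] := leqP k N.
    by rewrite big_nat_recr//= lerDl.
  by rewrite !big_geq// ltnW.
have C0 : 0 <= C by have := hC 0%N; rewrite big_geq.
have c1 : cvgn (fun N => \sum_(k <= i < N) `|x i|).
  by apply: mono => // N; have := hC N; lra.
have c2 : cvgn (fun N => \sum_(k <= i < N) (`|x i| + x i)).
  apply: mono => [i|N]; first by have := ler_norm (- x i); rewrite normrN; lra.
  rewrite (@le_trans _ _ (\sum_(k <= i < N) 2 * `|x i|))//.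
    by apply: ler_sum => i _; have := ler_norm (x i); lra.
  by rewrite -mulr_sumr ler_wpM2l.
rewrite (_ : (fun N => _) = (fun N => \sum_(k <= i < N) (`|x i| + x i)) -
  (fun N => \sum_(k <= i < N) `|x i|)); first exact: is_cvgB.
by apply/funext => N /=; rewrite fctE -sumrB; apply: eq_bigr => i _; rewrite addrAC subrr add0r.
Qed.

(** Otherwise [x j > e / j] from some index on, and the harmonic series would converge. It supplies
    the cut-off index for the closure of [U]. *)
Lemma harmonic_small x (C : R) J (e : R) : (forall n, (1 <= n)%N -> 0 <= x n) ->
  (forall N, \sum_(1 <= n < N) x n <= C) -> 0 < e ->
  exists2 j, (J <= j)%N & j%:R * x j <= e.
Proof.
move=> x0 xC e0; apply: contrapT => hJ.
have hx j : (maxn J 1 <= j)%N -> j%:R^-1 <= x j / e.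
  rewrite geq_max => /andP[Jj j1]; have j0 : 0 < j%:R :> R by rewrite ltr0n.
  rewrite ler_pdivlMr// mulrC ler_pdivrMr// leNgt; apply/negP => h.
  by apply: hJ; exists j => //; rewrite mulrC ltW.
apply: (@dvg_harmonic R).
pose K := maxn J 1.
have K1 : (1 <= K)%N by rewrite leq_max orbT.
apply: nondecreasing_is_cvgn.
  by apply: nondecreasing_series => n _ _; exact: harmonic_ge0.
exists (\sum_(1 <= n < K) n%:R^-1 + C / e) => _ [N _ <-].
have -> : series harmonic N = \sum_(1 <= n < N.+1) (n%:R^-1 : R).
  by rewrite /series/= big_add1.
have Ce0 : 0 <= C / e by rewrite divr_ge0 ?(ltW e0)//; have := xC 0%N; rewrite big_geq.
have V0 (n : nat) : (1 <= n)%N -> 0 <= (n%:R^-1 : R) by rewrite invr_ge0.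
have [NK|KN] := leqP N.+1 K; first by rewrite ler_wpDr// ler_sum_ext.
rewrite (big_cat_nat K1 (ltnW KN))/= lerD2l.
apply: (@le_trans _ _ ((\sum_(K <= n < N.+1) x n) / e)).
  rewrite mulr_suml big_nat_cond [leRHS]big_nat_cond.
  by apply: ler_sum => n /andP[/andP[Kn _] _]; exact: hx.
rewrite ler_wpM2r ?invr_ge0 ?(ltW e0)//; apply: le_trans (xC N.+1).
rewrite [leRHS](big_cat_nat K1 (ltnW KN))/= lerDr big_nat_cond.
by apply: sumr_ge0 => n /andP[/andP[n1 _] _]; exact: x0.
Qed.

Lemma powR_nat_mono (r : R) k n : 0 <= r -> (k <= n)%N ->
  k%:R `^ r <= n%:R `^ r.
Proof. by move=> r0 kn; apply: ge0_ler_powR; rewrite ?nnegrE// ler_nat. Qed.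

End finite_sums.

(** * A compactness criterion in weighted l^1 *)

Section compactness.
Context {R : realType} {m : R}.
Hypothesis m0 : 0 <= m.
Local Notation wt n := (n%:R `^ m).

Lemma ultra_bounded_cvg (T : Type) (G : set_system T) (x : T -> R) (C : R) :
  UltraFilter G -> G [set t | `|x t| <= C] ->
  exists r : R, x t @[t --> G] --> r.
Proof.
move=> UG GC.
have FG : ProperFilter (x @ G) by exact: fmap_proper_filter.
have GI : (x @ G) `[- C, C]%classic.
  change (G (x @^-1` `[- C, C]%classic)).
  by apply: filterS GC => t /= ht; rewrite in_itv /= -ler_norml.
have [r [_ hr]] := segment_compact FG GI; exists r.
apply/cvgrPdist_lt => e e0.
have [//|GN] := in_ultra_setVsetC [set t | `|r - x t| < e] UG.
have [] := hr (~` (ball r e)) (ball r e).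
- change (G (x @^-1` (~` (ball r e)))).
  by apply: filterS GN => t; rewrite -ball_normE.
- exact: nbhsx_ballx.
by move=> z [].
Qed.

(** An ultrafilter on the set converges in every coordinate because the coordinates are bounded.
    Since [p] tends to infinity, the bound [C1] makes the tails small uniformly on the set, which
    upgrades this to convergence in norm. *)
Lemma wl1_compact (p : nat -> R) (C1 C2 : R) :
  (forall n, (1 <= n)%N -> 0 <= p n) ->
  (forall M : R, exists N, forall n, (N <= n)%N -> M <= p n) ->
  compact [set f : wl1 m | `|f| <= C2 /\
    forall N, \sum_(1 <= n < N) wt n * (p n * `|f n|) <= C1].
Proof.
move=> p0 pinf; rewrite compact_ultra => G UG GS.
have /choice[cc hcc] : forall n, exists r : R, f n @[f --> G] --> r.
  move=> n; apply: (@ultra_bounded_cvg _ G (fun f : wl1 m => f n) C2) => //.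
  by apply: filterS GS => f [fC _] /=; apply: le_trans fC; exact: wl1_coord.
have cc0 : cc 0%N = 0.
  have E : (fun f : wl1 m => f 0%N) = (fun _ => 0).
    by apply/funext => f; rewrite wl1_at0.
  have h : (fun _ : wl1 m => (0 : R)) @ G --> cc 0%N by rewrite -E; exact: hcc.
  by apply: (cvg_unique _ h) => //; exact: cvg_cst.
have sum_cvg (q : nat -> R) N : \sum_(1 <= n < N) q n * `|f n| @[f --> G] -->
    \sum_(1 <= n < N) q n * `|cc n|.
  by apply: cvg_finite_sum => n; apply: cvgMl_tmp; exact: cvg_norm.
have [N|F FE FC] := @wl1_ex R m cc C2 cc0.
  apply: (cvgr_to_le (sum_cvg _ N)).
  change (G [set f : wl1 m | \sum_(1 <= n < N) wt n * `|f n| <= C2]).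
  by apply: filterS GS => f [fC _]; exact: le_trans (wl1_partial f N) fC.
have FC1 N : \sum_(1 <= n < N) wt n * (p n * `|F n|) <= C1.
  rewrite FE; under eq_bigr do rewrite mulrA.
  apply: (cvgr_to_le (sum_cvg _ N)).
  change (G [set f : wl1 m | \sum_(1 <= n < N) wt n * p n * `|f n| <= C1]).
  apply: filterS GS => f [_ /(_ N)] /=.
  by under eq_bigr do rewrite mulrA.
exists F; split=> //=; apply/cvgrPdist_le => e e0.
have C10 : 0 <= C1 by have := FC1 0%N; rewrite big_geq.
(* Each of the two tails, of [F] and of [f], is then at most [e / 4]; the remaining [e / 2] is left
   for finitely many coordinates. *)
pose M := 4 * (C1 + 1) / e.
have M0 : 0 < M by rewrite divr_gt0// mulr_gt0// ltr_wpDl.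
have [N hN] := pinf M.
have tail (f : wl1 m) : (forall N, \sum_(1 <= n < N) wt n * (p n * `|f n|) <= C1) ->
    forall K, \sum_(N.+1 <= n < K) wt n * `|f n| <= e / 4.
  move=> hf K; have [KN|NK] := leqP K N.+1.
    by rewrite big_geq// divr_ge0// ltW.
  have h1 : M * \sum_(N.+1 <= n < K) wt n * `|f n| <= C1.
    apply: le_trans (hf K); rewrite [leRHS](big_cat_nat (ltn0Sn N) (ltnW NK))/=.
    rewrite ler_wpDl//.
      rewrite big_nat_cond; apply: sumr_ge0 => n /andP[/andP[n1 _] _].
      by rewrite !mulr_ge0 ?powR_ge0 ?p0.
    rewrite mulr_sumr [leLHS]big_nat_cond [leRHS]big_nat_cond.
    apply: ler_sum => n /andP[/andP[n1 _] _].
    by rewrite mulrCA ler_wpM2l ?powR_ge0// ler_wpM2r// hN// ltnW.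
  rewrite -(ler_pM2l M0) (le_trans h1)// /M.
  have -> : 4 * (C1 + 1) / e * (e / 4) = C1 + 1 by field; rewrite gt_eqF.
  by rewrite lerDl.
have h2 : \sum_(1 <= n < N.+1) wt n * `|F n - f n| @[f --> G] -->
    \sum_(1 <= n < N.+1) wt n * `|F n - cc n|.
  apply: cvg_finite_sum => n; apply: cvgMl_tmp; apply: cvg_norm.
  by apply: cvgB => //; exact: cvg_cst.
rewrite FE [X in _ --> X]big1 in h2; last first.
  by move=> n _; rewrite subrr normr0 mulr0.
have e20 : 0 < e / 2 by rewrite divr_gt0.
have /cvgr0Pnorm_le/(_ _ e20) h3 := h2.
change (G [set f : wl1 m | `|F - f| <= e]).
have {}h3 : G [set f : wl1 m |
    `|\sum_(1 <= n < N.+1) wt n * `|cc n - f n| | <= e / 2] by exact: h3.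
apply: filterS2 h3 GS => f /= h3 [_ hf].
have {}h3 : \sum_(1 <= n < N.+1) wt n * `|F n - f n| <= e / 2.
  by rewrite FE (le_trans (ler_norm _)).
apply: wl1_norm_le => K.
apply: (@le_trans _ _ (\sum_(1 <= n < maxn K N.+1) wt n * `|F n - f n|)).
  apply: (ler_sum_ext (x := fun n => wt n * `|F n - f n|)).
    exact: leq_maxl.
  by move=> n _; rewrite mulr_ge0 ?powR_ge0.
rewrite (@big_cat_nat _ _ _ N.+1)//= ?leq_maxr//.
have -> : e = e / 2 + (e / 4 + e / 4) by field.
apply: lerD => //.
apply: le_trans (lerD (tail F FC1 (maxn K N.+1)) (tail f hf (maxn K N.+1))).
rewrite -big_split/=; apply: ler_sum => n _.
by rewrite -mulrDr ler_wpM2l ?powR_ge0// ler_normB.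
Qed.

End compactness.

(** * The growth-fragmentation operator *)

Section model.
Context {R : realType}.
Variables (a g d : nat -> R) (b : nat -> nat -> R).
Hypotheses (ha1 : a 1%N = 0) (ha : forall n, (2 <= n)%N -> 0 < a n)
  (hg : forall n, (1 <= n)%N -> 0 <= g n)
  (hd1 : d 1%N = 0) (hd : forall n, (2 <= n)%N -> 0 <= d n)
  (hb : forall n i, (1 <= n)%N -> (n < i)%N -> 0 <= b n i)
  (hmass : forall i, (2 <= i)%N -> \sum_(1 <= n < i) n%:R * b n i = i%:R).
Variables (m : R) (hm : 1 <= m).
Local Notation wt n := (n%:R `^ m).
Local Notation X := (wl1 m).
Local Notation th := (theta a d g).

Lemma a_ge0 n : (1 <= n)%N -> 0 <= a n.
Proof. by case: n => [|[|n]] // _; [rewrite ha1|rewrite ltW// ha]. Qed.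

Lemma d_ge0 n : (1 <= n)%N -> 0 <= d n.
Proof. by case: n => [|[|n]] // _; [rewrite hd1|rewrite hd]. Qed.

Lemma th_ge0 n : (1 <= n)%N -> 0 <= th n.
Proof. by move=> n1; rewrite /theta !addr_ge0 ?a_ge0 ?hg ?d_ge0. Qed.

Let m0 : 0 <= m. Proof. exact: le_trans hm. Qed.

Lemma wt_ge0 n : 0 <= wt n. Proof. exact: powR_ge0. Qed.

Lemma wt_mono k n : (k <= n)%N -> wt k <= wt n.
Proof. exact: powR_nat_mono. Qed.

Lemma wt_double n : (1 <= n)%N -> wt n.+1 <= 2 `^ m * wt n.
Proof.
move=> n1; rewrite -powRM//; apply: ge0_ler_powR; rewrite ?nnegrE ?mulr_ge0//.
by rewrite -natrM ler_nat mul2n -addnn -addn1 leq_add2l.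
Qed.

Lemma wt_Delta n : wt n - Delta b m n = \sum_(1 <= k < n) wt k * b k n.
Proof. by rewrite /Delta subKr. Qed.

Lemma moment_ge0 n : 0 <= wt n - Delta b m n.
Proof.
rewrite wt_Delta big_nat_cond sumr_ge0// => k /andP[/andP[k1 kn] _].
by rewrite mulr_ge0 ?powR_ge0 ?hb.
Qed.

(** For [k < n] one has [k^m <= k n^(m-1)] as [m >= 1], and mass conservation sums [k b_{k,n}] to
    [n]. *)
Lemma Delta_ge0 n : (1 <= n)%N -> 0 <= Delta b m n.
Proof.
case: n => [|[|n]] // _; first by rewrite /Delta big_geq// subr0 powR_ge0.
rewrite /Delta subr_ge0 -(@mulr_powRB1 _ n.+2%:R)// ?(lt_le_trans ltr01)//.
set p := n.+2%:R `^ (m - 1).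
rewrite -hmass// mulr_suml big_nat_cond [leRHS]big_nat_cond.
apply: ler_sum => k /andP[/andP[k1 kn] _].
rewrite -(@mulr_powRB1 _ k%:R)// ?(lt_le_trans ltr01)// mulrAC.
rewrite ler_wpM2l ?mulr_ge0 ?hb//.
by apply: powR_nat_mono; [rewrite subr_ge0|exact: ltnW].
Qed.

Definition bsum n M (u : nat -> R) := \sum_(n.+1 <= i < M) a i * b n i * u i.

Lemma bsum_le n M M' u : (1 <= n)%N -> (forall i, 0 <= u i) -> (M <= M')%N ->
  bsum n M u <= bsum n M' u.
Proof.
move=> n1 u0 MM'; have t0 i : (n < i)%N -> 0 <= a i * b n i * u i.
  move=> ni; rewrite !mulr_ge0 ?hb// a_ge0//.
  exact: leq_trans ni.
rewrite /bsum; have [Mn|nM] := leqP M n.+1.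
  rewrite big_geq// big_nat_cond sumr_ge0// => i /andP[/andP[ni _] _].
  exact: t0.
rewrite [leRHS](@big_cat_nat _ _ _ M)//= ?(ltnW nM)// lerDl big_nat_cond.
rewrite sumr_ge0// => i /andP[/andP[ni _] _]; apply: t0.
exact: leq_trans (ltnW nM) ni.
Qed.

(** Exchanging the sums makes column [i] contribute the [m]-th moment of its fragments, which is
    [wt i - Delta b m i]. *)
Lemma bsum_moment N M u : (N <= M)%N -> (forall i, 0 <= u i) ->
  \sum_(1 <= n < N) wt n * bsum n M u <=
  \sum_(1 <= i < M) a i * (wt i - Delta b m i) * u i.
Proof.
move=> NM u0.
have t0 n i : (1 <= n)%N -> (n < i)%N -> 0 <= wt n * (a i * b n i * u i).
  move=> n1 ni; rewrite !mulr_ge0 ?powR_ge0 ?hb// a_ge0//.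
  exact: leq_trans ni.
have E : \sum_(1 <= i < M) a i * (wt i - Delta b m i) * u i =
   \sum_(1 <= n < M) wt n * bsum n M u.
  rewrite /bsum; under [RHS]eq_bigr do rewrite mulr_sumr.
  rewrite triangular_exchange; apply: eq_bigr => i _.
  rewrite wt_Delta mulr_sumr mulr_suml; apply: eq_bigr => n _; ring.
rewrite E; apply: ler_sum_ext => // n n1.
rewrite /bsum mulr_sumr big_nat_cond sumr_ge0// => i /andP[/andP[ni _] _].
exact: t0.
Qed.

(** In [hH] the diagonal is already cancelled: a particle of size [n] gains weight by moving to
    [n + 1], loses weight by moving to [n - 1], and loses [Delta] by fragmentation. The weight [sg]
    is left abstract so that both parts share all estimates. *)
Variables (sg : nat -> R) (w c : R).
Hypotheses (w0 : 0 <= w) (c0 : 0 < c)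
  (sg_ge : forall n, (1 <= n)%N -> a n + d n <= sg n)
  (hH : forall n, (1 <= n)%N ->
    (wt n.+1 - wt n) * g n + c * (sg n * wt n) <=
    w * wt n + a n * Delta b m n + (wt n - wt n.-1) * d n).

Lemma ad_ge0 n : (1 <= n)%N -> 0 <= a n + d n.
Proof. by move=> n1; rewrite addr_ge0 ?a_ge0 ?d_ge0. Qed.

Lemma sg_ge0 n : (1 <= n)%N -> 0 <= sg n.
Proof. by move=> n1; rewrite (le_trans _ (sg_ge n1))// ad_ge0. Qed.

Lemma gain_shift N u : u 0%N = 0 -> (forall i, 0 <= u i) ->
  \sum_(1 <= n < N) wt n * (g n.-1 * u n.-1) <=
  \sum_(1 <= n < N) wt n.+1 * (g n * u n).
Proof.
move=> u00 u0.
case: N => [|N]; first by rewrite !big_geq.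
rewrite big_add1/=; case: N => [|N]; first by rewrite !big_geq.
rewrite big_nat_recl// u00 !mulr0 add0r big_add1/= [leRHS]big_nat_recr//= lerDl.
by rewrite !mulr_ge0 ?powR_ge0 ?hg.
Qed.

Lemma loss_shift N M u : (N < M)%N -> (forall i, 0 <= u i) ->
  \sum_(1 <= n < N) wt n * (d n.+1 * u n.+1) <=
  \sum_(1 <= n < M) wt n.-1 * (d n * u n).
Proof.
move=> NM u0; apply: (@le_trans _ _ (\sum_(1 <= n < N.+1) wt n.-1 * (d n * u n))).
  case: N NM => [|N NM]; first by move=> _; rewrite !big_geq.
  by rewrite [leRHS]big_ltn//= hd1 mul0r mulr0 add0r [leRHS]big_add1/=.
by apply: ler_sum_ext => // n n1; rewrite !mulr_ge0 ?powR_ge0 ?d_ge0.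
Qed.

(* Weighted summation of the inequality [(l + theta) u <= h + P u], where [P]
   is the positive off-diagonal part of the matrix. *)
Lemma subsolution_bound l u h (C H : R) : w <= l ->
  u 0%N = 0 -> (forall i, 0 <= u i) ->
  (forall N, \sum_(1 <= n < N) wt n * ((a n + d n) * u n) <= C) ->
  (forall N, \sum_(1 <= n < N) wt n * h n <= H) ->
  (forall n e, (1 <= n)%N -> 0 < e -> exists M, (l + th n) * u n <=
     h n + g n.-1 * u n.-1 + d n.+1 * u n.+1 + bsum n M u + e) ->
  forall N, \sum_(1 <= n < N) (l - w + c * sg n) * (wt n * u n) <= H.
Proof.
move=> wl u00 u0 hC hH' sub N.
have ad_u n : (1 <= n)%N -> 0 <= wt n * ((a n + d n) * u n).
  by move=> n1; rewrite !mulr_ge0 ?powR_ge0 ?ad_ge0.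
apply/ler_addgt0Pr => e2 e20; pose e := e2 / 2.
have e0 : 0 < e by rewrite divr_gt0.
have [N1 hN1] := bounded_sum_tail ad_u hC e0.
(* Half of [e2] pays for the inflow into [[1, K)] from larger indices, bounded by the tail of
   [(a + d) u]; the other half pays for the errors of the rows. *)
pose K := (maxn N N1.+1).
have K1 : (1 <= K)%N by rewrite leq_max orbT.
have tailK M : \sum_(K <= n < M) wt n * ((a n + d n) * u n) <= e.
  have [MK|KM] := leqP M K; first by rewrite big_geq// ltW.
  apply: le_trans (hN1 M).
  rewrite [leRHS](@big_cat_nat _ _ _ K)//= ?leq_max ?leqnn ?orbT ?(ltnW KM)//.
  rewrite lerDr big_nat_cond sumr_ge0// => i /andP[/andP[i1 _] _].
  by apply: ad_u; exact: leq_trans i1.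
have K0 : 0 < K%:R :> R by rewrite ltr0n.
have wgt0 n : (1 <= n)%N -> 0 < wt n by move=> n1; rewrite powR_gt0// ltr0n.
(* The error of row [n] is divided by [K%:R * wt n], so that fewer than [K] weighted errors add up
   to at most [e]. A common truncation [M] exists as [bsum] increases with [M]. *)
have /choice[M0 hM0] : forall n, exists M, (1 <= n)%N -> (l + th n) * u n <=
     h n + g n.-1 * u n.-1 + d n.+1 * u n.+1 + bsum n M u + e / (K%:R * wt n).
  move=> n; case: (leqP 1 n) => [n1|n0]; last by exists 0%N.
  have [|M hM] := sub n (e / (K%:R * wt n)) n1; last by exists M.
  by rewrite divr_gt0// mulr_gt0// wgt0.
pose M := maxn K.+1 (\max_(n < K) M0 n).
have KM : (K < M)%N by rewrite leq_max leqnn.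
have hM n : (1 <= n < K)%N -> (l + th n) * u n <=
     h n + g n.-1 * u n.-1 + d n.+1 * u n.+1 + bsum n M u + e / (K%:R * wt n).
  move=> /andP[n1 nK]; apply: (le_trans (hM0 n n1)).
  rewrite lerD2r lerD2l bsum_le// leq_max; apply/orP; right.
  exact: (leq_bigmax (Ordinal nK)).
apply: (@le_trans _ _ (\sum_(1 <= n < K) (l - w + c * sg n) * (wt n * u n))).
  apply: ler_sum_ext; first by rewrite leq_max leqnn.
  move=> n n1; rewrite !mulr_ge0 ?powR_ge0// addr_ge0 ?subr_ge0//.
  by rewrite mulr_ge0 ?(ltW c0)// sg_ge0.
have S1 : \sum_(1 <= n < K) wt n * ((l + th n) * u n) <=
    \sum_(1 <= n < K) wt n * h n +
    \sum_(1 <= n < K) wt n * (g n.-1 * u n.-1) +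
    \sum_(1 <= n < K) wt n * (d n.+1 * u n.+1) +
    \sum_(1 <= n < K) wt n * bsum n M u + e.
  apply: (@le_trans _ _ (\sum_(1 <= n < K) (wt n * h n +
     wt n * (g n.-1 * u n.-1) + wt n * (d n.+1 * u n.+1) +
     wt n * bsum n M u + e / K%:R))).
    rewrite big_nat_cond [leRHS]big_nat_cond; apply: ler_sum => n /andP[nK _].
    have n1 : (1 <= n)%N by case/andP: nK.
    rewrite (le_trans (ler_wpM2l (wt_ge0 n) (hM n nK)))//.
    rewrite !mulrDr lerD2l invfM mulrCA mulrA mulrACA.
    have -> : wt n * (wt n)^-1 = 1 by rewrite divff// gt_eqF// wgt0.
    by rewrite mulr1.
  rewrite !big_split/= lerD2l sumr_const_nat -[e / _ *+ _]mulr_natr.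
  rewrite -mulrA ler_piMr ?(ltW e0)// mulrC ler_pdivrMr// mul1r ler_nat.
  by rewrite leq_subr.
have S2 := gain_shift K u00 u0.
have S3 := loss_shift KM u0.
have S4 := bsum_moment (ltnW KM) u0.
have S5 := hH' K.
have split (x : nat -> R) : \sum_(1 <= n < M) x n =
    \sum_(1 <= n < K) x n + \sum_(K <= n < M) x n.
  by rewrite (big_cat_nat K1 (ltnW KM)).
rewrite split in S3; rewrite split in S4.
have S6 : \sum_(K <= n < M) wt n.-1 * (d n * u n) +
    \sum_(K <= n < M) a n * (wt n - Delta b m n) * u n <= e.
  apply: le_trans (tailK M); rewrite -big_split/=.
  rewrite big_nat_cond [leRHS]big_nat_cond; apply: ler_sum => n /andP[/andP[Kn _] _].
  have n1 : (1 <= n)%N by exact: leq_trans Kn.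
  have un := u0 n; have an := a_ge0 n1; have dn := d_ge0 n1.
  have h1 : wt n.-1 * (d n * u n) <= wt n * (d n * u n).
    by rewrite ler_wpM2r ?mulr_ge0// wt_mono// leq_pred.
  have h2 : a n * (wt n - Delta b m n) * u n <= a n * wt n * u n.
    by rewrite ler_wpM2r// ler_wpM2l// gerBl Delta_ge0.
  lra.
have S7 : \sum_(1 <= n < K) (l - w + c * sg n) * (wt n * u n) <=
   \sum_(1 <= n < K) wt n * ((l + th n) * u n) -
   \sum_(1 <= n < K) wt n.+1 * (g n * u n) -
   \sum_(1 <= n < K) wt n.-1 * (d n * u n) -
   \sum_(1 <= n < K) a n * (wt n - Delta b m n) * u n.
  rewrite -!sumrB big_nat_cond [leRHS]big_nat_cond.
  apply: ler_sum => n /andP[/andP[n1 _] _].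
  have := ler_wpM2r (u0 n) (hH n1); rewrite /theta; lra.
rewrite /e in S1 S6; lra.
Qed.

(** The equation gives [th n * |u n| <= |v n| + g n.-1 * |u n.-1|]; after weighted summation and a
    shift, [hH] compares the two sides, its fragmentation and death terms being at most those in
    [theta]. This places the domain of [K] in those of [A] and [D0], and yields the summability
    required by [subsolution_bound]. *)
Lemma K_dom_bound (u v : X) :
  (forall n, (1 <= n)%N -> v n = g n.-1 * u n.-1 - th n * u n) ->
  forall N, c * \sum_(1 <= n < N) wt n * (sg n * `|u n|) <= `|v| + w * `|u|.
Proof.
move=> uv N.
have u00 : `|u 0%N| = 0 by rewrite wl1_at0 normr0.
have S2 := gain_shift (u := fun n => `|u n|) N u00 (fun i => normr_ge0 _).
have S1 : \sum_(1 <= n < N) wt n * (th n * `|u n|) <=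
   \sum_(1 <= n < N) wt n * `|v n| +
   \sum_(1 <= n < N) wt n * (g n.-1 * `|u n.-1|).
  rewrite -big_split/= big_nat_cond [leRHS]big_nat_cond.
  apply: ler_sum => n /andP[/andP[n1 _] _].
  rewrite -mulrDr ler_wpM2l ?powR_ge0//.
  have -> : th n * `|u n| = `|th n * u n| by rewrite normrM ger0_norm// th_ge0.
  have -> : g n.-1 * `|u n.-1| = `|g n.-1 * u n.-1|.
    case: n n1 => [|[|n]]// _; first by rewrite /= wl1_at0 mulr0 normr0 mulr0.
    by rewrite normrM (ger0_norm (hg _)).
  have -> : th n * u n = g n.-1 * u n.-1 - v n by rewrite uv// subKr.
  by rewrite [leRHS]addrC ler_normB.
have S3 := wl1_partial v N; have S4 := wl1_partial u N.
have S5 : c * \sum_(1 <= n < N) wt n * (sg n * `|u n|) <=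
   w * \sum_(1 <= n < N) wt n * `|u n| +
   \sum_(1 <= n < N) wt n * (th n * `|u n|) -
   \sum_(1 <= n < N) wt n.+1 * (g n * `|u n|).
  rewrite !mulr_sumr -big_split/= -sumrB big_nat_cond [leRHS]big_nat_cond.
  apply: ler_sum => n /andP[/andP[n1 _] _].
  have un := normr_ge0 (u n); have an := a_ge0 n1; have dn := d_ge0 n1.
  have h1 : 0 <= wt n.-1 * d n * `|u n| by rewrite !mulr_ge0 ?powR_ge0.
  have h2 : 0 <= a n * (wt n - Delta b m n) * `|u n|.
    by rewrite !mulr_ge0 ?moment_ge0.
  have := ler_wpM2r un (hH n1); rewrite /theta; lra.
have := ler_wpM2l w0 S4; lra.
Qed.

Lemma diag_ex (p : nat -> R) (u : X) (C : R) : (forall n, (1 <= n)%N -> 0 <= p n) ->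
  (forall N, \sum_(1 <= n < N) wt n * (p n * `|u n|) <= C) ->
  exists2 F : X, diag_op m (fun n => - p n) (u, F) & `|F| <= C.
Proof.
move=> p0 hC.
have [|N|F FE FC] := @wl1_ex _ m (fun n => - p n * u n) C.
- by rewrite wl1_at0 mulr0.
- apply: le_trans (hC N); rewrite big_nat_cond [leRHS]big_nat_cond.
  apply: ler_sum => n /andP[/andP[n1 _] _].
  by rewrite normrM normrN (ger0_norm (p0 n n1)).
by exists F => // n n1 /=; rewrite FE.
Qed.

Lemma diag_bound (p : nat -> R) (u F : X) : (forall n, (1 <= n)%N -> 0 <= p n) ->
  diag_op m (fun n => - p n) (u, F) ->
  forall N, \sum_(1 <= n < N) wt n * (p n * `|u n|) <= `|F|.
Proof.
move=> p0 uF N; apply: le_trans (wl1_partial F N).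
rewrite big_nat_cond [leRHS]big_nat_cond.
apply: ler_sum => n /andP[/andP[n1 _] _].
by rewrite (uF n n1) /= normrM normrN (ger0_norm (p0 n n1)).
Qed.

Lemma diag_domP (p : nat -> R) (u : X) : (forall n, (1 <= n)%N -> 0 <= p n) ->
  dom (diag_op m (fun n => - p n)) u <->
  exists C, forall N, \sum_(1 <= n < N) wt n * (p n * `|u n|) <= C.
Proof.
move=> p0; split=> [[[u' F] /= uF <-]|[C hC]].
  by exists `|F|; exact: diag_bound.
by have [F uF _] := diag_ex p0 hC; exists (u, F).
Qed.

Lemma weighted_le (p q : nat -> R) (u : X) (C : R) :
  (forall n, (1 <= n)%N -> p n <= q n) ->
  (forall N, \sum_(1 <= n < N) wt n * (q n * `|u n|) <= C) ->
  forall N, \sum_(1 <= n < N) wt n * (p n * `|u n|) <= C.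
Proof.
move=> pq hC N; apply: le_trans (hC N).
rewrite big_nat_cond [leRHS]big_nat_cond.
apply: ler_sum => n /andP[/andP[n1 _] _].
by rewrite ler_wpM2l ?powR_ge0// ler_wpM2r// pq.
Qed.

Lemma Dplus_ex (u : X) (C : R) :
  (forall N, \sum_(1 <= n < N) wt n * (d n * `|u n|) <= C) ->
  exists2 F : X, Dplus_op d m (u, F) & `|F| <= C.
Proof.
move=> hC.
have [|N|F FE FC] := @wl1_ex _ m
  (fun n => if n is 0%N then 0 else d n.+1 * u n.+1) C.
- by [].
- apply: le_trans (hC N.+1).
  apply: (@le_trans _ _ (\sum_(1 <= n < N.+1) wt n.-1 * (d n * `|u n|))).
    apply: le_trans (loss_shift (u := fun n => `|u n|) (ltnSn N) (fun i => normr_ge0 _)).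
    rewrite big_nat_cond [leRHS]big_nat_cond.
    apply: ler_sum => -[|n] /andP[/andP[n1 _] _] //.
    by rewrite normrM (ger0_norm (d_ge0 _)).
  rewrite big_nat_cond [leRHS]big_nat_cond.
  apply: ler_sum => n /andP[/andP[n1 _] _].
  by rewrite ler_wpM2r ?wt_mono ?leq_pred// mulr_ge0// d_ge0.
exists F => //; split=> /=.
  by apply/diag_domP; [exact: d_ge0|exists C].
by case=> // n _; rewrite FE.
Qed.

Lemma bsum_abs_le (u : X) (C : R) N M : (N <= M)%N ->
  (forall K, \sum_(1 <= n < K) wt n * (a n * `|u n|) <= C) ->
  \sum_(1 <= n < N) wt n * bsum n M (fun i => `|u i|) <= C.
Proof.
move=> NM hC; apply: le_trans (bsum_moment NM (fun i => normr_ge0 _)) _.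
apply: le_trans (hC M); rewrite big_nat_cond [leRHS]big_nat_cond.
apply: ler_sum => n /andP[/andP[n1 _] _].
rewrite mulrA [wt n * _]mulrC ler_wpM2r// ler_wpM2l ?a_ge0//.
by rewrite gerBl Delta_ge0.
Qed.

Lemma bsum_norm n M (u : nat -> R) : (1 <= n)%N ->
  `|\sum_(n.+1 <= i < M) a i * b n i * u i| <= bsum n M (fun i => `|u i|).
Proof.
move=> n1; rewrite (le_trans (ler_norm_sum _ _ _))// /bsum.
rewrite big_nat_cond [leRHS]big_nat_cond.
apply: ler_sum => i /andP[/andP[ni _] _].
by rewrite normrM (ger0_norm (mulr_ge0 (a_ge0 _) (hb _ _)))// (leq_trans _ ni).
Qed.

(** Since [wt n >= 1], the weighted bound on the finite double sums already makes every row converge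
    absolutely; letting the truncation tend to infinity gives the norm. *)
Lemma B_ex (u : X) (C : R) :
  (forall N, \sum_(1 <= n < N) wt n * (a n * `|u n|) <= C) ->
  exists2 F : X, B_op a b m (u, F) & `|F| <= C.
Proof.
move=> hC.
pose s n M := \sum_(n.+1 <= i < M) a i * b n i * u i.
have cs n : (1 <= n)%N -> cvgn (s n).
  move=> n1; apply: (@abs_bounded_cvg _ _ C) => M.
  have h1 : wt n * bsum n (maxn n.+1 M) (fun i => `|u i|) <= C.
    have := bsum_abs_le (leq_maxl n.+1 M) hC.
    rewrite big_nat_recr//=; apply: le_trans; rewrite lerDr big_nat_cond.
    apply: sumr_ge0 => i /andP[/andP[i1 _] _].
    rewrite mulr_ge0 ?powR_ge0// /bsum big_nat_cond.
    apply: sumr_ge0 => j /andP[/andP[ij _] _].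
    by rewrite !mulr_ge0 ?a_ge0 ?hb// (leq_trans _ ij).
  apply: le_trans h1.
  have b0 K : 0 <= bsum n K (fun i => `|u i|).
    rewrite /bsum big_nat_cond; apply: sumr_ge0 => j /andP[/andP[ij _] _].
    by rewrite !mulr_ge0 ?a_ge0 ?hb// (leq_trans _ ij).
  apply: (@le_trans _ _ (bsum n (maxn n.+1 M) (fun i => `|u i|))).
    apply: le_trans (bsum_le n1 (fun i => normr_ge0 (u i)) (leq_maxr n.+1 M)).
    rewrite /bsum big_nat_cond [leRHS]big_nat_cond.
    apply: ler_sum => i /andP[/andP[ni _] _].
    by rewrite normrM (ger0_norm (mulr_ge0 (a_ge0 _) (hb _ _)))// (leq_trans _ ni).
  by rewrite ler_peMl// powR_nat_ge1.
pose f n := if n is 0%N then 0 else limn (s n).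
have [|N|F FE FC] := @wl1_ex _ m f C.
- by [].
- pose t n M := if n is 0%N then 0 else wt n * `|s n M|.
  pose l n := if n is 0%N then 0 else wt n * `|f n|.
  have h : \sum_(1 <= n < N) t n M @[M --> \oo] --> \sum_(1 <= n < N) l n.
    apply: cvg_finite_sum => -[|n]; first exact: cvg_cst.
    by apply: cvgMl_tmp; apply: cvg_norm; exact: cs.
  have -> : \sum_(1 <= n < N) wt n * `|f n| = \sum_(1 <= n < N) l n.
    by apply: eq_big_nat => -[|n].
  apply: (cvgr_to_le h); exists N => // M /= NM.
  apply: le_trans (bsum_abs_le NM hC); rewrite big_nat_cond [leRHS]big_nat_cond.
  apply: ler_sum => -[|n] /andP[/andP[n1 _] _] //.
  by rewrite ler_wpM2l ?powR_ge0// bsum_norm.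
exists F => //; split=> /=.
  by apply/diag_domP; [exact: a_ge0|exists C].
by case=> // n n1; rewrite FE /f; exact: cs.
Qed.

(** The shift from [n] to [n + 1] costs the factor [2 ^ m] by [wt_double]. *)
Lemma Gminus_ex (u : X) (C : R) :
  (forall N, \sum_(1 <= n < N) wt n * (th n * `|u n|) <= C) ->
  exists2 F : X, Gminus_op a d g m (u, F) & `|F| <= 2 `^ m * C.
Proof.
move=> hC.
have gth n : (1 <= n)%N -> g n <= th n.
  by move=> n1; rewrite /theta -addrAC lerDr addr_ge0 ?a_ge0 ?d_ge0.
have [|N|F FE FC] := @wl1_ex _ m (fun n => g n.-1 * u n.-1) (2 `^ m * C).
- by rewrite /= wl1_at0 mulr0.
- have u00 : `|u 0%N| = 0 by rewrite wl1_at0 normr0.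
  have := gain_shift (u := fun n => `|u n|) N u00 (fun i => normr_ge0 _).
  move=> h; apply: (@le_trans _ _ (\sum_(1 <= n < N) wt n.+1 * (g n * `|u n|))).
    apply: le_trans h; rewrite big_nat_cond [leRHS]big_nat_cond.
    apply: ler_sum => -[|[|n]] /andP[/andP[n1 _] _] //.
      by rewrite /= !(wl1_at0, mulr0, normr0).
    by rewrite normrM (ger0_norm (hg _)).
  apply: le_trans (ler_wpM2l (powR_ge0 2 m) (hC N)); rewrite mulr_sumr.
  rewrite big_nat_cond [leRHS]big_nat_cond.
  apply: ler_sum => n /andP[/andP[n1 _] _]; rewrite [leRHS]mulrA.
  apply: ler_pM; rewrite ?powR_ge0 ?mulr_ge0 ?hg ?wt_double//.
  by rewrite ler_wpM2r// gth.
exists F => //; split=> /=; last by move=> n n1; rewrite FE.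
by apply/diag_domP; [exact: th_ge0|exists C].
Qed.

Lemma YP (u y : X) : Y_op a d g b m (u, y) <-> exists k e f,
  [/\ K_op a d g m (u, k), Dplus_op d m (u, e), B_op a b m (u, f) &
      y = k + e + f].
Proof.
split=> [[f' [f [[k [e [Ku Du /= ->]]] Bu /= ->]]]|[k [e [f [Ku Du Bu ->]]]]].
  by exists k, e, f.
by exists (k + e), f; split=> //; exists k, e.
Qed.

Lemma UP (u y : X) : U_op a d g b m (u, y) <-> exists t k e f,
  [/\ T_op a d g m (u, t), Gminus_op a d g m (u, k), Dplus_op d m (u, e),
      B_op a b m (u, f) & y = t + k + e + f].
Proof.
split=> [[h1 [f [[h2 [e [[t [k [Tu Gu /= ->]]] Du /= ->]]] Bu /= ->]]]|].
  by exists t, k, e, f.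
move=> [t [k [e [f [Tu Gu Du Bu ->]]]]].
exists (t + k + e), f; split=> //; exists (t + k), e; split=> //.
by exists t, k.
Qed.

Lemma Y_ex (u k : X) (C : R) : K_op a d g m (u, k) ->
  (forall N, \sum_(1 <= n < N) wt n * ((a n + d n) * `|u n|) <= C) ->
  exists2 y, Y_op a d g b m (u, y) & `|y| <= `|k| + C + C.
Proof.
move=> Ku hC.
have [e De eC] : exists2 F : X, Dplus_op d m (u, F) & `|F| <= C.
  apply: Dplus_ex; apply: weighted_le hC => n n1.
  by rewrite lerDr a_ge0.
have [f Bf fC] : exists2 F : X, B_op a b m (u, F) & `|F| <= C.
  apply: B_ex; apply: weighted_le hC => n n1.
  by rewrite lerDl d_ge0.
exists (k + e + f); first by apply/YP; exists k, e, f.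
by rewrite (le_trans (ler_normD _ _))// lerD// (le_trans (ler_normD _ _))// lerD.
Qed.

Lemma K_dom_ad (u k : X) : K_op a d g m (u, k) ->
  forall N, \sum_(1 <= n < N) wt n * ((a n + d n) * `|u n|) <=
    (`|k| + w * `|u|) / c.
Proof.
move=> Ku; apply: (weighted_le sg_ge) => N.
by rewrite ler_pdivlMr// mulrC; exact: K_dom_bound.
Qed.

Lemma Y_dom : dom (Y_op a d g b m) = dom (K_op a d g m).
Proof.
apply/seteqP; split=> u.
  by move=> [[u' y] /= /YP[k [e [f [Ku _ _ _]]]] <-]; exists (u', k).
move=> [[u' k] /= Ku <-].
by have [y Yu _] := Y_ex Ku (K_dom_ad Ku); exists (u', y).
Qed.

Lemma Y_ad (u y : X) : Y_op a d g b m (u, y) ->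
  exists C, forall N, \sum_(1 <= n < N) wt n * ((a n + d n) * `|u n|) <= C.
Proof.
move=> /YP[k [_ [_ [Ku _ _ _]]]]; exists ((`|k| + w * `|u|) / c).
exact: K_dom_ad.
Qed.

(** Taking absolute values in the rows of [(l - Y) u] makes [|u|] a subsolution. Replacing the
    infinite sum of [B] by a finite one costs an arbitrarily small amount, which is why subsolutions
    carry an error [e]. *)
Lemma Y_resolvent_bound l (u y : X) : w <= l -> Y_op a d g b m (u, y) ->
  forall N, \sum_(1 <= n < N) (l - w + c * sg n) * (wt n * `|u n|) <=
    `|l *: u - y|.
Proof.
move=> wl Yu; have [C hC] := Y_ad Yu.
move: Yu => /YP[k [e [f [Ku [_ Du] [_ Bu] yE]]]].
have l0 : 0 <= l by exact: le_trans wl.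
apply: (@subsolution_bound l (fun n => `|u n|)
  (fun n => `|(l *: u - y) n|) C) => //.
- by rewrite wl1_at0 normr0.
- exact: wl1_partial.
move=> n ep n1 ep0; have /cvgrPdist_le/(_ _ ep0)[M _ hM] := Bu n n1.
exists M; have {}hM := hM M (leqnn M); rewrite /= in hM.
have E : (l + th n) * u n = (l *: u - y) n + g n.-1 * u n.-1 +
    d n.+1 * u n.+1 + f n.
  rewrite wl1B wl1Z yE !wl1D (Ku n n1) (Du n n1) /=; ring.
have -> : (l + th n) * `|u n| = `|(l + th n) * u n|.
  by rewrite normrM ger0_norm// addr_ge0// th_ge0.
rewrite E.
have gE : `|g n.-1 * u n.-1| = g n.-1 * `|u n.-1|.
  case: n n1 {hM E} => [|[|n]]// _; first by rewrite /= wl1_at0 mulr0 normr0 mulr0.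
  by rewrite normrM (ger0_norm (hg _)).
have dE : `|d n.+1 * u n.+1| = d n.+1 * `|u n.+1|.
  by rewrite normrM (ger0_norm (d_ge0 _)).
have fE : `|f n| <= bsum n M (fun i => `|u i|) + ep.
  rewrite -[f n](subrK (\sum_(n.+1 <= i < M) a i * b n i * u i)).
  by rewrite (le_trans (ler_normD _ _))// addrC lerD// bsum_norm.
rewrite -gE -dE -[leRHS]addrA.
rewrite (le_trans (ler_normD _ _))// lerD// (le_trans (ler_normD _ _))// lerD//.
exact: ler_normD.
Qed.

Lemma Y_diss0 l (u y : X) : w < l -> Y_op a d g b m (u, y) ->
  (l - w) * `|u| <= `|l *: u - y|.
Proof.
move=> wl Yu; have lw0 : 0 < l - w by rewrite subr_gt0.
rewrite mulrC -ler_pdivlMr//; apply: wl1_norm_le => N.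
rewrite ler_pdivlMr//; apply: le_trans (Y_resolvent_bound (ltW wl) Yu N).
rewrite mulr_suml big_nat_cond [leRHS]big_nat_cond.
apply: ler_sum => n /andP[/andP[n1 _] _]; rewrite mulrC.
rewrite ler_wpM2r ?mulr_ge0 ?powR_ge0// lerDl mulr_ge0 ?(ltW c0)//.
exact: sg_ge0.
Qed.

Lemma Y_lin : lin_graph (Y_op a d g b m).
Proof.
move=> s [u y] [u' y'] /YP[k [e [f [Ku Du Bu yE]]]] /YP[k' [e' [f' [Ku' Du' Bu' yE']]]].
rewrite (_ : s *: (u, y) + (u', y') = (s *: u + u', s *: y + y'))//.
have diagD (p : nat -> R) v v' : dom (diag_op m p) v -> dom (diag_op m p) v' ->
    dom (diag_op m p) (s *: v + v' : X).
  move=> [[v1 F] /= vF <-] [[v1' F'] /= vF' <-].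
  exists (s *: v1 + v1', s *: F + F') => // n n1.
  change (s * F n + F' n = p n * (s * v1 n + v1' n)).
  by rewrite (vF n n1) (vF' n n1) /=; ring.
apply/YP; exists (s *: k + k'), (s *: e + e'), (s *: f + f'); split.
- move=> n n1.
  change (s * k n + k' n = g n.-1 * (s * u n.-1 + u' n.-1) -
    th n * (s * u n + u' n)).
  by rewrite (Ku n n1) (Ku' n n1) /=; ring.
- case: Du Du' => [D1 D2] [D1' D2']; split; first exact: diagD.
  move=> n n1; change (s * e n + e' n = d n.+1 * (s * u n.+1 + u' n.+1)).
  by rewrite (D2 n n1) (D2' n n1) /=; ring.
- case: Bu Bu' => [B1 B2] [B1' B2']; split; first exact: diagD.
  move=> n n1; change (\sum_(n.+1 <= i < N) a i * b n i * (s * u i + u' i)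
    @[N --> \oo] --> s * f n + f' n).
  rewrite (_ : (fun N => \sum_(n.+1 <= i < N) a i * b n i * (s * u i + u' i)) =
    (fun N => s * (\sum_(n.+1 <= i < N) a i * b n i * u i) +
      \sum_(n.+1 <= i < N) a i * b n i * u' i)).
    by apply: cvgD; [apply: cvgMl_tmp; exact: B2|exact: B2'].
  apply/funext => N; rewrite mulr_sumr -big_split/=; apply: eq_bigr => i _.
  ring.
by rewrite yE yE' !scalerDr addrACA; congr (_ + _); rewrite addrACA.
Qed.

Lemma bsum_ge0 n M u : (1 <= n)%N -> (forall i, 0 <= u i) -> 0 <= bsum n M u.
Proof.
move=> n1 u0; rewrite /bsum big_nat_cond; apply: sumr_ge0 => j /andP[/andP[nj _] _].
by rewrite !mulr_ge0 ?a_ge0 ?hb// (leq_trans _ nj).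
Qed.

Lemma bsum_mono n M u v : (1 <= n)%N -> (forall i, u i <= v i) ->
  bsum n M u <= bsum n M v.
Proof.
move=> n1 uv; rewrite /bsum big_nat_cond [leRHS]big_nat_cond.
apply: ler_sum => j /andP[/andP[nj _] _].
by rewrite ler_wpM2l// !mulr_ge0 ?a_ge0 ?hb// (leq_trans _ nj).
Qed.

(* The [k]-th iterate is supported in [1, k), so that only finite sums occur. *)
Fixpoint iterate (l : R) (h : nat -> R) k n : R :=
  if k is k'.+1 then
    if (1 <= n <= k')%N then
      (h n + g n.-1 * iterate l h k' n.-1 + d n.+1 * iterate l h k' n.+1 +
       bsum n k (iterate l h k')) / (l + th n)
    else 0
  else 0.

Section minimal_solution.
Variables (l : R) (h : X).
Hypotheses (wl : w < l) (h0 : forall n, 0 <= h n).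
Local Notation it := (iterate l h).

Let lth n : (1 <= n)%N -> 0 < l + th n.
Proof. by move=> n1; rewrite ltr_wpDr ?th_ge0// (le_lt_trans w0). Qed.

Let g_it n (u : nat -> R) : u 0%N = 0 -> (forall i, 0 <= u i) ->
  0 <= g n.-1 * u n.-1.
Proof.
case: n => [|[|n]] u0 ui /=; first by rewrite u0 mulr0.
  by rewrite u0 mulr0.
by rewrite mulr_ge0// hg.
Qed.

Lemma iterateS k n : it k.+1 n = if (1 <= n <= k)%N then
    (h n + g n.-1 * it k n.-1 + d n.+1 * it k n.+1 + bsum n k.+1 (it k)) /
    (l + th n) else 0.
Proof. by []. Qed.

Lemma iterate_at0 k : it k 0%N = 0. Proof. by case: k. Qed.

Lemma iterate_ge0 k n : 0 <= it k n.
Proof.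
elim: k n => [|k IHk] n //=; case: ifP => // /andP[n1 _].
rewrite divr_ge0 ?(ltW (lth n1))// addr_ge0 ?bsum_ge0// addr_ge0//.
  by rewrite addr_ge0// g_it// iterate_at0.
by rewrite mulr_ge0// d_ge0.
Qed.

Lemma iterate_supp k n : (k <= n)%N -> it k n = 0.
Proof.
case: k => [|k] //= kn; rewrite ifF//.
by apply/negbTE; rewrite negb_and -!ltnNge kn orbT.
Qed.

Let g_le k k' n : (forall i, it k i <= it k' i) ->
  g n.-1 * it k n.-1 <= g n.-1 * it k' n.-1.
Proof.
case: n => [|[|n]] kk'; rewrite [_.-1]/= ?iterate_at0//.
by rewrite ler_wpM2l ?hg.
Qed.

Lemma iterate_mono k n : it k n <= it k.+1 n.
Proof.
elim: k n => [|k IHk] n; first exact: (iterate_ge0 1).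
rewrite [leLHS]iterateS; case: ifP => [/andP[n1 nk]|_]; last exact: iterate_ge0.
rewrite [leRHS]iterateS n1 (leqW nk) ler_wpM2r ?invr_ge0 ?(ltW (lth n1))//.
apply: lerD; last first.
  apply: le_trans (bsum_mono k.+1 n1 IHk) _.
  by apply: bsum_le => // i; exact: iterate_ge0.
apply: lerD; last by rewrite ler_wpM2l ?d_ge0.
by rewrite lerD2l; exact: g_le.
Qed.

(** An iterate is a subsolution because it is built from its predecessor, which it dominates; its
    finite support supplies the required summability, whatever the coefficients. *)
Lemma iterate_bound k N :
  \sum_(1 <= n < N) (l - w + c * sg n) * (wt n * it k n) <= `|h|.
Proof.
case: k => [|k].
  by rewrite big1// => n _ /=; rewrite !mulr0.
apply: (@subsolution_bound l (it k.+1) h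
  (\sum_(1 <= n < k.+1) wt n * ((a n + d n) * it k.+1 n))).
- exact: ltW.
- exact: iterate_at0.
- exact: iterate_ge0.
- have t0 n : (1 <= n)%N -> 0 <= wt n * ((a n + d n) * it k.+1 n).
    by move=> n1; rewrite !mulr_ge0 ?powR_ge0 ?ad_ge0 ?iterate_ge0.
  move=> M; have [Mk|kM] := leqP M k.+1; first exact: ler_sum_ext.
  rewrite (big_cat_nat (ltn0Sn k) (ltnW kM)) gerDl big_nat_cond.
  by rewrite big1// => n /andP[/andP[kn _] _]; rewrite iterate_supp// !mulr0.
- move=> M; apply: le_trans (wl1_partial h M).
  by apply: ler_sum => n _; rewrite ler_wpM2l ?powR_ge0// ler_norm.
move=> n e n1 e0; exists k.+1.
have [nk|kn] := leqP n k; last first.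
  rewrite iterate_supp// mulr0 !addr_ge0 ?bsum_ge0 ?(ltW e0)//.
  - by apply: g_it => [|i]; [exact: iterate_at0|exact: iterate_ge0].
  - by rewrite mulr_ge0 ?d_ge0 ?iterate_ge0.
  - exact: iterate_ge0.
rewrite [it k.+1 n]iterateS n1 nk mulrC divfK; last by rewrite gt_eqF// lth.
rewrite ler_wpDr ?(ltW e0)//.
apply: lerD; last by apply: bsum_mono => // i; exact: iterate_mono.
apply: lerD; last by rewrite ler_wpM2l ?d_ge0 ?iterate_mono.
by rewrite lerD2l; apply: g_le => i; exact: iterate_mono.
Qed.

Let lw0 : 0 < l - w. Proof. by rewrite subr_gt0. Qed.

Lemma iterate_cvg n : cvgn (fun k => it k n).
Proof.
apply: nondecreasing_is_cvgn.
  by apply/nondecreasing_seqP => k; exact: iterate_mono.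
exists (`|h| / (l - w)) => _ [k _ <-].
have [n0|n1] := leqP n 0.
  by move: n0; rewrite leqn0 => /eqP ->; rewrite iterate_at0 divr_ge0 ?(ltW lw0).
rewrite ler_pdivlMr//; apply: le_trans (iterate_bound k n.+1).
rewrite big_nat_recr//= ler_wpDl//.
  rewrite big_nat_cond; apply: sumr_ge0 => i /andP[/andP[i1 _] _].
  by rewrite !mulr_ge0 ?powR_ge0 ?iterate_ge0// addr_ge0 ?(ltW lw0)//
    mulr_ge0 ?(ltW c0)// sg_ge0.
rewrite mulrC; apply: ler_pM; rewrite ?(ltW lw0) ?iterate_ge0//.
  by rewrite lerDl mulr_ge0 ?(ltW c0)// sg_ge0.
by rewrite ler_peMl ?iterate_ge0// powR_nat_ge1.
Qed.

(** The bound on the iterates passes to their limit [f] and makes [(a + d) f] summable, so death and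
    fragmentation are defined on it. The image under [K] is then prescribed by the resolvent
    equation, whose rows remain to be verified. *)
Lemma Y_range_pos : exists2 F : X, (forall n, 0 <= F n) &
  Y_op a d g b m (F, l *: F - h).
Proof.
pose f n := limn (fun k => it k n).
have itf k n : it k n <= f n.
  apply: (@nondecreasing_cvgn_le _ (fun k => it k n)); last exact: iterate_cvg.
  by apply/nondecreasing_seqP => j; exact: iterate_mono.
have f0 n : 0 <= f n by apply: le_trans (itf 0%N n).
have f00 : f 0%N = 0.
  rewrite /f; under eq_fun do rewrite iterate_at0; exact: lim_cst.
have fb N : \sum_(1 <= n < N) (l - w + c * sg n) * (wt n * f n) <= `|h|.
  have hc : \sum_(1 <= n < N) (l - w + c * sg n) * (wt n * it k n)
      @[k --> \oo] --> \sum_(1 <= n < N) (l - w + c * sg n) * (wt n * f n).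
    apply: cvg_finite_sum => n; do 2 apply: cvgMl_tmp; exact: iterate_cvg.
  by apply: (cvgr_to_le hc); apply: nearW => k; exact: iterate_bound.
have [N|F FE _] := @wl1_ex _ m f (`|h| / (l - w)) f00.
  rewrite ler_pdivlMr//; apply: le_trans (fb N); rewrite mulr_suml.
  rewrite big_nat_cond [leRHS]big_nat_cond.
  apply: ler_sum => n /andP[/andP[n1 _] _].
  rewrite ger0_norm// mulrC ler_wpM2r ?mulr_ge0 ?powR_ge0// lerDl.
  by rewrite mulr_ge0 ?(ltW c0)// sg_ge0.
have adF N : \sum_(1 <= n < N) wt n * ((a n + d n) * `|F n|) <= `|h| / c.
  rewrite ler_pdivlMr//; apply: le_trans (fb N); rewrite mulr_suml.
  rewrite big_nat_cond [leRHS]big_nat_cond.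
  apply: ler_sum => n /andP[/andP[n1 _] _].
  rewrite FE ger0_norm//.
  have h1 : (a n + d n) * (c * (wt n * f n)) <= sg n * (c * (wt n * f n)).
    by rewrite ler_wpM2r ?sg_ge// !mulr_ge0 ?powR_ge0 ?(ltW c0).
  have h2 : 0 <= (l - w) * (wt n * f n).
    by rewrite !mulr_ge0 ?powR_ge0 ?(ltW lw0).
  lra.
have [De DF _] : exists2 G : X, Dplus_op d m (F, G) & `|G| <= `|h| / c.
  by apply: Dplus_ex; apply: weighted_le adF => n n1; rewrite lerDr a_ge0.
have [Bf BF _] : exists2 G : X, B_op a b m (F, G) & `|G| <= `|h| / c.
  by apply: B_ex; apply: weighted_le adF => n n1; rewrite lerDl d_ge0.
have eqn n : (1 <= n)%N ->
    (l + th n) * f n = h n + g n.-1 * f n.-1 + d n.+1 * f n.+1 + Bf n.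
  move=> n1.
  (* By the recursion, [s] is the limit of the truncated fragmentation sums of the iterates, in
     which truncation and iterate vary together. *)
  pose s := (l + th n) * f n - h n - g n.-1 * f n.-1 - d n.+1 * f n.+1.
  suff -> : Bf n = s by rewrite /s; ring.
  have hs : bsum n k.+1 (it k) @[k --> \oo] --> s.
    have hs' : ((l + th n) * it k.+1 n - h n - g n.-1 * it k n.-1 -
        d n.+1 * it k n.+1) @[k --> \oo] --> s.
      apply: cvgB; last by apply: cvgMl_tmp; exact: iterate_cvg.
      apply: cvgB; last by apply: cvgMl_tmp; exact: iterate_cvg.
      apply: cvgB; last exact: cvg_cst.
      apply: cvgMl_tmp.
      by rewrite (cvg_shiftS (fun k => it k n)); exact: iterate_cvg.
    apply: cvg_trans hs'; apply: near_eq_cvg; exists n => // k nk.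
    rewrite iterateS n1 nk mulrC divfK; last by rewrite gt_eqF// lth.
    ring.
  have hB : bsum n M f @[M --> \oo] --> Bf n.
    by have [_ /(_ n n1)] := BF; rewrite /= FE.
  (* Below: for fixed [M], the sum up to [M] is at most the one up to [k + 1] as soon as [k >= M].
     Above: each iterate is at most [f]. *)
  apply/eqP; rewrite eq_le; apply/andP; split.
    apply: (cvgr_to_le hB); apply: nearW => M.
    have hM : bsum n M (it k) @[k --> \oo] --> bsum n M f.
      apply: cvg_finite_sum => i; apply: cvgMl_tmp; exact: iterate_cvg.
    apply: (ler_cvg_to hM hs); exists M => // k /= Mk.
    by apply: bsum_le => // [i|]; [exact: iterate_ge0|exact: leqW].
  apply: (cvgr_to_le hs); apply: nearW => k.
  apply: (le_trans (bsum_mono k.+1 n1 (itf k))).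
  apply: (cvgr_to_ge hB); exists k.+1 => // M /= kM.
  exact: bsum_le.
exists F; first by move=> n; rewrite FE.
apply/YP; exists (l *: F - h - De - Bf), De, Bf; split=> //.
  move=> n n1; have [_ /(_ n n1) /= DFn] := DF.
  change (l * F n - h n - De n - Bf n = g n.-1 * F n.-1 - th n * F n).
  by rewrite DFn FE; have := eqn n n1; lra.
by rewrite [_ - Bf + De]addrAC !subrK.
Qed.

End minimal_solution.

Lemma Y_range l (h : X) : w < l -> exists F, Y_op a d g b m (F, l *: F - h).
Proof.
move=> wl.
(* [e = 1] and [e = -1] produce the positive and the negative part of [h]. *)
have part (e : R) : `|e| = 1 -> exists2 G : X, (forall n, 0 <= G n) &
    (forall n, G n = Num.max (e * h n) 0).
  move=> e1; have [|N|G GE _] := @wl1_ex _ m (fun n => Num.max (e * h n) 0) `|h|.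
  - by rewrite wl1_at0 mulr0 maxxx.
  - apply: le_trans (wl1_partial h N); apply: ler_sum => n _.
    rewrite ler_wpM2l ?powR_ge0// ger0_norm ?le_max ?lexx ?orbT//.
    rewrite ge_max normr_ge0 andbT (le_trans (ler_norm _))// normrM e1 mul1r.
    by [].
  by exists G => n; rewrite GE// le_max lexx orbT.
have [hp hp0 hpE] := part 1 (normr1 _).
have [hn hn0 hnE] : exists2 G : X, (forall n, 0 <= G n) &
    (forall n, G n = Num.max (-1 * h n) 0) by apply: part; rewrite normrN1.
have [Fp _ YFp] := Y_range_pos wl hp0; have [Fn _ YFn] := Y_range_pos wl hn0.
exists (Fp - Fn); have := Y_lin (-1) YFn YFp.
suff -> : -1 *: (Fn, l *: Fn - hn) + (Fp, l *: Fp - hp) =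
  (Fp - Fn, l *: (Fp - Fn) - h) by [].
apply: injective_projections => /=; first by rewrite scaleN1r addrC.
rewrite scaleN1r addrC scalerBr subrACA; congr (_ - _).
apply: wl1P => n _; change (hp n - hn n = h n).
rewrite hpE hnE mul1r mulN1r.
case: (leP 0 (h n)) => hh.
  by rewrite max_r ?oppr_le0// subr0.
by rewrite max_l ?oppr_ge0 ?(ltW hh)// sub0r opprK.
Qed.

Lemma Y_resolvent l : w < l -> exists Q, is_resolvent (Y_op a d g b m) l Q /\
  forall h, (l - w) * `|Q h| <= `|h|.
Proof.
move=> wl.
have dY : dissipative (Y_op a d g b m) w 0 w.
  by move=> l' u y wl' Yu; rewrite mul0r addr0; exact: Y_diss0.
have [Q [QR Qe]] := resolvent_ex wl (lexx 0) Y_lin dY (fun h => Y_range h wl).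
by exists Q; split=> // h; have := Qe h; rewrite mul0r addr0.
Qed.

Lemma truncation_ex (f : X) K : exists F : X,
  (forall n, (n <= K)%N -> F n = f n) /\ (forall n, (K < n)%N -> F n = 0).
Proof.
have [|N|F FE _] := @wl1_ex _ m (fun n => if (n <= K)%N then f n else 0) `|f|.
- by rewrite wl1_at0.
- apply: le_trans (wl1_partial f N); apply: ler_sum => n _.
  by rewrite ler_wpM2l ?powR_ge0//; case: ifP; rewrite // normr0.
exists F; split=> n; rewrite FE; first by move=> ->.
by rewrite ltnNge => /negbTE ->.
Qed.

Lemma finite_support_dom (p : nat -> R) (F : X) K :
  (forall n, (1 <= n)%N -> 0 <= p n) -> (forall n, (K < n)%N -> F n = 0) ->
  dom (diag_op m (fun n => - p n)) F.
Proof.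
move=> p0 FK; apply/diag_domP => //.
exists (\sum_(1 <= n < K.+1) wt n * (p n * `|F n|)) => N.
have t0 n : (1 <= n)%N -> 0 <= wt n * (p n * `|F n|).
  by move=> n1; rewrite !mulr_ge0 ?powR_ge0 ?p0.
have [NK|KN] := leqP N K.+1; first exact: ler_sum_ext.
rewrite (big_cat_nat (ltn0Sn K) (ltnW KN)) gerDl big_nat_cond.
by rewrite big1// => n /andP[/andP[kn _] _]; rewrite FK// normr0 !mulr0.
Qed.

Lemma truncation_dist (f F : X) K (C : R) : (forall n, (n <= K)%N -> F n = f n) ->
  (forall n, (K < n)%N -> F n = 0) ->
  (forall M, \sum_(K.+1 <= n < M) wt n * `|f n| <= C) -> `|f - F| <= C.
Proof.
move=> FK F0 hC; apply: wl1_norm_le => N.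
have E n : (1 <= n <= K)%N -> wt n * `|(f - F) n| = 0.
  by move=> /andP[_ nK]; rewrite wl1B FK// subrr normr0 mulr0.
have C0 : 0 <= C by have := hC 0%N; rewrite big_geq.
have [NK|KN] := leqP N K.+1.
  rewrite big_nat_cond big1// => n /andP[/andP[n1 nN] _]; apply: E.
  by rewrite n1 -ltnS (leq_trans nN).
apply: le_trans (hC N); rewrite (big_cat_nat (ltn0Sn K) (ltnW KN))/=.
rewrite [X in X + _]big_nat_cond [X in X + _]big1 ?add0r; last first.
  by move=> n /andP[/andP[n1 nK] _]; apply: E; rewrite n1.
rewrite big_nat_cond [leRHS]big_nat_cond.
apply: ler_sum => n /andP[/andP[kn _] _].
by change (wt n * `|f n - F n| <= wt n * `|f n|); rewrite F0// subr0.
Qed.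

Lemma T_dom_K : dom (T_op a d g m) `<=` dom (K_op a d g m).
Proof.
move=> _ [[u t] /= Tu <-].
have [G [_ GE] _] := Gminus_ex (diag_bound th_ge0 Tu).
exists (u, G + t) => // n n1.
change (G n + t n = g n.-1 * u n.-1 - th n * u n).
by rewrite (GE n n1) (Tu n n1) /= mulNr.
Qed.

Lemma Y_dense (f : X) (e : R) : 0 < e ->
  exists2 F, dom (Y_op a d g b m) F & `|f - F| <= e.
Proof.
move=> e0; have [K hK] := wl1_tail f e0.
have [F [FK F0]] := truncation_ex f K.
exists F; last exact: truncation_dist FK F0 hK.
by rewrite Y_dom; apply: T_dom_K; exact: finite_support_dom th_ge0 F0.
Qed.

Lemma Y_generation (c' : R) : 0 <= c' -> dissipative (Y_op a d g b m) w c' w ->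
  exists S : R -> X -> X, [/\ C0_semigroup S, positive_semigroup S,
    generator S = Y_op a d g b m & 0 < c' -> is_analytic S].
Proof.
move=> c'0 dY.
have [S [S0 SG SA SP]] := generation (wl1_complete m0) w0 c'0 Y_lin dY
  (fun l h wl => Y_range h wl) Y_dense.
exists S; split=> // t t0 f f0.
apply: (SP [set f : X | forall n, 0 <= f n]) => //.
- by move=> u v u0 v0 n; change (0 <= u n + v n); rewrite addr_ge0.
- by move=> s u s0 u0 n; change (0 <= s * u n); rewrite mulr_ge0.
- move=> u v u0 uv n; have h := wl1_coord_cvg m0 (n := n) uv.
  by apply: (cvgr_to_ge h); apply: nearW => k; exact: u0.
(* Dissipativity makes the solution unique, so [u] is the nonnegative one. *)
move=> l u h wl h0 Yu; have [F F0 YF] := Y_range_pos wl h0.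
suff -> : u = F by [].
have lw0 : 0 < l - w by rewrite subr_gt0.
have := Y_diss0 wl (Y_lin (-1) YF Yu); rewrite /= !scaleN1r.
have -> : l *: (- F + u) - (- (l *: F - h) + (l *: u - h)) = 0.
  rewrite ![- _ + _]addrC scalerBr [l *: u - h - _]subrACA.
  by rewrite subrr subr0 subrr.
rewrite normr0 pmulr_rle0// normr_le0 addrC subr_eq0 => /eqP.
exact.
Qed.

Lemma U_dom : dom (U_op a d g b m) = dom (T_op a d g m).
Proof.
apply/seteqP; split=> u.
  by move=> [[u' y] /= /UP[t [k [e [f [Tu _ _ _ _]]]]] <-]; exists (u', t).
move=> [[u' t] /= Tu <-].
have hC := diag_bound th_ge0 Tu.
have [k Gk _] := Gminus_ex hC.
have [e De _] : exists2 F : X, Dplus_op d m (u', F) & `|F| <= `|t|.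
  apply: Dplus_ex; apply: weighted_le hC => n n1.
  by rewrite /theta lerDr addr_ge0 ?a_ge0 ?hg.
have [f Bf _] : exists2 F : X, B_op a b m (u', F) & `|F| <= `|t|.
  apply: B_ex; apply: weighted_le hC => n n1.
  by rewrite /theta -addrA lerDl addr_ge0 ?hg ?d_ge0.
by exists (u', t + k + e + f) => //; apply/UP; exists t, k, e, f.
Qed.

Lemma TG_K (u t k : X) : T_op a d g m (u, t) -> Gminus_op a d g m (u, k) ->
  K_op a d g m (u, t + k).
Proof.
move=> Tu [_ Gu] n n1; change (t n + k n = g n.-1 * u n.-1 - th n * u n).
by rewrite (Tu n n1) (Gu n n1) /= mulNr addrC.
Qed.

Lemma U_sub_Y : U_op a d g b m `<=` Y_op a d g b m.
Proof.
move=> [u y] /UP[t [k [e [f [Tu Gu Du Bu ->]]]]].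
by apply/YP; exists (t + k), e, f; split=> //; exact: TG_K.
Qed.

(* The graph of [Y] is closed because it is the graph of the inverse of a
   bounded operator. *)
Lemma Y_closed : closed (Y_op a d g b m).
Proof.
move=> [f y] cl; pose l := w + 1.
have wl : w < l by rewrite ltrDl.
have [Q [[lQ cQ hQ] Qb]] := Y_resolvent wl.
have Qb' h : `|Q h| <= `|h| by have := Qb h; rewrite /l addrAC subrr add0r mul1r.
have l0 : 0 <= l by rewrite addr_ge0.
suff : Q (l *: f - y) = f by move/hQ; rewrite subKr.
apply/eqP; rewrite -subr_eq0 -normr_le0.
apply/ler_addgt0Pr => e e0; rewrite add0r.
pose e' := e / (l + 3).
have l30 : 0 < l + 3 by rewrite ltr_wpDl.
have e'0 : 0 < e' by rewrite divr_gt0.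
have [[u v] [Yu /=]] := cl _ (nbhsx_ballx (f, y) _ e'0).
rewrite -ball_normE /= prod_normE /= gt_max => /andP[/ltW fu /ltW yv].
have Qu : Q (l *: u - v) = u by apply/hQ; rewrite subKr.
have -> : Q (l *: f - y) - f = Q (l *: (f - u) - (y - v)) - (f - u).
  rewrite scalerBr subrACA (linB lQ) Qu.
  by rewrite opprB addrA subrK.
rewrite (le_trans (ler_normB _ _))//.
apply: (@le_trans _ _ ((l * e' + e') + e')).
  rewrite lerD// (le_trans (Qb' _))// (le_trans (ler_normB _ _))// lerD//.
  by rewrite normrZ (ger0_norm l0) ler_wpM2l.
have -> : l * e' + e' + e' = (l + 2) * e' by ring.
rewrite /e' mulrA ler_pdivrMr// mulrC ler_wpM2l ?(ltW e0)//.
by rewrite lerD2l ler_nat.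
Qed.

Lemma Y_functional (u y y' : X) : Y_op a d g b m (u, y) ->
  Y_op a d g b m (u, y') -> y = y'.
Proof.
move=> /YP[k [e [f [Ku [_ Du] [_ Bu] ->]]]] /YP[k' [e' [f' [Ku' [_ Du'] [_ Bu'] ->]]]].
congr (_ + _ + _); apply: wl1P => n n1.
- by rewrite (Ku n n1) (Ku' n n1).
- by rewrite (Du n n1) (Du' n n1).
- exact: (cvg_unique _ (Bu n n1) (Bu' n n1)).
Qed.

(* The cut-off [f 1_{n <= j}] only creates the boundary term [g_j f_j] at
   [j + 1]; as [n (a_n + d_n) |f_n| / n] is summable, it is small for some
   arbitrarily large [j]. *)
Lemma Y_closure (C : R) (N0 : nat) :
  (forall n, (N0 <= n)%N -> g n <= C * (n%:R * (a n + d n))) ->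
  Y_op a d g b m = closure (U_op a d g b m).
Proof.
move=> hgC; apply/seteqP; split; last first.
  by rewrite closureE => u; apply; split; [exact: Y_closed|exact: U_sub_Y].
move=> [f y] Yf S /nbhs_ballP[e /= e0 hS].
have [Cad hCad] := Y_ad Yf.
have /YP[k [_ [_ [Kf _ _ _]]]] := Yf.
(* The images will differ by at most [4 e']: two for [K], one each for death and fragmentation. *)
pose e' := e / 8; have e'0 : 0 < e' by rewrite divr_gt0.
have x0 n : (1 <= n)%N -> 0 <= wt n * ((a n + d n) * `|f n|).
  by move=> n1; rewrite !mulr_ge0 ?powR_ge0 ?ad_ge0.
have [N1 hN1] := wl1_tail f e'0.
have [N2 hN2] := wl1_tail k e'0.
have [N3 hN3] := bounded_sum_tail x0 hCad e'0.
(* The boundary term carries the weight of [j + 1], at most [2 ^ m] times that of [j]; [C] bounds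
   [g j] by [j (a j + d j)]. *)
pose C' := 2 `^ m * (`|C| + 1).
have C'0 : 0 < C' by rewrite mulr_gt0 ?powR_gt0// ltr_wpDl.
have d0 : 0 < e' / C' by rewrite divr_gt0.
have [j] := harmonic_small (maxn (maxn N0 1) (maxn N1 (maxn N2 N3))) x0 hCad d0.
rewrite !geq_max => /andP[/andP[N0j j1] /andP[N1j /andP[N2j N3j]]] hj.
have tail (x : nat -> R) N M : (forall n, (1 <= n)%N -> 0 <= x n) -> (N <= j)%N ->
    (forall M, \sum_(N.+1 <= n < M) x n <= e') -> \sum_(j.+1 <= n < M) x n <= e'.
  move=> xx0 Nj hx; have [Mj|jM] := leqP M j.+1; first by rewrite big_geq// ltW.
  apply: le_trans (hx M); rewrite [leRHS](@big_cat_nat _ _ _ j.+1)//= ?(ltnW jM)//.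
  rewrite lerDr big_nat_cond; apply: sumr_ge0 => n /andP[/andP[n1 _] _].
  by apply: xx0; exact: leq_trans n1.
have [F [FE F0]] := truncation_ex f j.
have [y' UF] : exists y', U_op a d g b m (F, y').
  have : dom (U_op a d g b m) F.
    by rewrite U_dom; exact: finite_support_dom th_ge0 F0.
  by move=> [[F' y'] /= UF <-]; exists y'.
have fF : `|f - F| <= e'.
  apply: (truncation_dist FE F0) => M.
  by apply: (tail _ N1) => // n n1; rewrite mulr_ge0 ?powR_ge0.
have YF := U_sub_Y UF; have /YP[kF [_ [_ [KF _ _ _]]]] := YF.
have Yd : Y_op a d g b m (f - F, y - y').
  have := Y_lin (-1) YF Yf; suff -> : -1 *: (F, y') + (f, y) = (f - F, y - y') by [].
  by apply: injective_projections => /=; rewrite scaleN1r addrC.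
have Kd : K_op a d g m (f - F, k - kF).
  move=> n n1; change (k n - kF n = g n.-1 * (f n.-1 - F n.-1) -
    th n * (f n - F n)).
  by rewrite (Kf n n1) (KF n n1) /=; ring.
have kk : `|k - kF| <= e' + e'.
  have bterm : wt j.+1 * (g j * `|f j|) <= e'.
    apply: (@le_trans _ _ (C' * (j%:R * (wt j * ((a j + d j) * `|f j|))))); last first.
      by rewrite mulrC -ler_pdivlMr.
    have h1 : g j * `|f j| <= (`|C| + 1) * (j%:R * (a j + d j)) * `|f j|.
      rewrite ler_wpM2r// (le_trans (hgC j N0j))// ler_wpM2r ?mulr_ge0 ?ad_ge0//.
      by rewrite (le_trans (ler_norm _))// lerDl.
    have h2 : wt j.+1 * (g j * `|f j|) <= (2 `^ m * wt j) *
        ((`|C| + 1) * (j%:R * (a j + d j)) * `|f j|).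
      by apply: ler_pM; rewrite ?powR_ge0 ?mulr_ge0 ?hg ?wt_double.
    by apply: (le_trans h2); rewrite le_eqVlt; apply/orP; left; apply/eqP;
      rewrite /C'; ring.
  apply: wl1_norm_le => N.
  (* Up to [j] the truncation changes nothing; beyond, the difference is the tail of [k], except at
     [j + 1], where the removed inflow [g j * f j] appears. *)
  pose z n := wt n * `|k n| *+ (j < n)%N + wt n * (g j * `|f j|) *+ (n == j.+1).
  have z0 n : 0 <= z n.
    by rewrite addr_ge0// mulrn_wge0// !mulr_ge0 ?powR_ge0 ?hg.
  apply: (@le_trans _ _ (\sum_(1 <= n < (maxn N j.+2)) z n)).
    apply: (@le_trans _ _ (\sum_(1 <= n < N) z n)); last first.
      by apply: ler_sum_ext => //; rewrite leq_maxl.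
    rewrite big_nat_cond [leRHS]big_nat_cond.
    apply: ler_sum => n /andP[/andP[n1 _] _].
    change (wt n * `|k n - kF n| <= z n).
    have -> : k n - kF n = g n.-1 * (f n.-1 - F n.-1) - th n * (f n - F n).
      exact: (Kd n n1).
    have [nj|jn] := leqP n j.
      by rewrite !FE// ?subrr ?mulr0 ?subrr ?normr0 ?mulr0// (leq_trans (leq_pred _)).
    rewrite (F0 n jn) /z jn mulr1n.
    have [->|nj] := eqVneq n j.+1.
      rewrite [_.-1]/= (FE j)// subrr mulr0 sub0r normrN subr0 mulr1n -mulrDr.
      rewrite ler_wpM2l ?powR_ge0//.
      have -> : th j.+1 * f j.+1 = g j * f j - k j.+1.
        by rewrite (Kf j.+1 (ltn0Sn j)) /= subKr.
      rewrite (le_trans (ler_normB _ _))// addrC lerD2l normrM ger0_norm ?hg//.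
    have jn1 : (j < n.-1)%N.
      case: n n1 jn nj => // n _.
      by rewrite ltnS eqSS leq_eqVlt eq_sym => /orP[/eqP ->|//]; rewrite eqxx.
    rewrite (F0 n.-1 jn1) !subr0 mulr0n addr0.
    by have := Kf n n1 => /= <-.
  rewrite big_split/=; apply: lerD.
    rewrite (@big_cat_nat _ _ _ j.+1)//= ?leq_max ?leqnSn ?orbT//.
    rewrite [X in X + _]big_nat_cond [X in X + _]big1 ?add0r; last first.
      by move=> n /andP[/andP[n1 nj] _]; rewrite ltnNge -ltnS nj mulr0n.
    apply: le_trans (tail _ N2 (maxn N j.+2) _ N2j hN2).
      rewrite big_nat_cond [leRHS]big_nat_cond.
      by apply: ler_sum => n /andP[/andP[jn _] _]; rewrite jn mulr1n.
    by move=> n n1; rewrite mulr_ge0 ?powR_ge0.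
  rewrite (@big_cat_nat _ _ _ j.+1)//= ?leq_max ?leqnSn ?orbT//.
  rewrite [X in X + _]big_nat_cond [X in X + _]big1 ?add0r; last first.
    by move=> n /andP[/andP[n1 nj] _]; rewrite ltn_eqF.
  rewrite big_ltn ?leq_max ?ltnSn ?orbT// eqxx mulr1n big_nat_cond big1 ?addr0//.
  by move=> n /andP[/andP[n1 _] _]; rewrite gtn_eqF.
have add N : \sum_(1 <= n < N) wt n * ((a n + d n) * `|(f - F) n|) <= e'.
  have t0 n : 0 <= wt n * ((a n + d n) * `|(f - F) n|) *+ (j < n)%N.
    case: n => [|n]; first by rewrite mulr0n.
    by rewrite mulrn_wge0// !mulr_ge0 ?powR_ge0 ?ad_ge0.
  apply: le_trans (tail _ N3 (maxn N j.+1) x0 N3j hN3).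
  apply: (@le_trans _ _ (\sum_(1 <= n < (maxn N j.+1))
      wt n * ((a n + d n) * `|(f - F) n|))).
    apply: ler_sum_ext; first exact: leq_maxl.
    by move=> n n1; rewrite !mulr_ge0 ?powR_ge0 ?ad_ge0.
  rewrite (@big_cat_nat _ _ _ j.+1)//= ?leq_max ?leqnn ?orbT//.
  rewrite [X in X + _]big_nat_cond [X in X + _]big1 ?add0r; last first.
    move=> n /andP[/andP[n1 nj] _]; change (wt n * ((a n + d n) * `|f n - F n|) = 0).
    by rewrite FE// subrr normr0 !mulr0.
  rewrite big_nat_cond [leRHS]big_nat_cond.
  apply: ler_sum => n /andP[/andP[jn _] _].
  change (wt n * ((a n + d n) * `|f n - F n|) <= wt n * ((a n + d n) * `|f n|)).
  by rewrite F0// subr0.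
have [y'' Yd' hy''] := Y_ex Kd add.
have yy : `|y - y'| <= e' + e' + e' + e'.
  rewrite (Y_functional Yd Yd') (le_trans hy'')// lerD2r lerD2r.
  exact: kk.
exists (F, y'); split=> //; apply: hS.
rewrite -ball_normE /= prod_normE /= gt_max.
by apply/andP; split; [apply: le_lt_trans fF _|apply: le_lt_trans yy _];
  rewrite /e'; lra.
Qed.

Lemma Y_compact l : (forall M : R, exists N, forall n, (N <= n)%N -> M <= a n + d n) ->
  w < l -> exists Q, is_resolvent (Y_op a d g b m) l Q /\ compact_operator Q.
Proof.
move=> adinf wl; have [Q [QR Qb]] := Y_resolvent wl; exists Q; split=> //.
have [_ _ hQ] := QR; have lw0 : 0 < l - w by rewrite subr_gt0.
pose S := [set f : X | `|f| <= (l - w)^-1 /\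
  forall N, \sum_(1 <= n < N) wt n * ((a n + d n) * `|f n|) <= c^-1].
have cS : compact S.
  apply: (@wl1_compact R m m0 (fun n => a n + d n) c^-1 (l - w)^-1).
    exact: ad_ge0.
  exact: adinf.
exists S; last first.
  by split; [exact: cS|exact: (compact_closed (@norm_hausdorff _ _) cS)].
move=> _ [h /= h1 <-]; split.
  by rewrite -(ler_pM2l lw0) mulfV ?gt_eqF// (le_trans (Qb h)).
have YQ : Y_op a d g b m (Q h, l *: Q h - h) by exact/hQ.
apply: (weighted_le sg_ge) => N.
rewrite -(ler_pM2l c0) mulfV ?gt_eqF//; apply: le_trans h1.
have := Y_resolvent_bound (ltW wl) YQ N; rewrite subKr; apply: le_trans.
rewrite mulr_sumr big_nat_cond [leRHS]big_nat_cond.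
apply: ler_sum => n /andP[/andP[n1 _] _].
have h2 : 0 <= (l - w) * (wt n * `|Q h n|).
  by rewrite !mulr_ge0 ?powR_ge0 ?(ltW lw0).
lra.
Qed.

Lemma T_dom_sum : dom (T_op a d g m) =
  dom (op_add (op_add (A_op a m) (G0_op g m)) (D0_op d m)).
Proof.
apply/seteqP; split=> u.
  move=> [[u' t] /= Tu <-]; have hC := diag_bound th_ge0 Tu.
  have [fa Aa _] : exists2 F : X, A_op a m (u', F) & `|F| <= `|t|.
    apply: diag_ex; first exact: a_ge0.
    apply: weighted_le hC => n n1.
    by rewrite /theta -addrA lerDl addr_ge0 ?hg ?d_ge0.
  have [fg Gg _] : exists2 F : X, G0_op g m (u', F) & `|F| <= `|t|.
    apply: diag_ex; first exact: hg.
    apply: weighted_le hC => n n1.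
    by rewrite /theta -addrAC lerDr addr_ge0 ?a_ge0 ?d_ge0.
  have [fd Dd _] : exists2 F : X, D0_op d m (u', F) & `|F| <= `|t|.
    apply: diag_ex; first exact: d_ge0.
    apply: weighted_le hC => n n1.
    by rewrite /theta lerDr addr_ge0 ?a_ge0 ?hg.
  exists (u', fa + fg + fd) => //; exists (fa + fg), fd; split=> //.
  by exists fa, fg.
move=> [[u' y] /= [h [fd [[fa [fg [/= Aa Gg _]]] /= Dd _]]] <-].
exists (u', fa + fg + fd) => // n n1.
change (fa n + fg n + fd n = - theta a d g n * u' n).
by rewrite (Aa n n1) (Gg n n1) (Dd n n1) /= /theta; ring.
Qed.

Section theta_domain.
Hypothesis sgE : forall n, (1 <= n)%N -> sg n = th n.

(** With weight [theta], [K_dom_bound] makes [theta u] itself summable, so the domain of [K] is no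
    larger than that of [T]. *)
Lemma U_eq_Y : U_op a d g b m = Y_op a d g b m.
Proof.
apply/seteqP; split=> [|[u y] Yu]; first exact: U_sub_Y.
have /YP[k [_ [_ [Ku _ _ _]]]] := Yu.
have : dom (U_op a d g b m) u.
  rewrite U_dom; apply/diag_domP; first exact: th_ge0.
  exists ((`|k| + w * `|u|) / c).
  apply: (weighted_le (q := sg)) => [n n1|N]; first by rewrite sgE.
  by rewrite ler_pdivlMr// mulrC; exact: K_dom_bound.
by move=> [[u' y'] /= Uu uE]; subst u'; rewrite (Y_functional Yu (U_sub_Y Uu)).
Qed.

Lemma Y_diss : dissipative (Y_op a d g b m) w (c / (2 `^ m + 3)) w.
Proof.
move=> l u y wl Yu; have lw0 : 0 < l - w by rewrite subr_gt0.
have m20 : 0 < 2 `^ m + 3 :> R by rewrite ltr_wpDl ?powR_ge0.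
have : U_op a d g b m (u, y) by rewrite U_eq_Y.
move=> /UP[t [k [e [f [Tu Gu Du Bu yE]]]]].
have hC := diag_bound th_ge0 Tu.
(* [2 ^ m] is the share of growth; the diagonal, death and fragmentation contribute 1 each. *)
have yt : `|y| <= (2 `^ m + 3) * `|t|.
  have [k' Gu' kb] := Gminus_ex hC.
  have [e' Du' eb] : exists2 F : X, Dplus_op d m (u, F) & `|F| <= `|t|.
    apply: Dplus_ex; apply: weighted_le hC => n n1.
    by rewrite /theta lerDr addr_ge0 ?a_ge0 ?hg.
  have [f' Bu' fb] : exists2 F : X, B_op a b m (u, F) & `|F| <= `|t|.
    apply: B_ex; apply: weighted_le hC => n n1.
    by rewrite /theta -addrA lerDl addr_ge0 ?hg ?d_ge0.
  have -> : y = t + k' + e' + f'.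
    apply: (Y_functional Yu); apply: U_sub_Y.
    by apply/UP; exists t, k', e', f'.
  have -> : (2 `^ m + 3) * `|t| = `|t| + 2 `^ m * `|t| + `|t| + `|t| by ring.
  rewrite (le_trans (ler_normD _ _))// lerD// (le_trans (ler_normD _ _))// lerD//.
  by rewrite (le_trans (ler_normD _ _))// lerD2l.
set H := `|l *: u - y|.
(* Two independent cut-offs, so that the norms of [u] and of [t] can be reached one after the
   other. *)
have key N N' : (l - w) * \sum_(1 <= n < N) wt n * `|u n| +
    c * \sum_(1 <= n < N') wt n * `|t n| <= H.
  apply: le_trans (Y_resolvent_bound (ltW wl) Yu (maxn N N')).
  apply: (@le_trans _ _ ((l - w) * \sum_(1 <= n < maxn N N') wt n * `|u n| +
    c * \sum_(1 <= n < maxn N N') wt n * `|t n|)).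
    apply: lerD; rewrite ler_wpM2l ?(ltW lw0) ?(ltW c0)//.
      apply: ler_sum_ext; first exact: leq_maxl.
      by move=> n _; rewrite mulr_ge0 ?powR_ge0.
    apply: ler_sum_ext; first exact: leq_maxr.
    by move=> n _; rewrite mulr_ge0 ?powR_ge0.
  rewrite !mulr_sumr -big_split/= big_nat_cond [leRHS]big_nat_cond.
  apply: ler_sum => n /andP[/andP[n1 _] _].
  rewrite (Tu n n1) /= mulNr normrN normrM (ger0_norm (th_ge0 n1)) sgE//.
  by rewrite le_eqVlt; apply/orP; left; apply/eqP; ring.
have ub N' : `|u| <= (H - c * \sum_(1 <= n < N') wt n * `|t n|) / (l - w).
  apply: wl1_norm_le => N; rewrite ler_pdivlMr// mulrC lerBrDr; exact: key.
have tb : `|t| <= (H - (l - w) * `|u|) / c.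
  apply: wl1_norm_le => N'; rewrite ler_pdivlMr//.
  by have := ub N'; rewrite ler_pdivlMr//; set s := \sum_(1 <= n < N') _; lra.
move: tb; rewrite ler_pdivlMr// mulrC => tb.
apply: (@le_trans _ _ ((l - w) * `|u| + c * `|t|)); last by lra.
rewrite lerD2l -mulrA ler_wpM2l ?(ltW c0)//.
by rewrite mulrC ler_pdivrMr// mulrC.
Qed.

End theta_domain.

End model.

(** * From the liminf conditions to column sums *)

Section asymptotics.
Context {R : realType}.

Lemma limn_einf_gt (u : nat -> \bar R) (x : R) : (x%:E < limn_einf u)%E ->
  exists2 y : R, x < y & exists N, forall n, (N <= n)%N -> (y%:E <= u n)%E.
Proof.
rewrite limn_einf_lim (cvg_lim _ (@cvg_einfs_sup _ u))//.
move=> /ereal_sup_gt[_ [N _ <-]] hN.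
have [y xy yN] : exists2 y : R, x < y & (y%:E <= einfs u N)%E.
  move: hN; case: (einfs u N) => [r| |] //=.
  - by rewrite lte_fin => xr; exists r.
  - by move=> _; exists (x + 1); rewrite ?ltrDl// leey.
exists y => //; exists N => n Nn; apply: (le_trans yN).
by apply: ereal_inf_lbound; exists n.
Qed.

(** After division by [n^m], the left side is the difference quotient of [x^m] at 1 with increment
    [1 / n], which tends to [m]. *)
Lemma powR_increment (m e : R) : 0 < e ->
  exists N, forall n, (N <= n)%N ->
    n%:R * (n.+1%:R `^ m - n%:R `^ m) <= (m + e) * n%:R `^ m.
Proof.
move=> e0; have D := is_derive1_powR m (@ltr01 R).
have cD : derivable (@powR R ^~ m) 1 1 by exact: ex_derive.
have lD : 'D_1 (@powR R ^~ m) 1 = m.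
  by rewrite derive_val powR1 mulr1.
have /cvgrPdist_le/(_ _ e0) := cD.
rewrite -/(derive (@powR R ^~ m) 1 1) lD => -[r /= r0 hr].
exists (Num.bound r^-1).+1 => n hn.
have n1 : (1 <= n)%N by exact: leq_trans hn.
have n0 : 0 < n%:R :> R by rewrite ltr0n.
have rn : r^-1 < n%:R.
  apply: (lt_le_trans (archi_boundP _)); first by rewrite invr_ge0 ltW.
  by rewrite ler_nat ltnW.
have := hr n%:R^-1; rewrite /ball_ /= sub0r normrN.
have ni0 : 0 < n%:R^-1 :> R by rewrite invr_gt0.
have nr : n%:R^-1 < r by rewrite invf_plt.
rewrite (gtr0_norm ni0) => /(_ nr (lt0r_neq0 ni0)).
rewrite invrK powR1 ler_distlC => /andP[_].
rewrite -lerBlDr.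
have -> : n.+1%:R `^ m = n%:R `^ m * (n%:R^-1 *: 1 + 1) `^ m :> R.
  rewrite -powRM ?ler0n ?addr_ge0 ?(ltW ni0)//; last first.
    by rewrite mulr_ge0// ltW.
  by rewrite mulrDr mulr1 scaler1 mulfV ?gt_eqF// -natr1 addrC.
set z := (_ `^ m) => h; rewrite /GRing.scale /= in h.
have := ler_wpM2r (powR_ge0 n%:R m) h; lra.
Qed.

(** All weights are at least 1, so the sum of the finitely many exceptional [|x k|] can serve as
    [w]. *)
Lemma finite_defect (q wt x y : nat -> R) N : (forall n, (1 <= n)%N -> 1 <= wt n) ->
  (forall n, (1 <= n)%N -> 0 <= y n) ->
  (forall n, (N <= n)%N -> x n <= q n + y n) ->
  (forall n, (1 <= n)%N -> 0 <= q n) ->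
  exists2 w, 0 <= w & forall n, (1 <= n)%N -> x n <= w * wt n + q n + y n.
Proof.
move=> wt1 y0 xy q0; pose w := \sum_(k < N) `|x k|.
have w0 : 0 <= w by rewrite sumr_ge0.
exists w => // n n1; have wn : w <= w * wt n by rewrite ler_peMr ?wt1.
have := q0 n n1; have := y0 n n1.
have [nN|Nn] := ltnP n N; last by have := xy _ Nn; lra.
have : x n <= w.
  apply: (le_trans (ler_norm _)).
  by rewrite /w (bigD1 (Ordinal nN))//= lerDl sumr_ge0.
lra.
Qed.

End asymptotics.

(** * The column-sum inequality from the coefficient conditions *)

Section coefficients.
Context {R : realType}.
Variables (a g d : nat -> R) (b : nat -> nat -> R).
Hypotheses (ha1 : a 1%N = 0) (ha : forall n, (2 <= n)%N -> 0 < a n)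
  (hg : forall n, (1 <= n)%N -> 0 <= g n)
  (hd1 : d 1%N = 0) (hd : forall n, (2 <= n)%N -> 0 <= d n)
  (hb : forall n i, (1 <= n)%N -> (n < i)%N -> 0 <= b n i)
  (hmass : forall i, (2 <= i)%N -> \sum_(1 <= n < i) n%:R * b n i = i%:R).
Implicit Types m k : R.

(** [Delta / n^m] increases with the exponent, because [(j / n)^k <= (j / n)^m] for [j < n]. This
    carries the condition of part 2 from [m] to every larger [k]. *)
Lemma Delta_ratio m k n : m <= k -> (1 <= n)%N ->
  Delta b m n * n%:R `^ k <= Delta b k n * n%:R `^ m.
Proof.
move=> mk n1; rewrite /Delta !mulrBl [leRHS]addrC mulrC [leRHS]addrC lerD2l lerN2.
rewrite !mulr_suml big_nat_cond [leRHS]big_nat_cond.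
apply: ler_sum => j /andP[/andP[j1 jn] _].
have nz i : (1 <= i)%N -> i%:R != 0 :> R by move=> i1; rewrite pnatr_eq0 -lt0n.
have E i : (1 <= i)%N -> i%:R `^ k = i%:R `^ m * i%:R `^ (k - m) :> R.
  by move=> i1; rewrite -powRD ?subrKC// nz// implybT.
rewrite (E j j1) (E n n1).
have h : j%:R `^ (k - m) <= n%:R `^ (k - m) :> R.
  by apply: powR_nat_mono; [rewrite subr_ge0|exact: ltnW].
have p0 : 0 <= j%:R `^ m * b j n * n%:R `^ m.
  by rewrite !mulr_ge0 ?powR_ge0 ?hb.
by have := ler_wpM2l p0 h; lra.
Qed.

Lemma liminf_Delta m x (t : nat -> R) : (forall n, (2 <= n)%N -> 0 < t n) ->
  (x%:E < limn_einf
      (fun n => (a n / t n * (Delta b m n / n%:R `^ m))%:E))%E ->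
  exists2 y, x < y & exists N, forall n, (N <= n)%N ->
    y * (t n * n%:R `^ m) <= a n * Delta b m n.
Proof.
move=> t0 /limn_einf_gt[y xy [N hN]]; exists y => //; exists (maxn 2 N) => n.
rewrite geq_max => /andP[n2 /hN]; rewrite lee_fin.
rewrite mulrACA -invfM ler_pdivlMr//.
by rewrite mulr_gt0 ?t0// powR_gt0// ltr0n ltnW.
Qed.

Lemma liminf_growth m' x : x < m' ->
  (m'%:E <= limn_einf (fun n => (n%:R * (a n + d n))%:E / (g n)%:E))%E ->
  exists N, forall n, (N <= n)%N -> x * g n <= n%:R * (a n + d n).
Proof.
move=> xm' hm'; have /limn_einf_gt[y xy [N hN]] :
    (x%:E < limn_einf (fun n => (n%:R * (a n + d n))%:E / (g n)%:E))%E.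
  by apply: lt_le_trans hm'; rewrite lte_fin.
exists (maxn 2 N) => n; rewrite geq_max => /andP[n2 /hN].
have n1 : (1 <= n)%N by exact: ltnW.
have adn := ad_ge0 ha1 ha hd1 hd n1.
(* For [g n = 0] the claim holds whatever the extended quotient is. *)
have [->|gn] := eqVneq (g n) 0; first by rewrite mulr0 mulr_ge0.
have g0 : 0 < g n by rewrite lt_neqAle eq_sym gn hg.
rewrite inver (negbTE gn) -EFinM lee_fin ler_pdivlMr//; apply: le_trans.
by rewrite ler_pM2r// ltW.
Qed.

(* The [n]-th column of the matrix has the [n ^ m]-weighted sum
   [(n+1)^m g_n - n^m theta_n + (n-1)^m d_n + a_n (n^m - Delta_n)]. *)
Definition balance m (sg : nat -> R) (w c : R) := forall n, (1 <= n)%N ->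
  (n.+1%:R `^ m - n%:R `^ m) * g n + c * (sg n * n%:R `^ m) <=
  w * n%:R `^ m + a n * Delta b m n + (n%:R `^ m - n.-1%:R `^ m) * d n.

Lemma balance_eventually m (sg : nat -> R) c N : 1 <= m ->
  (forall n, (N <= n)%N -> (n.+1%:R `^ m - n%:R `^ m) * g n +
     c * (sg n * n%:R `^ m) <= a n * Delta b m n) ->
  exists2 w, 0 <= w & balance m sg w c.
Proof.
move=> m1 hN; have m0 : 0 <= m by exact: le_trans m1.
have y0 n : (1 <= n)%N -> 0 <= (n%:R `^ m - n.-1%:R `^ m) * d n.
  move=> n1; rewrite mulr_ge0 ?(d_ge0 hd1 hd)// subr_ge0.
  by apply: powR_nat_mono => //; exact: leq_pred.
have q0 n : (1 <= n)%N -> 0 <= a n * Delta b m n.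
  by move=> n1; rewrite mulr_ge0 ?(a_ge0 ha1 ha) ?(Delta_ge0 hb hmass).
apply: (@finite_defect R _ _ _ _ (maxn 1 N)) => // [n|n]; first exact: powR_nat_ge1.
rewrite geq_max => /andP[n1 Nn]; apply: (le_trans (hN n Nn)).
by rewrite lerDl y0.
Qed.

(** To leading order growth contributes [m n^(m-1) g_n], which is at most
    [(m / m') (a_n + d_n) n^m], while fragmentation removes at least [y (a_n + d_n) n^m] with
    [y > m / m']. *)
Lemma balance_growth m m' : 1 < m -> m < m' ->
  (m'%:E <= limn_einf (fun n => (n%:R * (a n + d n))%:E / (g n)%:E))%E ->
  ((m / m')%:E < limn_einf
      (fun n => (a n / (a n + d n) * (Delta b m n / n%:R `^ m))%:E))%E ->
  exists w c, [/\ 0 <= w, 0 < c & balance m (fun n => a n + d n) w c].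
Proof.
move=> m1 mm' hg' hD.
have m0 : 0 < m by exact: lt_trans m1.
have m'0 : 0 < m' by exact: lt_trans mm'.
have ad0 n : (2 <= n)%N -> 0 < a n + d n.
  by move=> n2; rewrite ltr_wpDr ?ha ?hd.
have [y] := liminf_Delta ad0 hD.
set q := m / m' => qy [N1 hN1].
have q0 : 0 < q by rewrite divr_gt0.
(* Both asymptotic bounds lose a factor [1 + s]. As [s <= 1],
   [q (1 + s)^2 <= q + 3 q s <= (y + q) / 2], and [c = (y - q) / 2] is what remains below [y]. *)
pose s := Num.min 1 ((y - q) / (6 * q)).
have s0 : 0 < s by rewrite lt_min ltr01 divr_gt0 ?subr_gt0// mulr_gt0.
have s1 : s <= 1 by rewrite ge_min lexx.
have sq : q * s <= (y - q) / 6.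
  have : s <= (y - q) / (6 * q) by rewrite ge_min lexx orbT.
  by rewrite invfM mulrA ler_pdivlMr// mulrC.
have x0 : 0 < m' / (1 + s) by rewrite divr_gt0// addr_gt0.
have [|N2 hN2] := @liminf_growth m' (m' / (1 + s)) _ hg'.
  by rewrite ltr_pdivrMr ?addr_gt0// mulrDr mulr1 ltrDl mulr_gt0.
have [|N3 hN3] := @powR_increment R m (m * s); first by rewrite mulr_gt0.
pose c := (y - q) / 2; have c0 : 0 < c by rewrite divr_gt0 ?subr_gt0.
have [||w w0 hw] := @balance_eventually m (fun n => a n + d n) c
    (maxn 1 (maxn N1 (maxn N2 N3))); [exact: ltW| |by exists w, c].
move=> n; rewrite !geq_max => /and4P[n1 /hN1 h1 /hN2 h2 /hN3 h3].
have n0 : 0 < n%:R :> R by rewrite ltr0n.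
set W := n%:R `^ m in h1 h3 *; set I := _ - W in h3 *.
have W0 : 0 < W by rewrite powR_gt0.
have adn := ad_ge0 ha1 ha hd1 hd n1; have gn := hg n1.
apply: le_trans h1.
have h4 : I * g n <= q * (1 + s) ^+ 2 * ((a n + d n) * W).
  have h5 : (n%:R * I) * (m' / (1 + s) * g n) <=
      (m + m * s) * W * (n%:R * (a n + d n)).
    rewrite (le_trans (ler_wpM2r _ h3))//.
      by rewrite mulr_ge0 ?(ltW x0).
    by rewrite ler_wpM2l// !mulr_ge0 ?(ltW W0)// addr_ge0 ?mulr_ge0 ?(ltW m0) ?(ltW s0).
  have p0 : 0 < n%:R * (m' / (1 + s)) by rewrite mulr_gt0.
  rewrite -(ler_pM2l p0).
  have -> : n%:R * (m' / (1 + s)) * (I * g n) =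
    (n%:R * I) * (m' / (1 + s) * g n) by ring.
  apply: (le_trans h5); rewrite /q le_eqVlt; apply/orP; left; apply/eqP.
  by field; rewrite gt_eqF// gt_eqF// addr_gt0.
have h6 : q * (1 + s) ^+ 2 <= (y + q) / 2.
  have : q * s * s <= q * s by rewrite ler_piMr// mulr_ge0 ?(ltW q0) ?(ltW s0).
  lra.
have p0 : 0 <= (a n + d n) * W by rewrite mulr_ge0// ltW.
have := ler_wpM2r p0 h6; rewrite /c; lra.
Qed.

Lemma balance_theta m k : 1 < m -> m <= k ->
  (0%:E < limn_einf
      (fun n => (a n / theta a d g n * (Delta b m n / n%:R `^ m))%:E))%E ->
  exists w c, [/\ 0 <= w, 0 < c & balance k (theta a d g) w c].
Proof.
move=> m1 mk hD; have k1 : 1 <= k by exact: le_trans (ltW m1) mk.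
have t0 n : (2 <= n)%N -> 0 < theta a d g n.
  by move=> n2; rewrite /theta -addrA ltr_wpDr ?ha// addr_ge0 ?hd ?hg// ltnW.
have [y y0 [N1 hN1]] := liminf_Delta t0 hD.
have [N2 hN2] := @powR_increment R k 1 ltr01.
(* Half of the fragmentation term pays for growth, whose relative increment is at most
   [(k + 1) / n <= c] beyond [N3] while [g <= theta]; the other half is kept. *)
pose c := y / 2; have c0 : 0 < c by rewrite divr_gt0.
pose N3 := Num.bound ((k + 1) / c).
have [//||w w0 hw] := @balance_eventually k (theta a d g) c
    (maxn 1 (maxn N1 (maxn N2 N3))); last by exists w, c.
move=> n; rewrite !geq_max => /and4P[n1 /hN1 h1 /hN2 h2 n3].
have n0 : 0 < n%:R :> R by rewrite ltr0n.
have nc : (k + 1) <= c * n%:R.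
  rewrite mulrC -ler_pdivrMr//; apply: ltW.
  apply: lt_le_trans (archi_boundP _) _; last by rewrite ler_nat.
  by rewrite divr_ge0 ?(ltW c0)// addr_ge0// (le_trans _ k1).
have r := Delta_ratio mk n1.
set W := n%:R `^ k in h2 r *; set I := _ - W in h2 *.
set V := n%:R `^ m in h1 r; set D := Delta b k n in r *.
have W0 : 0 < W by rewrite powR_gt0.
have V0 : 0 < V by rewrite powR_gt0.
have thn := th_ge0 ha1 ha hg hd1 hd n1; have gn := hg n1.
have an := a_ge0 ha1 ha n1.
have h3 : y * (theta a d g n * W) <= a n * D.
  rewrite -(ler_pM2r V0) -[leRHS]mulrA.
  apply: le_trans (ler_wpM2l an r).
  have := ler_wpM2r (ltW W0) h1; lra.
have h4 : I <= c * W.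
  rewrite -(ler_pM2l n0); apply: (le_trans h2).
  by have := ler_wpM2r (ltW W0) nc; lra.
have gth : g n <= theta a d g n.
  by rewrite /theta addrAC lerDr addr_ge0 ?(d_ge0 hd1 hd).
apply: le_trans h3.
have h5 := ler_wpM2r gn h4.
have h6 := ler_wpM2l (mulr_ge0 (ltW c0) (ltW W0)) gth.
by rewrite /c in h5 h6 *; lra.
Qed.

End coefficients.

Theorem theorem2 (R : realType) (a g d : nat -> R) (b : nat -> nat -> R)
  (ha1 : a 1%N = 0) (ha : forall n, (2 <= n)%N -> 0 < a n)
  (hg : forall n, (1 <= n)%N -> 0 <= g n)
  (hd1 : d 1%N = 0) (hd : forall n, (2 <= n)%N -> 0 <= d n)
  (hb : forall n i, (1 <= n)%N -> (n < i)%N -> 0 <= b n i)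
  (hmass : forall i, (2 <= i)%N -> \sum_(1 <= n < i) n%:R * b n i = i%:R) :
  (forall m m' : R, 1 < m -> m < m' ->
    (m'%:E <= limn_einf (fun n => (n%:R * (a n + d n))%:E / (g n)%:E))%E ->
    ((m / m')%:E < limn_einf
      (fun n => (a n / (a n + d n) * (Delta b m n / n%:R `^ m))%:E))%E ->
    let K := K_op a d g m in
    let T := T_op a d g m in
    let U := U_op a d g b m in
    let Y := Y_op a d g b m in
    [/\ dom Y = dom K, dom U = dom T, Y = closure U,
        (exists S : R -> wl1 m -> wl1 m,
          [/\ C0_semigroup S, positive_semigroup S & generator S = Y])
      & limn_einf (fun n => (a n + d n)%:E) = +oo%E ->
        (\sum_(1 <= n <oo) (g n)%:E^-1 < +oo)%E \/
          (n%:R%:E / (g n)%:E)%E @[n --> \oo] --> 0%:E ->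
        exists l0 : R, forall l, l0 < l -> exists Q : wl1 m -> wl1 m,
          is_resolvent Y l Q /\ compact_operator Q]) /\
  (forall m : R, 1 < m ->
    (0%:E < limn_einf
      (fun n => (a n / theta a d g n * (Delta b m n / n%:R `^ m))%:E))%E ->
    forall k : R, m <= k ->
    let K := K_op a d g k in
    let T := T_op a d g k in
    let U := U_op a d g b k in
    let Y := Y_op a d g b k in
    [/\ dom Y = dom K,
        dom U = dom T /\
          dom T = dom (op_add (op_add (A_op a k) (G0_op g k)) (D0_op d k)),
        U = Y
      & exists S : R -> wl1 k -> wl1 k,
          [/\ C0_semigroup S, positive_semigroup S, is_analytic S
            & generator S = U]]).
Proof.
split=> [m m' m1 mm' hg' hD /=|m m1 hD k mk /=].
  have [w [c [w0 c0 H]]] :=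
    balance_growth ha1 ha hg hd1 hd hb hmass m1 mm' hg' hD.
  have m1' := ltW m1; have m'0 : 0 < m' by rewrite (lt_trans _ mm')// (lt_trans _ m1).
  have sg_ge n : (1 <= n)%N -> a n + d n <= a n + d n by [].
  split.
  - exact: (Y_dom ha1 ha hg hd1 hd hb hmass m1' w0 c0 sg_ge H).
  - exact: (U_dom ha1 ha hg hd1 hd hb hmass m1').
  (* The lower limit may equal [m'], so a smaller positive constant is taken; [m' / 2] is enough to
     bound [g n] by a multiple of [n (a n + d n)]. *)
  - have [|N hN] := liminf_growth ha1 ha hg hd1 hd (x := m' / 2) _ hg'; first by lra.
    apply: (Y_closure ha1 ha hg hd1 hd hb hmass m1' w0 c0 sg_ge H
      (C := (m' / 2)^-1) (N0 := N)) => n /hN h.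
    by rewrite mulrC ler_pdivlMr ?divr_gt0// mulrC.
  - have dY : dissipative (Y_op a d g b m) w 0 w.
      move=> l u y wl Yu; rewrite mul0r addr0.
      exact: (Y_diss0 ha1 ha hg hd1 hd hb hmass m1' w0 c0 sg_ge H wl Yu).
    have [S [C0 pos gen _]] := Y_generation ha1 ha hg hd1 hd hb hmass m1' w0 c0
      sg_ge H (lexx 0) dY.
    by exists S.
  - move=> hinf _; exists w => l wl.
    apply: (Y_compact ha1 ha hg hd1 hd hb hmass m1' w0 c0 sg_ge H _ wl) => M.
    have : (M%:E < limn_einf (fun n => (a n + d n)%:E))%E by rewrite hinf ltry.
    move=> /limn_einf_gt[y My [N hN]]; exists N => n /hN; rewrite lee_fin.
    exact: (le_trans (ltW My)).
have [w [c [w0 c0 H]]] := balance_theta ha1 ha hg hd1 hd hb hmass m1 mk hD.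
have k1 : 1 <= k by exact: le_trans (ltW m1) mk.
have sg_ge n : (1 <= n)%N -> a n + d n <= theta a d g n.
  by move=> n1; rewrite /theta addrAC lerDl hg.
have sgE n : (1 <= n)%N -> theta a d g n = theta a d g n by [].
have UY := U_eq_Y ha1 ha hg hd1 hd hb hmass k1 w0 c0 H sgE.
split=> //.
- exact: (Y_dom ha1 ha hg hd1 hd hb hmass k1 w0 c0 sg_ge H).
- split; first exact: (U_dom ha1 ha hg hd1 hd hb hmass k1).
  exact: (T_dom_sum ha1 ha hg hd1 hd).
have c'0 : 0 < c / (2 `^ k + 3).
  by rewrite divr_gt0// ltr_wpDl ?powR_ge0.
have [S [C0 pos gen an]] := Y_generation ha1 ha hg hd1 hd hb hmass k1 w0 c0
  sg_ge H (ltW c'0) (Y_diss ha1 ha hg hd1 hd hb hmass k1 w0 c0 sg_ge H sgE).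
by exists S; split=> //; [exact: an|rewrite gen UY].
Qed.
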